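(* Assume that $g$ satisfies hypotheses $(H_1)$ and $(H_2)$ (stated in the context). Then for every $\omega>0$ small enough the following holds. Let $(X,Y,\lambda)$, with $\lambda\in\mathbb{C}$, be a solution of the system $$L_-X=\lambda Y,\qquad L_+Y=\lambda X$$ such that $X,Y\in L^\infty(\mathbb{R})$ and $X',Y'\in H^1(\mathbb{R})$ (such a solution is called a resonance). Then either $X=Y=0$; or $\lambda=0$, $X\in\mathrm{span}(\phi_\omega)$ and $Y\in\mathrm{span}(\phi_\omega')$.
   Context: Let $g:[0,+\infty)\to\mathbb{R}$ and $G(s)=\int_0^s g$. $(H_1)$: $g\in C^5((0,+\infty))\cap C^1([0,+\infty))$; $g^{(k)}(s)=o(s^{1-k})$ as $s\to0^+$ for every integer $0\le k\le5$; and $g$ is not identically $0$ near $0$. For $\omega>0$ small, $\phi_\omega\in H^1(\mathbb{R})$ denotes the unique nontrivial, even, nonnegative solution vanishing at infinity of $\phi_\omega''=\omega\phi_\omega-\phi_\omega^3+\phi_\omega g(\phi_\omega^2)$ (it exists for all small $\omega>0$). Put $\varepsilon_\omega=\sup_{0\le s\le3\omega}|sg''(s)|$ (with $sg''(s)$ read as $0$ at $s=0$); under $(H_1)$, $\varepsilon_\omega$ is finite and nonzero for small $\omega>0$. $(H_2)$: $\displaystyle\lim_{\omega\to0^+}\frac{1}{\varepsilon_\omega^2\sqrt\omega}\int_{\mathbb{R}}\left(-3g(\phi_\omega^2)+\phi_\omega^2g'(\phi_\omega^2)+4\frac{G(\phi_\omega^2)}{\phi_\omega^2}\right)dx=+\infty.$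 The operators are $$L_+=-\partial_x^2+\omega-3\phi_\omega^2+g(\phi_\omega^2)+2\phi_\omega^2g'(\phi_\omega^2),\qquad L_-=-\partial_x^2+\omega-\phi_\omega^2+g(\phi_\omega^2).$$ Functions are complex-valued. *)

(* Defs.v *)
From HB Require Import structures.
From mathcomp Require Import all_boot all_order all_algebra.
From mathcomp Require Import all_classical all_reals all_analysis.
From mathcomp Require Import complex.

Set Implicit Arguments.
Unset Strict Implicit.
Unset Printing Implicit Defensive.
Import Order.TTheory GRing.Theory Num.Theory.
Import numFieldNormedType.Exports.
Local Open Scope classical_set_scope.
Local Open Scope ring_scope.

Definition test_function (R : realType) (theta : R -> R) : Prop :=
  (forall n x, derivable (derive1n n theta) x 1) /\
  compact (closure [set x | theta x != 0]).

Definition weak_derivative (R : realType) (u v : R -> R) : Prop :=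
  [/\ locally_integrable setT u, locally_integrable setT v &
   forall theta : R -> R, test_function theta ->
     \int[@lebesgue_measure R]_x (u x * derive1 theta x) =
     - \int[@lebesgue_measure R]_x (v x * theta x)].

Definition sobolevH1 (R : realType) (u : R -> R) : Prop :=
  u \in Lfun (@lebesgue_measure R) 2%:E /\
  exists v, weak_derivative u v /\ v \in Lfun (@lebesgue_measure R) 2%:E.

(* Complex-valued versions are componentwise; in particular the derivatives
   are taken with respect to the real variable. *)
Definition on_components (R : realType) (P : (R -> R) -> Prop)
    (X : R -> R[i]) : Prop :=
  P (fun x => complex.Re (X x)) /\ P (fun x => complex.Im (X x)).

Definition weak_derivativeC (R : realType) (X X1 : R -> R[i]) : Prop :=
  weak_derivative (fun x => complex.Re (X x)) (fun x => complex.Re (X1 x)) /\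
  weak_derivative (fun x => complex.Im (X x)) (fun x => complex.Im (X1 x)).

Definition sobolevH1C (R : realType) (X : R -> R[i]) : Prop :=
  on_components (@sobolevH1 R) X.

Definition LinftyC (R : realType) (X : R -> R[i]) : Prop :=
  on_components (fun u => u \in Lfun (@lebesgue_measure R) +oo%E) X.

(* A function on [0, +oo[ is represented by a total g : R -> R whose values at
   negative arguments play no role: the two-sided derivatives [derive1n k g] are
   only evaluated at s > 0, or multiplied by s = 0 (in [epsilon]). *)
Definition C5_pos (R : realType) (g : R -> R) : Prop :=
  (forall k s, (k < 5)%N -> 0 < s -> derivable (derive1n k g) s 1) /\
  (forall s, 0 < s -> {for s, continuous (derive1n 5 g)}).

(* For g in C^1(]0, +oo[), this says that g is in C^1([0, +oo[); d is the right
   derivative of g at 0. *)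
Definition C1_at_zero (R : realType) (g : R -> R) : Prop :=
  exists d : R, ((g h - g 0) / h @[h --> 0^'+] --> d) /\
                (derive1 g s @[s --> 0^'+] --> d).

Definition hypH1 (R : realType) (g : R -> R) : Prop :=
  [/\ C5_pos g, C1_at_zero g,
      forall k : nat, (k <= 5)%N ->
        derive1n k g s / s ^ (1 - k%:Z) @[s --> 0^'+] --> 0 &
      ~ (\forall s \near 0^'+, g s = 0)].

(* Used for s >= 0 only. *)
Definition primitive0 (R : realType) (g : R -> R) (s : R) : R :=
  \int[@lebesgue_measure R]_(t in `[0, s]) g t.

Definition is_soliton (R : realType) (g : R -> R) (omega : R) (phi : R -> R)
    : Prop :=
  [/\ sobolevH1 phi,
      (forall x, derivable phi x 1 /\ derivable (derive1 phi) x 1),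
      (forall x, derive1n 2 phi x =
         omega * phi x - phi x ^+ 3 + phi x * g (phi x ^+ 2)) &
      [/\ exists x, phi x != 0,
          forall x, phi (- x) = phi x,
          forall x, 0 <= phi x,
          phi x @[x --> +oo] --> 0 &
          phi x @[x --> -oo] --> 0]].

Definition epsilon (R : realType) (g : R -> R) (omega : R) : R :=
  sup [set `|s * derive1n 2 g s| | s in `[0, 3 * omega]].

Definition hypH2 (R : realType) (g : R -> R) (phi : R -> R -> R) : Prop :=
  (epsilon g omega ^+ 2 * Num.sqrt omega)^-1 *
    \int[@lebesgue_measure R]_x
      (- 3 * g (phi omega x ^+ 2)
       + phi omega x ^+ 2 * derive1 g (phi omega x ^+ 2)
       + 4 * (primitive0 g (phi omega x ^+ 2) / phi omega x ^+ 2))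
  @[omega --> 0^'+] --> +oo.

(* [X2] is the second weak derivative of [X]. *)
Definition schrodinger (R : realType) (V : R -> R) (X X2 : R -> R[i]) (x : R)
    : R[i] :=
  - X2 x + (V x)%:C%C * X x.

Definition Lplus (R : realType) (g : R -> R) (omega : R) (phi : R -> R)
    : (R -> R[i]) -> (R -> R[i]) -> R -> R[i] :=
  schrodinger (fun x => omega - 3 * phi x ^+ 2 + g (phi x ^+ 2)
                        + 2 * phi x ^+ 2 * derive1 g (phi x ^+ 2)).

Definition Lminus (R : realType) (g : R -> R) (omega : R) (phi : R -> R)
    : (R -> R[i]) -> (R -> R[i]) -> R -> R[i] :=
  schrodinger (fun x => omega - phi x ^+ 2 + g (phi x ^+ 2)).

(* Functions are taken up to a.e. equality and the derivatives X', X'', Y', Y''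
   (here X1, X2, Y1, Y2) are weak; they are unique up to a.e. equality. *)
Definition is_resonance (R : realType) (g : R -> R) (omega : R) (phi : R -> R)
    (X Y : R -> R[i]) (lambda : R[i]) : Prop :=
  LinftyC X /\ LinftyC Y /\
  exists X1 X2 Y1 Y2 : R -> R[i],
    [/\ weak_derivativeC X X1 /\ weak_derivativeC X1 X2,
        weak_derivativeC Y Y1 /\ weak_derivativeC Y1 Y2,
        sobolevH1C X1 /\ sobolevH1C Y1,
        {ae @lebesgue_measure R, forall x,
           Lminus g omega phi X X2 x = lambda * Y x} &
        {ae @lebesgue_measure R, forall x,
           Lplus g omega phi Y Y2 x = lambda * X x}].

(* Main.v *)
Require Import Defs.
From HB Require Import structures.
From mathcomp Require Import all_boot all_order all_algebra.
From mathcomp Require Import all_classical all_reals all_analysis.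
From mathcomp Require Import measurable_realfun ess_sup_inf complex ring lra.

Set Implicit Arguments.
Unset Strict Implicit.
Unset Printing Implicit Defensive.
Import Order.TTheory GRing.Theory Num.Theory.
Import numFieldNormedType.Exports ComplexField.Normc.
Local Open Scope classical_set_scope.
Local Open Scope ring_scope.

(** Resonances are first shown to be classical solutions with X' and Y' tending
    to 0 at both ends. Weak derivatives are integrated by testing against smooth
    plateaus at Lebesgue points ([weak_derivative_primitive]); boundedness of the
    source terms then makes X' and Y' Lipschitz, and square-integrable Lipschitz
    functions tend to 0 ([resonance_classical]).

    For lambda = 0 the two equations decouple. The Wronskian with phi, or with
    phi', is constant and vanishes at infinity ([kernel_Lminus],
    [kernel_Lplus]).

    For lambda <> 0, let psi = phi'/phi and S = d/dx - psi. For the cubic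
    equation S^2 conjugates the linearized system to one with constant
    coefficients. Here it leads to functions V and W with
      - V'' + (omega + am) V = lambda W,  - W'' + (omega + ap) W = lambda V,
    and both am and ap are O(epsilon phi^2): they vanish when g is linear, so that
    only s g''(s) enters ([aplus_le], [aminus_le]). The potentials being explicit,
    this is a polynomial identity in psi, phi^2, g(phi^2), g'(phi^2) and
    G(phi^2)/phi^2 ([cderV1], [cderW1]), and the injectivity of
    (X, Y) -> (V, W) follows from another one ([darboux_injective]).

    By symmetry 0 <= Re lambda. Then p = V + W and q = V - W satisfy
      p'' = k^2 p + s p + d q,  q'' = m^2 q + d p + s q,
    where k^2 = omega - lambda, m^2 = omega + lambda, 0 <= Re k,
    |m| >= sqrt omega, and where s = (ap + am) / 2 is the integrand of the
    hypothesis on phi. For every such k, real or imaginary or neither, p' + k p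
    tends to 0 at +oo and - p' + k p at -oo, since X' and Y' do
    ([outgoing_tail]): when lambda > omega no wave subsists at infinity. Hence
    p' + k p is controlled by the source on the right half-line only, uniformly
    in k, and likewise on the left. Integrating it gives
      2 k p(0) = - p(0) * (integral of s) + O(epsilon |k| + epsilon^2 sqrt omega) p(0),
    while q is of size epsilon. As 0 <= Re k and the integral of s is positive
    and much larger than epsilon^2 sqrt omega, p(0) = 0, and then p = q = 0
    ([coupled_trivial]). No case distinction on lambda is involved.

    The weight phi^2 needs no explicit decay: the first integral of the soliton
    equation gives phi^2 <= - 4 psi' with psi bounded by sqrt omega, and
    psi + sqrt omega <= phi^2 / sqrt omega on the right half-line ([rho_le_psi'],
    [psi_tail]). *)

(** * Differential inequalities *)

Definition der (R : realType) (f : R -> R) (x a : R) : Prop :=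
  is_derive x 1 f a.

Section RealDerivatives.
Context {R : realType}.
Implicit Types (f g : R -> R) (a b x : R).

Lemma derD f g x a b : der f x a -> der g x b ->
  der (fun y => f y + g y) x (a + b).
Proof. exact: is_deriveD. Qed.

Lemma derN f x a : der f x a -> der (fun y => - f y) x (- a).
Proof. exact: is_deriveN. Qed.

Lemma derB f g x a b : der f x a -> der g x b ->
  der (fun y => f y - g y) x (a - b).
Proof. exact: is_deriveB. Qed.

Lemma derM f g x a b : der f x a -> der g x b ->
  der (fun y => f y * g y) x (a * g x + f x * b).
Proof.
move=> df dg; apply: (is_derive_eq (is_deriveM df dg)).
by rewrite /GRing.scale /= addrC mulrC.
Qed.

Lemma derC (c : R) x : der (fun=> c) x 0.
Proof. exact: is_derive_cst. Qed.

Lemma der_id x : der (fun y : R => y) x 1.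
Proof. exact: is_derive_id. Qed.

Lemma derZ (c : R) f x a : der f x a -> der (fun y => c * f y) x (c * a).
Proof. by move=> df; have := derM (derC c x) df; rewrite mul0r add0r. Qed.

Lemma der_comp f g x a b : der f x a -> der g (f x) b ->
  der (fun y => g (f y)) x (b * a).
Proof.
exact: (fun df dg => @is_derive1_comp R g f x b a dg df).
Qed.

Lemma derX2 f x a : der f x a -> der (fun y => f y ^+ 2) x (2 * f x * a).
Proof.
move=> df; have := derM df df; congr (der _ _ _); last by ring.
Qed.

Lemma derV f x a : der f x a -> f x != 0 ->
  der (fun y => (f y)^-1) x (- a / f x ^+ 2).
Proof.
move=> df fx0; apply: (is_derive_eq (is_deriveV fx0 df)).
by rewrite /GRing.scale /= mulNr mulrC mulNr.
Qed.

Lemma der_flip f x a : der f (- x) a -> der (fun y => f (- y)) x (- a).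
Proof.
move=> df; have := der_comp (derN (der_id x)) df.
by rewrite mulrN1.
Qed.

Lemma der_eq f x a b : der f x a -> a = b -> der f x b.
Proof. by move=> df <-. Qed.

Lemma der_cont f x a : der f x a -> {for x, continuous f}.
Proof. by move=> [df _]; apply/differentiable_continuous/derivable1_diffP. Qed.

Lemma der_unique f x a b : der f x a -> der f x b -> a = b.
Proof. by move=> df dg; rewrite -(@derive_val _ _ _ _ _ _ _ df) (@derive_val _ _ _ _ _ _ _ dg). Qed.

Lemma der_derive1 f x : derivable f x 1 -> der f x (derive1 f x).
Proof. by rewrite /der derive1E => /derivableP. Qed.

Lemma derive1_val f x a : der f x a -> derive1 f x = a.
Proof. by move=> df; rewrite derive1E (@derive_val _ _ _ _ _ _ _ df). Qed.

Lemma der_mvt f (f' : R -> R) a b : a <= b ->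
  (forall x, a <= x <= b -> der f x (f' x)) ->
  exists2 c, a <= c <= b & f b - f a = f' c * (b - a).
Proof.
move=> ab df; have [||c + fE] := @MVT_segment R f f' a b ab.
- by move=> x /itvP xab; apply: df; rewrite !xab.
- apply: derivable_within_continuous => x; rewrite in_itv /= => xab.
  by have [] := df x xab.
- by rewrite in_itv /= => cab; exists c.
Qed.

Lemma der_ge0_le f (f' : R -> R) a b : a <= b ->
  (forall x, a <= x <= b -> der f x (f' x)) ->
  (forall x, a <= x <= b -> 0 <= f' x) -> f a <= f b.
Proof.
move=> ab df f'0; have [c cab fE] := der_mvt ab df.
by rewrite -subr_ge0 fE mulr_ge0 ?f'0 ?subr_ge0.
Qed.

Lemma der_le_le f g (f' g' : R -> R) a b : a <= b ->
  (forall x, a <= x <= b -> der f x (f' x)) ->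
  (forall x, a <= x <= b -> der g x (g' x)) ->
  (forall x, a <= x <= b -> f' x <= g' x) -> f b - f a <= g b - g a.
Proof.
move=> ab df dg fg.
suff : g a - f a <= g b - f b by lra.
apply: (@der_ge0_le (fun x => g x - f x) (fun x => g' x - f' x)) => // x xab.
  by apply: derB; [exact: dg|exact: df].
by rewrite subr_ge0 fg.
Qed.

Lemma der_0_cst f : (forall x, der f x 0) -> forall x y, f x = f y.
Proof.
move=> df x y; wlog xy : x y / x <= y.
  move=> H; have [/H //|/ltW/H //] := leP x y.
have [c _ +] := @der_mvt f (fun=> 0) x y xy (fun z _ => df z).
by rewrite mul0r => /eqP; rewrite subr_eq0 => /eqP.
Qed.

(** Gronwall: the factor e^(K x) turns the two-sided bound on the derivative
    into monotonicity in either direction. *)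
Lemma gronwall0 f (f' : R -> R) (K x0 : R) :
  (forall x, der f x (f' x)) -> (forall x, 0 <= f x) ->
  (forall x, `|f' x| <= K * f x) -> f x0 = 0 -> forall x, f x = 0.
Proof.
move=> df f0 f'K fx0 x.
have dexp (c y : R) : der (fun y => expR (c * y)) y (expR (c * y) * c).
  have := der_comp (derZ c (der_id y)) (@is_derive_expR _ (c * y)).
  by rewrite mulr1.
have bnd y : - (K * f y) <= f' y <= K * f y by rewrite -ler_norml.
apply/eqP; rewrite eq_le f0 andbT; have [xx0|/ltW xx0] := leP x0 x.
  have := @der_ge0_le (fun y => - (f y * expR (- K * y)))
    (fun y => - (f' y * expR (- K * y) + f y * (expR (- K * y) * - K)))
    x0 x xx0 (fun y _ => derN (derM (df y) (dexp _ y))).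
  rewrite fx0 mul0r oppr0 oppr_ge0 => H.
  rewrite -(pmulr_lle0 _ (expR_gt0 (- K * x))); apply: H => y _.
  have [_ h] := andP (bnd y).
  rewrite [X in 0 <= X](_ : _ = (K * f y - f' y) * expR (- K * y)); last by ring.
  by rewrite mulr_ge0 ?expR_ge0 // subr_ge0.
have := @der_ge0_le (fun y => f y * expR (K * y))
    (fun y => f' y * expR (K * y) + f y * (expR (K * y) * K))
    x x0 xx0 (fun y _ => derM (df y) (dexp _ y)).
rewrite fx0 mul0r => H.
rewrite -(pmulr_lle0 _ (expR_gt0 (K * x))); apply: H => y _.
have [h _] := andP (bnd y).
rewrite [X in 0 <= X](_ : _ = (K * f y + f' y) * expR (K * y)); last by ring.
by rewrite mulr_ge0 ?expR_ge0 //; lra.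
Qed.

(** Gronwall's lemma for the energy z^2 + z'^2. *)
Lemma second_order_unique (z z1 U : R -> R) (K x0 : R) :
  (forall x, der z x (z1 x)) -> (forall x, der z1 x (U x * z x)) ->
  (forall x, `|U x| <= K) -> z x0 = 0 -> z1 x0 = 0 -> forall x, z x = 0.
Proof.
move=> dz dz1 UK zx0 z1x0 x.
pose E y := z y ^+ 2 + z1 y ^+ 2.
have dE y : der E y (2 * (1 + U y) * (z y * z1 y)).
  by apply: (der_eq (derD (derX2 (dz y)) (derX2 (dz1 y)))); ring.
have EK y : `|2 * (1 + U y) * (z y * z1 y)| <= (1 + K) * E y.
  rewrite -mulrA normrM (gtr0_norm (ltr0Sn _ _)) normrM.
  have h1 : `|1 + U y| <= 1 + K.
    by apply: le_trans (ler_normD _ _) _; rewrite normr1 lerD2l.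
  have h2 : 2 * `|z y * z1 y| <= E y.
    rewrite normrM /E -(real_normK (num_real (z y))).
    rewrite -(real_normK (num_real (z1 y))).
    by have := sqr_ge0 (`|z y| - `|z1 y|); rewrite sqrrB; lra.
  by rewrite mulrCA; apply: ler_pM => //; rewrite ?mulr_ge0.
have E0 : E x = 0.
  apply: (gronwall0 dE _ EK (x0 := x0)) => [y|].
    by rewrite addr_ge0 ?sqr_ge0.
  by rewrite /E zx0 z1x0 !expr0n addr0.
have := sqr_ge0 (z x); have := sqr_ge0 (z1 x); move: E0; rewrite /E.
by move=> h1 h2 h3; apply/eqP; rewrite -sqrf_eq0 eq_le h3 andbT; lra.
Qed.

Lemma der_ge0_le_lim f (f' : R -> R) a (l : R) :
  (forall x, a <= x -> der f x (f' x)) ->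
  (forall x, a <= x -> 0 <= f' x) ->
  f x @[x --> +oo] --> l -> f a <= l.
Proof.
move=> df f'0 fl; apply: (cvgr_to_ge fl).
exists a; split => [|x /ltW ax]; first exact: num_real.
by apply: (@der_ge0_le f f') => // y /andP[ay _]; [exact: df|exact: f'0].
Qed.

Lemma cvgy_near f (l e : R) : f x @[x --> +oo] --> l -> 0 < e ->
  exists M : R, forall x, M <= x -> `|f x - l| <= e.
Proof.
move=> /cvgrPdist_le fl /fl [M [_ H]]; exists (M + 1) => x Mx.
by rewrite distrC; apply: H; apply: lt_le_trans Mx; rewrite ltrDl.
Qed.

Lemma near_cvgy f (l : R) : (forall e, 0 < e ->
  exists M : R, forall x, M <= x -> `|f x - l| <= e) ->
  f x @[x --> +oo] --> l.
Proof.
move=> H; apply/cvgrPdist_le => e /H [M HM]; exists M; split.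
  exact: num_real.
by move=> x /ltW /HM; rewrite distrC.
Qed.

End RealDerivatives.

(** * Complex-valued functions of a real variable *)

Definition cder (R : realType) (X : R -> R[i]) (x : R) (d : R[i]) : Prop :=
  der (fun y => complex.Re (X y)) x (complex.Re d) /\
  der (fun y => complex.Im (X y)) x (complex.Im d).

Section ComplexDerivatives.
Context {R : realType}.
Implicit Types (X Y : R -> R[i]) (c d e : R[i]) (x : R).

Lemma Re_add c d : complex.Re (c + d) = complex.Re c + complex.Re d.
Proof. by case: c d => [? ?] [? ?]. Qed.
Lemma Im_add c d : complex.Im (c + d) = complex.Im c + complex.Im d.
Proof. by case: c d => [? ?] [? ?]. Qed.
Lemma Re_opp c : complex.Re (- c) = - complex.Re c.
Proof. by case: c => [? ?]. Qed.
Lemma Im_opp c : complex.Im (- c) = - complex.Im c.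
Proof. by case: c => [? ?]. Qed.
Lemma Re_mul c d : complex.Re (c * d) =
  complex.Re c * complex.Re d - complex.Im c * complex.Im d.
Proof. by case: c d => [? ?] [? ?]. Qed.
Lemma Im_mul c d : complex.Im (c * d) =
  complex.Re c * complex.Im d + complex.Im c * complex.Re d.
Proof. by case: c d => [? ?] [? ?]. Qed.
Definition ReIm := (Re_add, Im_add, Re_opp, Im_opp, Re_mul, Im_mul).

Lemma complex_eq c d : complex.Re c = complex.Re d ->
  complex.Im c = complex.Im d -> c = d.
Proof. by case: c d => [? ?] [? ?] /= -> ->. Qed.

Lemma normc_sqrtE c :
  normc c = Num.sqrt (complex.Re c ^+ 2 + complex.Im c ^+ 2).
Proof. by case: c. Qed.

Lemma normc_ge0 c : 0 <= normc c.
Proof. by rewrite normc_sqrtE sqrtr_ge0. Qed.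

Lemma normc_sqr c : normc c ^+ 2 = complex.Re c ^+ 2 + complex.Im c ^+ 2.
Proof. by rewrite normc_sqrtE sqr_sqrtr // addr_ge0 // sqr_ge0. Qed.

Lemma normc_real (a : R) : normc a%:C%C = `|a|.
Proof. by rewrite normc_sqrtE /= expr0n addr0 sqrtr_sqr. Qed.

Lemma normc_zero : normc (0 : R[i]) = 0.
Proof. by rewrite normc_sqrtE /= expr0n /= addr0 sqrtr0. Qed.

Lemma normc_add c d : normc (c + d) <= normc c + normc d.
Proof. exact: le_normcD. Qed.

Lemma normc_opp c : normc (- c) = normc c.
Proof. exact: complex.normcN. Qed.

Lemma normc_sub c d : normc (c - d) <= normc c + normc d.
Proof. by rewrite -[X in _ <= _ + X]normc_opp normc_add. Qed.

Lemma normc_eq0 c : normc c <= 0 -> c = 0.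
Proof.
move=> c0; apply: ComplexField.Normc.eq0_normc.
by apply/eqP; rewrite eq_le c0 normc_ge0.
Qed.

Lemma Re_le_normc c : `|complex.Re c| <= normc c.
Proof.
rewrite -ler_sqr ?nnegrE ?normc_ge0 // real_normK ?num_real // normc_sqr lerDl; exact: sqr_ge0.
Qed.

Lemma normc_le_ReIm c : normc c <= `|complex.Re c| + `|complex.Im c|.
Proof.
rewrite -ler_sqr ?nnegrE ?normc_ge0 ?addr_ge0 // normc_sqr.
rewrite -(real_normK (num_real (complex.Re c))) -(real_normK (num_real (complex.Im c))).
have := mulr_ge0 (normr_ge0 (complex.Re c)) (normr_ge0 (complex.Im c)).
by nra.
Qed.

Lemma dot_le_normc c d : complex.Re c * complex.Re d + complex.Im c * complex.Im d
  <= normc c * normc d.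
Proof.
rewrite (_ : _ + _ = complex.Re (c * (d^*)%C)); last first.
  by case: c d => [? ?] [? ?] /=; ring.
apply: le_trans (ler_norm _) _; apply: le_trans (Re_le_normc _) _.
by rewrite normcM !normc_sqrtE; case: d => ? ? /=; rewrite sqrrN.
Qed.

Lemma cderD X Y x c d : cder X x c -> cder Y x d ->
  cder (fun y => X y + Y y) x (c + d).
Proof.
move=> [X1 X2] [Y1 Y2]; split; rewrite ?ReIm.
  by under eq_fun do rewrite ReIm; exact: derD.
by under eq_fun do rewrite ReIm; exact: derD.
Qed.

Lemma cderN X x c : cder X x c -> cder (fun y => - X y) x (- c).
Proof.
move=> [X1 X2]; split; rewrite ?ReIm.
  by under eq_fun do rewrite ReIm; exact: derN.
by under eq_fun do rewrite ReIm; exact: derN.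
Qed.

Lemma cderB X Y x c d : cder X x c -> cder Y x d ->
  cder (fun y => X y - Y y) x (c - d).
Proof. by move=> dX dY; apply: cderD dX (cderN dY). Qed.

Lemma cderZ X x c d : cder X x d -> cder (fun y => c * X y) x (c * d).
Proof.
move=> [X1 X2]; split; rewrite ?ReIm.
  by under eq_fun do rewrite ReIm; apply: derB; exact: derZ.
by under eq_fun do rewrite ReIm; apply: derD; exact: derZ.
Qed.

Lemma cder_real (a : R -> R) x (b : R) : der a x b ->
  cder (fun y => (a y)%:C%C) x b%:C%C.
Proof. by move=> ab; split => //=; exact: derC. Qed.

Lemma cderM X Y x c d : cder X x c -> cder Y x d ->
  cder (fun y => X y * Y y) x (c * Y x + X x * d).
Proof.
move=> [X1 X2] [Y1 Y2]; split.
  under eq_fun do rewrite ReIm; apply: (der_eq (derB (derM X1 Y1) (derM X2 Y2))).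
  by rewrite !ReIm; ring.
under eq_fun do rewrite ReIm; apply: (der_eq (derD (derM X1 Y2) (derM X2 Y1))).
by rewrite !ReIm; ring.
Qed.

Lemma cder_eq X x c d : cder X x c -> c = d -> cder X x d.
Proof. by move=> dX <-. Qed.

Lemma cder_flip X x c : cder X (- x) c -> cder (fun y => X (- y)) x (- c).
Proof.
move=> [X1 X2]; split; rewrite ReIm.
  exact: (der_flip X1).
exact: (der_flip X2).
Qed.

Lemma cder_unique X x c d : cder X x c -> cder X x d -> c = d.
Proof.
by move=> [? ?] [? ?]; apply: complex_eq; apply: der_unique; eassumption.
Qed.

(** Differentiating sqrt(|u|^2 + t^2) instead of |u| avoids the zeros of u; the
    parameter t is sent to 0 at the end. *)
Lemma normc_growth X (X' : R -> R[i]) (P P' : R -> R) (a b : R) : a <= b ->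
  (forall x, a <= x <= b -> cder X x (X' x)) ->
  (forall x, a <= x <= b -> der P x (P' x)) ->
  (forall x, a <= x <= b -> 0 <= P' x) ->
  (forall x, a <= x <= b ->
    complex.Re (X x) * complex.Re (X' x) + complex.Im (X x) * complex.Im (X' x)
      <= normc (X x) * P' x) ->
  normc (X b) <= normc (X a) + (P b - P a).
Proof.
move=> ab dX dP P'0 XP; apply/ler_addgt0Pr => t t0.
pose q x := complex.Re (X x) ^+ 2 + complex.Im (X x) ^+ 2 + t ^+ 2.
have q_gt0 x : 0 < q x by rewrite ltr_wpDl ?addr_ge0 ?sqr_ge0 // exprn_gt0.
have normq x : normc (X x) <= Num.sqrt (q x).
  by rewrite normc_sqrtE; apply: ler_wsqrtr; rewrite /q lerDl sqr_ge0.
have dN x : a <= x <= b -> der (fun y => Num.sqrt (q y)) x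
    ((2 * Num.sqrt (q x))^-1 * (2 * complex.Re (X x) * complex.Re (X' x)
        + 2 * complex.Im (X x) * complex.Im (X' x) + 0)).
  move=> /dX [dR dI].
  have dq : der q x (2 * complex.Re (X x) * complex.Re (X' x)
        + 2 * complex.Im (X x) * complex.Im (X' x) + 0).
    by apply: derD (derC _ _); apply: derD; exact: derX2.
  exact: der_comp dq (is_derive1_sqrt (q_gt0 x)).
have NP x : a <= x <= b -> (2 * Num.sqrt (q x))^-1 *
    (2 * complex.Re (X x) * complex.Re (X' x)
        + 2 * complex.Im (X x) * complex.Im (X' x) + 0) <= P' x.
  move=> xab; have s0 : 0 < Num.sqrt (q x) by rewrite sqrtr_gt0.
  rewrite mulrC ler_pdivrMr ?mulr_gt0 //.
  have := XP x xab; have := ler_wpM2r (P'0 x xab) (normq x).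
  by rewrite /=; lra.
have := der_le_le ab dN dP NP.
have : Num.sqrt (q a) <= normc (X a) + t.
  rewrite -ler_sqr ?nnegrE ?sqrtr_ge0 ?addr_ge0 ?normc_ge0 ?(ltW t0) //.
  rewrite sqr_sqrtr ?(ltW (q_gt0 a)) // sqrrD normc_sqr /q.
  have : 0 <= normc (X a) * t by rewrite mulr_ge0 ?normc_ge0 ?(ltW t0).
  lra.
by have := normq b; lra.
Qed.

Lemma normc_growth_le X (X' : R -> R[i]) (P P' : R -> R) (a b : R) : a <= b ->
  (forall x, a <= x <= b -> cder X x (X' x)) ->
  (forall x, a <= x <= b -> der P x (P' x)) ->
  (forall x, a <= x <= b -> normc (X' x) <= P' x) ->
  normc (X b) <= normc (X a) + (P b - P a).
Proof.
move=> ab dX dP XP; apply: (normc_growth ab dX dP) => x xab.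
  by apply: le_trans (XP x xab); exact: normc_ge0.
apply: le_trans (dot_le_normc _ _) _.
by rewrite ler_wpM2l ?normc_ge0 // XP.
Qed.

(** The term - k u can only decrease |u| when 0 <= Re k, so that |u| grows no
    faster than the integral of |f|, uniformly in k. *)
Lemma damped_growth (u f : R -> R[i]) (k : R[i]) (P P' : R -> R) (a b : R) :
  0 <= complex.Re k -> a <= b ->
  (forall x, a <= x <= b -> cder u x (- (k * u x) + f x)) ->
  (forall x, a <= x <= b -> der P x (P' x)) ->
  (forall x, a <= x <= b -> normc (f x) <= P' x) ->
  normc (u b) <= normc (u a) + (P b - P a).
Proof.
move=> k0 ab du dP fP; apply: (normc_growth ab du dP) => x xab.
  by apply: le_trans (fP x xab); exact: normc_ge0.
have := dot_le_normc (u x) (f x); rewrite !ReIm.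
have := ler_wpM2l (normc_ge0 (u x)) (fP x xab).
have := mulr_ge0 k0 (addr_ge0 (sqr_ge0 (complex.Re (u x))) (sqr_ge0 (complex.Im (u x)))).
by lra.
Qed.

(** The same comparison run backwards from +oo, where u vanishes. *)
Lemma undamped_decay (u f : R -> R[i]) (k : R[i]) (F F' : R -> R) (a : R) :
  0 <= complex.Re k ->
  (forall x, a <= x -> cder u x (k * u x + f x)) ->
  (forall x, a <= x -> der F x (F' x)) ->
  (forall x, a <= x -> normc (f x) <= - F' x) ->
  F x @[x --> +oo] --> (0 : R) ->
  normc (u x) @[x --> +oo] --> (0 : R) ->
  normc (u a) <= F a.
Proof.
move=> k0 du dF fF F0 u0; apply/ler_addgt0Pr => e e0.
have e2 : 0 < e / 2 by rewrite divr_gt0.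
have [M1 H1] := cvgy_near F0 e2; have [M2 H2] := cvgy_near u0 e2.
pose M := Num.max a (Num.max M1 M2).
have [aM M1M M2M] : [/\ a <= M, M1 <= M & M2 <= M].
  by rewrite /M !le_max !lexx !orbT.
have flipM x : - M <= x <= - a -> a <= - x by lra.
have Ma : - M <= - a by rewrite lerN2.
have := @damped_growth (fun x => u (- x)) (fun x => - f (- x)) k
   (fun x => F (- x)) (fun x => - F' (- x)) (- M) (- a) k0 Ma.
rewrite !opprK => H.
have {}H : normc (u a) <= normc (u M) + (F a - F M).
  apply: H => x /flipM ax.
  - by apply: (cder_eq (cder_flip (du _ ax))); rewrite opprD.
  - exact: (der_flip (dF _ ax)).
  - by rewrite normc_opp fF.
have := H1 _ M1M; have := H2 _ M2M.
by rewrite !subr0 !ler_norml; lra.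
Qed.

End ComplexDerivatives.

(** * A weakly repulsive pair of coupled equations *)

Section CoupledSystem.
Context {R : realType}.

(** In the application psi = phi'/phi and rho = phi^2. The weight rho being
    dominated by - 4 psi', every integral against rho that occurs below is
    bounded by means of values of psi. *)
Variables (w : R) (psi psi' rho : R -> R).
Hypothesis w_gt0 : 0 < w.
Hypothesis dpsi : forall x, der psi x (psi' x).
Hypothesis psi_odd : forall x, psi (- x) = - psi x.
Hypothesis psi_lim : psi x @[x --> +oo] --> - Num.sqrt w.
Hypothesis rho_ge0 : forall x, 0 <= rho x.
Hypothesis rho_le : forall x, rho x <= - 4 * psi' x.
Hypothesis psi_tail : forall x, 0 <= x -> psi x + Num.sqrt w <= rho x / Num.sqrt w.

Let sw := Num.sqrt w.

Let sw_gt0 : 0 < sw. Proof. by rewrite sqrtr_gt0. Qed.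

Let psi'_le0 x : psi' x <= 0.
Proof. by have := rho_le x; have := rho_ge0 x; lra. Qed.

Let dF x : der (fun y => psi y + sw) x (psi' x).
Proof. by have := derD (dpsi x) (derC sw x); rewrite addr0. Qed.

Let F_lim : (psi x + sw) @[x --> +oo] --> (0 : R).
Proof. by rewrite -(addNr sw); apply: cvgD psi_lim (cvg_cst _). Qed.

Let F_ge0 x : 0 <= psi x + sw.
Proof.
rewrite -oppr_le0; apply: (@der_ge0_le_lim _ (fun y => - (psi y + sw)) (fun y => - psi' y)).
- by move=> y _; apply: derN.
- by move=> y _; rewrite oppr_ge0.
- by rewrite -oppr0; apply: cvgN F_lim.
Qed.

Let psi0 : psi 0 = 0.
Proof. by have := psi_odd 0; rewrite oppr0; lra. Qed.

(** On x >= 0 the function - 4 psi / sqrt w is a primitive of a majorant of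
    psi + sqrt w, and it stays below 4. *)
Let Phi x := - 4 * psi x / sw.

Let dPhi x : der Phi x (- 4 * psi' x / sw).
Proof.
rewrite (_ : Phi = fun y => - 4 / sw * psi y).
  by rewrite mulrAC; exact: derZ.
by apply/funext => y; rewrite /Phi mulrAC.
Qed.

Let F_le_Phi' x : 0 <= x -> psi x + sw <= - 4 * psi' x / sw.
Proof.
move=> x0; apply: le_trans (psi_tail x0) _.
by rewrite ler_pM2r ?invr_gt0 // rho_le.
Qed.

Let Phi_le x : Phi x <= 4.
Proof. by rewrite /Phi ler_pdivrMr //; have := F_ge0 x; lra. Qed.

Let Phi0 : Phi 0 = 0.
Proof. by rewrite /Phi psi0 mulr0 mul0r. Qed.

(** The combination u1 + k u solves the first-order equation z' = k z + f and
    vanishes at +oo, so that it is controlled by the integral of |f| over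
    [x, +oo[ alone. *)
Lemma outgoing_bound (u u1 f : R -> R[i]) (k : R[i]) (c : R) :
  0 <= complex.Re k ->
  (forall x, cder u x (u1 x)) ->
  (forall x, cder u1 x (k ^+ 2 * u x + f x)) ->
  (forall x, normc (f x) <= c * rho x) -> 0 <= c ->
  normc (u1 x + k * u x) @[x --> +oo] --> (0 : R) ->
  forall x, normc (u1 x + k * u x) <= 4 * c * (psi x + sw).
Proof.
move=> k0 du du1 fc c0 u_lim x.
apply: (@undamped_decay _ (fun y => u1 y + k * u y) f k
  (fun y => 4 * c * (psi y + sw)) (fun y => 4 * c * psi' y) x k0 _ _ _ _ u_lim).
- move=> y _; apply: (cder_eq (cderD (du1 y) (cderZ k (du y)))).
  by ring.
- by move=> y _; apply: (derZ (4 * c) (dF y)).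
- move=> y _; apply: le_trans (fc y) _.
  by have := ler_wpM2l c0 (rho_le y); lra.
- by rewrite -(mulr0 (4 * c)); apply: cvgMr F_lim.
Qed.

Definition even_fun (f : R -> R) := forall x, f (- x) = f x.

Variables (e : R) (s d Sig : R -> R) (S : R).
Hypothesis e_ge0 : 0 <= e.
Hypothesis s_le : forall x, `|s x| <= e * rho x.
Hypothesis d_le : forall x, `|d x| <= e * rho x.
Hypothesis dSig : forall x, der Sig x (s x).
Hypothesis Sig0 : Sig 0 = 0.
Hypothesis Sig_lim : Sig x @[x --> +oo] --> S.

Section HalfLine.
Variables (p p1 q : R -> R[i]) (k : R[i]) (M : R).
Hypothesis k_ge0 : 0 <= complex.Re k.
Hypothesis dp : forall x, cder p x (p1 x).
Hypothesis dp1 : forall x,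
  cder p1 x (k ^+ 2 * p x + ((s x)%:C%C * p x + (d x)%:C%C * q x)).
Hypothesis p_lim : normc (p1 x + k * p x) @[x --> +oo] --> (0 : R).
Hypothesis out_le : forall x, normc (p1 x + k * p x) <= 4 * (e * M) * (psi x + sw).
Hypothesis p1_le : forall x, normc (p1 x) <= 4 * (e * M) * sw.
Hypothesis q_le : forall x, normc (q x) <= 4 * (e * M).
Hypothesis M_ge0 : 0 <= M.

Let c := e * M.

Let c_ge0 : 0 <= c. Proof. by rewrite mulr_ge0. Qed.

Lemma amplitude_bound x : 0 <= x -> normc (p x) <= normc (p 0) + 16 * c.
Proof.
move=> x0.
have := @damped_growth _ p (fun y => p1 y + k * p y) k (fun y => 4 * c * Phi y)
  (fun y => 4 * c * (- 4 * psi' y / sw)) 0 x k_ge0 x0.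
rewrite Phi0 mulr0 subr0 => H.
have : normc (p x) <= normc (p 0) + 4 * c * Phi x.
  apply: H => y /andP[y0 _].
  - by apply: (cder_eq (dp y)); ring.
  - exact: derZ.
  - apply: le_trans (out_le y) _; rewrite -/c ler_wpM2l ?mulr_ge0 //.
    exact: F_le_Phi'.
by have := ler_wpM2l c_ge0 (Phi_le x); lra.
Qed.

(** Integrating (p1 + k p)' = k (p1 + k p) + s p + d q over the half-line, with
    p frozen at its value p(0) in the leading term. *)
Lemma half_line_flux : normc (p1 0 + k * p 0 + S%:C%C * p 0)
  <= 16 * c * normc k + 80 * c * e * sw.
Proof.
pose r x := p1 x + k * p x.
have dr x : cder r x (k * r x + ((s x)%:C%C * p x + (d x)%:C%C * q x)).
  by apply: (cder_eq (cderD (dp1 x) (cderZ k (dp x)))); rewrite /r; ring.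
pose D x := r x - (Sig x)%:C%C * p 0 - r 0.
have dD x : cder D x (k * r x + ((s x)%:C%C * (p x - p 0) + (d x)%:C%C * q x)).
  have dcst z : cder (fun=> z) x (0 : R[i]) by split; exact: derC.
  apply: cder_eq.
    exact: cderB (cderB (dr x) (cderM (cder_real (dSig x)) (dcst (p 0)))) (dcst (r 0)).
  by cbv beta; ring.
have p_var x : 0 <= x -> normc (p x - p 0) <= 4 * c * sw * x.
  move=> x0.
  have := @normc_growth_le _ (fun y => p y - p 0) p1 (fun y => 4 * c * sw * y)
    (fun=> 4 * c * sw) 0 x x0.
  rewrite subrr mulr0 subr0 normc_zero add0r; apply => y _.
  - have := cderB (dp y) (conj (derC _ _) (derC _ _) : cder (fun=> p 0) y (0 : R[i])).
    by rewrite subr0.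
  - by have := derZ (4 * c * sw) (der_id y); rewrite mulr1.
  - exact: p1_le.
pose B x := 4 * (Phi x - x * (psi x + sw)).
pose Psi x := 4 * c * normc k * Phi x + 4 * c * e * sw * B x
              + 4 * c * e * (- 4 * psi x).
have dB x : der B x (4 * (- 4 * psi' x / sw - (1 * (psi x + sw) + x * psi' x))).
  by apply: derZ; apply: derB => //; apply: derM => //; exact: der_id.
have B_ge x : 0 <= x ->
    x * rho x <= 4 * (- 4 * psi' x / sw - (1 * (psi x + sw) + x * psi' x)).
  move=> x0; have := ler_wpM2l x0 (rho_le x); have := F_le_Phi' x0.
  by lra.
have D_le x : 0 <= x -> normc (D x) <= 16 * c * normc k + 80 * c * e * sw.
  move=> x0.
  have := @normc_growth_le _ D _ Psi (fun y =>
    4 * c * normc k * (- 4 * psi' y / sw)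
    + 4 * c * e * sw * (4 * (- 4 * psi' y / sw - (1 * (psi y + sw) + y * psi' y)))
    + 4 * c * e * (- 4 * psi' y)) 0 x x0 (fun y _ => dD y).
  have D0 : normc (D 0) = 0.
    by rewrite /D Sig0 mul0r subr0 subrr normc_zero.
  rewrite D0 add0r => H; apply: le_trans (H _ _) _.
  - move=> y _; apply: derD.
      apply: derD; last exact: (derZ (4 * c * e * sw) (dB y)).
      exact: (derZ (4 * c * normc k) (dPhi y)).
    exact: (derZ (4 * c * e) (derZ (-4) (dpsi y))).
  - move=> y /andP[y0 _].
    apply: le_trans (normc_add _ _) _; rewrite -addrA; apply: lerD.
      apply: (@le_trans _ _ (normc k * (4 * c * (- 4 * psi' y / sw)))); last by lra.
      rewrite normcM ler_wpM2l ?normc_ge0 //.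
      apply: le_trans (out_le y) _; rewrite -/c ler_wpM2l ?mulr_ge0 //.
      exact: F_le_Phi'.
    apply: le_trans (normc_add _ _) _; rewrite !normcM !normc_real; apply: lerD.
      apply: (@le_trans _ _ ((e * rho y) * (4 * c * sw * y))).
        by apply: ler_pM; rewrite ?normr_ge0 ?normc_ge0 ?s_le ?p_var.
      have cesw : 0 <= 4 * c * e * sw by rewrite !mulr_ge0 // ltW.
      by have := ler_wpM2l cesw (B_ge y y0); lra.
    apply: (@le_trans _ _ ((e * rho y) * (4 * c))).
      by apply: ler_pM; rewrite ?normr_ge0 ?normc_ge0 ?d_le ?q_le.
    have ce : 0 <= 4 * c * e by rewrite !mulr_ge0.
    by have := ler_wpM2l ce (rho_le y); lra.
  - rewrite /Psi /B Phi0 psi0 !(mul0r, mulr0, subr0).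
    have h1 : 4 * c * normc k * Phi x <= 4 * c * normc k * 4.
      by rewrite ler_wpM2l ?mulr_ge0 ?normc_ge0.
    have cesw : 0 <= 4 * c * e * sw by rewrite !mulr_ge0 // ltW.
    have h2 : Phi x - x * (psi x + sw) <= 4.
      by have := Phi_le x; have := mulr_ge0 x0 (F_ge0 x); lra.
    have := ler_wpM2l cesw h2.
    have ce : 0 <= 4 * c * e by rewrite !mulr_ge0.
    have := ler_wpM2l ce (F_ge0 x).
    by lra.
apply/ler_addgt0Pr => t t0.
pose b := normc (p 0) + 1.
have b0 : 0 < b by rewrite ltr_wpDl ?normc_ge0.
have t2 : 0 < t / 2 by rewrite divr_gt0.
have t2b : 0 < t / 2 / b by rewrite divr_gt0.
have [M1 H1] := cvgy_near p_lim t2; have [M2 H2] := cvgy_near Sig_lim t2b.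
pose x := Num.max 0 (Num.max M1 M2).
have [x0 M1x M2x] : [/\ 0 <= x, M1 <= x & M2 <= x].
  by rewrite /x !le_max !lexx !orbT.
rewrite (_ : p1 0 + k * p 0 + _ = r x + ((S - Sig x)%:C%C * p 0 - D x)); last first.
  by rewrite /D /r rmorphB /=; ring.
apply: le_trans (normc_add _ _) _; apply: le_trans (lerD (lexx _) (normc_sub _ _)) _.
have := D_le x x0; have := H1 _ M1x; rewrite subr0 ger0_norm ?normc_ge0 // -/(r x).
have : normc ((S - Sig x)%:C%C * p 0) <= t / 2.
  rewrite normcM normc_real distrC.
  apply: le_trans (ler_wpM2r (normc_ge0 _) (H2 _ M2x)) _.
  rewrite mulrAC ler_pdivrMr // ler_wpM2l // ?ltW // /b; lra.
by lra.
Qed.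

End HalfLine.

Hypothesis s_even : even_fun s.
Hypothesis d_even : even_fun d.
Hypothesis e_small : e <= 64^-1.
Hypothesis S_large : 320 * e ^+ 2 * sw < S.

(** The equation for q is elliptic since |m| >= sqrt w, which makes q of size e.
    The half-line fluxes of p from both sides give
    2 (k + S) p(0) = O(e |k| + e^2 sqrt w) p(0). As 0 <= Re k and 0 < S, both
    |k| and S are at most |k + S|; hence S would be O(e^2 sqrt w) if p(0) were
    nonzero. When p(0) = 0 the a priori bounds leave no room for p and q. *)
Lemma coupled_trivial (p p1 q q1 : R -> R[i]) (k m : R[i]) (K : R) :
  0 <= complex.Re k -> 0 <= complex.Re m -> sw <= normc m ->
  (forall x, cder p x (p1 x)) -> (forall x, cder q x (q1 x)) ->
  (forall x, cder p1 x (k ^+ 2 * p x + ((s x)%:C%C * p x + (d x)%:C%C * q x))) ->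
  (forall x, cder q1 x (m ^+ 2 * q x + ((d x)%:C%C * p x + (s x)%:C%C * q x))) ->
  normc (p1 x + k * p x) @[x --> +oo] --> (0 : R) ->
  normc (- p1 (- x) + k * p (- x)) @[x --> +oo] --> (0 : R) ->
  normc (q1 x + m * q x) @[x --> +oo] --> (0 : R) ->
  normc (- q1 (- x) + m * q (- x)) @[x --> +oo] --> (0 : R) ->
  (forall x, normc (p x) + normc (q x) <= K) ->
  forall x, p x = 0 /\ q x = 0.
Proof.
move=> k0 m0 mw dp dq dp1 dq1 pl pl' ql ql' bK.
(* The supremum of |p| + |q| is bounded by |p(0)| plus a fraction of itself. *)
pose A := [set normc (p x) + normc (q x) | x in [set: R]].
have supA : has_sup A.
  split; first by exists (normc (p 0) + normc (q 0)); exists 0.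
  by exists K => _ [x _ <-].
pose M := sup A.
have bM x : normc (p x) + normc (q x) <= M.
  by apply: (sup_upper_bound supA); exists x.
have M0 : 0 <= M by apply: le_trans (bM 0); rewrite addr_ge0 ?normc_ge0.
pose c := e * M.
have c0 : 0 <= c by rewrite mulr_ge0.
have src (a b : R -> R) (u v : R -> R[i]) x : `|a x| <= e * rho x ->
    `|b x| <= e * rho x -> normc (u x) + normc (v x) <= M ->
    normc ((a x)%:C%C * u x + (b x)%:C%C * v x) <= c * rho x.
  move=> ha hb uv; apply: le_trans (normc_add _ _) _; rewrite !normcM !normc_real.
  apply: (@le_trans _ _ (e * rho x * (normc (u x) + normc (v x)))).
    by rewrite mulrDr lerD // ler_wpM2r ?normc_ge0.
  have er : 0 <= e * rho x by rewrite mulr_ge0.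
  by have := ler_wpM2l er uv; rewrite /c; lra.
have flip1 (u u1 : R -> R[i]) : (forall x, cder u x (u1 x)) ->
    forall x, cder (fun y => u (- y)) x (- u1 (- x)).
  by move=> du x; apply: cder_flip.
have flip2 (u1 f : R -> R[i]) : (forall x, cder u1 x (f x)) ->
    forall x, cder (fun y => - u1 (- y)) x (f (- x)).
  by move=> du x; rewrite -[f _]opprK; apply: cderN; apply: cder_flip.
have dp1' x : cder (fun y => - p1 (- y)) x
    (k ^+ 2 * p (- x) + ((s x)%:C%C * p (- x) + (d x)%:C%C * q (- x))).
  by have := flip2 _ _ dp1 x; rewrite s_even d_even.
have dq1' x : cder (fun y => - q1 (- y)) x
    (m ^+ 2 * q (- x) + ((d x)%:C%C * p (- x) + (s x)%:C%C * q (- x))).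
  by have := flip2 _ _ dq1 x; rewrite s_even d_even.
have srcp x := src s d p q x (s_le x) (d_le x) (bM x).
have srcq x := src d s p q x (d_le x) (s_le x) (bM x).
have srcp' x := src s d (fun y => p (- y)) (fun y => q (- y)) x (s_le x) (d_le x) (bM (- x)).
have srcq' x := src d s (fun y => p (- y)) (fun y => q (- y)) x (d_le x) (s_le x) (bM (- x)).
have outp := outgoing_bound k0 dp dp1 srcp c0 pl.
have outp' := outgoing_bound k0 (flip1 _ _ dp) dp1' srcp' c0 pl'.
have outq := outgoing_bound m0 dq dq1 srcq c0 ql.
have outq' := outgoing_bound m0 (flip1 _ _ dq) dq1' srcq' c0 ql'.
have qb x : normc (q x) <= 4 * c.
  have : normc (2%:C%C * m * q x) <= 8 * c * sw.
    rewrite (_ : _ * _ = (q1 x + m * q x) + (- q1 x + m * q x)); last first.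
      by rewrite (_ : 2%:C%C = 2); [ring|rewrite rmorph_nat].
    apply: le_trans (normc_add _ _) _.
    have := outq x; have := outq' (- x); rewrite /= !opprK psi_odd; lra.
  rewrite !normcM normc_real ger0_norm // => H.
  have := ler_wpM2r (normc_ge0 (q x)) mw => H'.
  rewrite -(ler_pM2l sw_gt0); lra.
have p1b x : normc (p1 x) <= 4 * c * sw.
  have : normc (2%:C%C * p1 x) <= 8 * c * sw.
    rewrite (_ : _ * _ = (p1 x + k * p x) - (- p1 x + k * p x)); last first.
      by rewrite (_ : 2%:C%C = 2); [ring|rewrite rmorph_nat].
    apply: le_trans (normc_sub _ _) _.
    have := outp x; have := outp' (- x); rewrite /= !opprK psi_odd; lra.
  by rewrite !normcM normc_real ger0_norm // => H; lra.
have p1b' x : normc (- p1 (- x)) <= 4 * c * sw by rewrite normc_opp.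
have pb x : normc (p x) <= normc (p 0) + 16 * c.
  have [x0|/ltW x0] := leP 0 x.
    exact: (amplitude_bound k0 dp outp M0 x0).
  have := amplitude_bound k0 (flip1 _ _ dp) outp' M0.
  by move=> /(_ (- x)); rewrite /= opprK oppr0; apply; rewrite oppr_ge0.
have M_le : M <= normc (p 0) + 20 * c.
  apply: ge_sup; first exact: supA.1.
  by move=> _ [x _ <-]; have := pb x; have := qb x; lra.
have cM : c <= M / 64 by rewrite /c mulrC ler_wpM2l.
suff p00 : normc (p 0) <= 0.
  have M00 : M <= 0 by have := M_le; lra.
  by move=> x; have := bM x; have := normc_ge0 (p x); have := normc_ge0 (q x);
    split; apply: normc_eq0; lra.
rewrite leNgt; apply/negP => p0_gt0.
have flux := half_line_flux dp dp1 pl outp p1b qb M0.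
have flux' := half_line_flux (flip1 _ _ dp) dp1' pl' outp' p1b'
  (fun x => qb (- x)) M0.
have S0 : 0 < S.
  have : 0 <= e ^+ 2 * sw by rewrite mulr_ge0 ?sqr_ge0 ?(ltW sw_gt0).
  by have := S_large; lra.
pose z := k + S%:C%C.
have zb : normc z * normc (p 0) <= 16 * c * normc k + 80 * c * e * sw.
  have : normc (2%:C%C * (z * p 0)) <= 2 * (16 * c * normc k + 80 * c * e * sw).
    rewrite (_ : _ * _ = (p1 0 + k * p 0 + S%:C%C * p 0)
        + (- p1 (- 0) + k * p (- 0) + S%:C%C * p (- 0))); last first.
      by rewrite oppr0 (_ : 2%:C%C = 2) /z; [ring|rewrite rmorph_nat].
    by apply: le_trans (normc_add _ _) _; rewrite mulr2n mulrDl mul1r lerD.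
  by rewrite normcM normc_real ger0_norm // normcM; lra.
have c2 : c <= 2 * e * normc (p 0).
  by rewrite /c [2 * e]mulrC -mulrA ler_wpM2l //; lra.
have {}zb : normc z <= 32 * e * normc k + 160 * e ^+ 2 * sw.
  rewrite -(ler_pM2r p0_gt0); apply: le_trans zb _.
  have h1 : 0 <= 16 * normc k + 80 * e * sw.
    by rewrite addr_ge0 ?mulr_ge0 ?normc_ge0 // ltW.
  by have := ler_wpM2r h1 c2; lra.
have kz : normc k <= normc z.
  rewrite !normc_sqrtE; apply: ler_wsqrtr; rewrite /z !ReIm /= addr0 lerD2r.
  by have := mulr_ge0 k0 (ltW S0); nra.
have Sz : S <= normc z.
  apply: le_trans (Re_le_normc _); rewrite /z !ReIm /=.
  by apply: le_trans (ler_norm _); rewrite lerDr.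
have ek : e * normc k <= normc k / 64 by rewrite mulrC ler_wpM2l ?normc_ge0.
have := S_large; lra.
Qed.

End CoupledSystem.

(** * The nonlinearity near 0 *)

Section RightNeighbourhoods.
Context {R : realType}.

Lemma at_right0P (P : R -> Prop) : (\forall x \near 0^'+, P x) <->
  exists2 b : R, 0 < b & forall x, 0 < x < b -> P x.
Proof.
split=> [[b /= b0 H]|[b b0 H]].
  exists b => // x /andP[x0 xb]; apply: H => //=.
  by rewrite sub0r normrN gtr0_norm.
exists b => //= x; rewrite /= sub0r normrN => xb x0; apply: H.
by rewrite x0 -(gtr0_norm x0).
Qed.

Lemma cvg_at_right0P (f : R -> R) (l : R) : f x @[x --> 0^'+] --> l <->
  forall e, 0 < e -> exists2 b : R, 0 < b & forall x, 0 < x < b -> `|f x - l| <= e.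
Proof.
split=> [/cvgrPdist_le H e /H /at_right0P [b b0 Hb]|H].
  by exists b => // x /Hb; rewrite distrC.
apply/cvgrPdist_le => e /H [b b0 Hb]; apply/at_right0P; exists b => // x /Hb.
by rewrite distrC.
Qed.

(** The mean value inequality on [r, t], with r sent to 0. *)
Lemma bound_from_0 (f f' P P' : R -> R) (b : R) :
  (forall t, 0 < t <= b -> der f t (f' t)) ->
  (forall t, 0 < t <= b -> der P t (P' t)) ->
  (forall t, 0 < t <= b -> `|f' t| <= P' t) ->
  f x @[x --> 0^'+] --> (0 : R) -> P x @[x --> 0^'+] --> (0 : R) ->
  forall t, 0 < t <= b -> `|f t| <= P t.
Proof.
move=> df dP fP f0 P0 t /andP[t0 tb]; apply/ler_addgt0Pr => e e0.
have e2 : 0 < e / 2 by rewrite divr_gt0.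
have [b1 b10 H1] := (cvg_at_right0P _ _).1 f0 _ e2.
have [b2 b20 H2] := (cvg_at_right0P _ _).1 P0 _ e2.
pose r := Num.min t (Num.min b1 b2) / 2.
have m0 : 0 < Num.min t (Num.min b1 b2) by rewrite !lt_min t0 b10 b20.
have [mt mb1 mb2] : [/\ Num.min t (Num.min b1 b2) <= t,
    Num.min t (Num.min b1 b2) <= b1 & Num.min t (Num.min b1 b2) <= b2].
  by rewrite !ge_min !lexx !orbT.
have [r0 rt rb1 rb2] : [/\ 0 < r, r <= t, r < b1 & r < b2] by rewrite /r; split; lra.
have itv s : r <= s <= t -> 0 < s <= b by lra.
have up := der_le_le rt (fun s h => df s (itv s h)) (fun s h => dP s (itv s h))
  (fun s h => le_trans (ler_norm _) (fP s (itv s h))).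
have NP s : r <= s <= t -> - f' s <= P' s.
  by move=> /itv /fP; rewrite ler_norml; lra.
have lo := der_le_le rt (fun s h => derN (df s (itv s h)))
  (fun s h => dP s (itv s h)) NP.
have rb1' : 0 < r < b1 by rewrite r0.
have rb2' : 0 < r < b2 by rewrite r0.
have := H1 _ rb1'; have := H2 _ rb2'; rewrite !subr0.
move: up lo => /=; rewrite !ler_norml; lra.
Qed.

End RightNeighbourhoods.

Section Nonlinearity.
Context {R : realType}.
Variable g : R -> R.
Hypothesis gH1 : hypH1 g.

Let g1 := derive1 g.
Let g2 := derive1n 2 g.
Let G := primitive0 g.

Lemma hypH1_der s : 0 < s -> der g s (g1 s) /\ der g1 s (g2 s).
Proof.
move=> s0; have [[dg _] _ _ _] := gH1; split.
  by apply: der_derive1; exact: (dg 0%N).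
by rewrite /g2 /=; apply: der_derive1; exact: (dg 1%N).
Qed.

Lemma hypH1_cont s : 0 < s -> {for s, continuous g}.
Proof. by move=> /hypH1_der [/der_cont]. Qed.

Lemma hypH1_g_small (e : R) : 0 < e ->
  exists2 b : R, 0 < b & forall s, 0 < s < b -> `|g s| <= e * s.
Proof.
move=> e0; have [_ _ o _] := gH1.
have /cvg_at_right0P /(_ _ e0) [b b0 H] := o 0%N isT; exists b => // s sb.
have := H s sb; case/andP: sb => s0 _.
rewrite /= !subr0 expr1z normrM normfV (gtr0_norm s0).
by rewrite ler_pdivrMr.
Qed.

Lemma hypH1_g1_lim : g1 s @[s --> 0^'+] --> (0 : R).
Proof.
have [_ _ o _] := gH1; apply/cvg_at_right0P => e e0.
have /cvg_at_right0P /(_ _ e0) [b b0 H] := o 1%N isT; exists b => // s sb.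
by have := H s sb; rewrite /= (_ : 1 - 1%:Z = 0) // expr0z divr1.
Qed.

Lemma hypH1_g2_lim : s * g2 s @[s --> 0^'+] --> (0 : R).
Proof.
have [_ _ o _] := gH1; apply/cvg_at_right0P => e e0.
have /cvg_at_right0P /(_ _ e0) [b b0 H] := o 2%N isT; exists b => // s sb.
by have := H s sb; rewrite (_ : 1 - 2%:Z = - 1) // exprN1 invrK mulrC.
Qed.

Lemma hypH1_g_lim : g s @[s --> 0^'+] --> (0 : R).
Proof.
apply/cvg_at_right0P => e e0; have [b b0 H] := hypH1_g_small (@ltr01 R).
have m0 : 0 < Num.min b e by rewrite lt_min b0 e0.
exists (Num.min b e) => // s; rewrite lt_min => /and3P[s0 sb se].
rewrite subr0; apply: (le_trans (H s _)); first by rewrite s0.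
by rewrite mul1r ltW.
Qed.

Lemma hypH1_g0 : g 0 = 0.
Proof.
have [_ [d [gd _]] _ _] := gH1.
have [b1 b10 H1] := (cvg_at_right0P _ _).1 gd 1 ltr01.
have [b2 b20 H2] := hypH1_g_small (@ltr01 R).
apply/eqP; rewrite -normr_le0; apply/ler_addgt0Pr => e e0; rewrite add0r.
pose C := 2 + `|d|; have C0 : 0 < C by rewrite ltr_wpDr.
pose m := Num.min (e / C) (Num.min b1 b2).
have m0 : 0 < m by rewrite !lt_min b10 b20 divr_gt0.
have [me mb1 mb2] : [/\ m <= e / C, m <= b1 & m <= b2].
  by rewrite /m !ge_min !lexx !orbT.
pose h := m / 2.
have [h0 hb1 hb2] : [/\ 0 < h, 0 < h < b1 & 0 < h < b2] by rewrite /h; split; lra.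
have := H1 _ hb1; have := H2 _ hb2; rewrite mul1r => gh qh.
have : `|g h - g 0| <= (1 + `|d|) * h.
  rewrite -ler_pdivrMr // -(gtr0_norm h0) -normfV -normrM (gtr0_norm h0).
  rewrite -[X in `|X|](subrK d); apply: le_trans (ler_normD _ _) _.
  by rewrite lerD2r.
have : `|g 0| <= `|g h| + `|g h - g 0|.
  by rewrite -[g 0 in X in X <= _](subKr (g h)) ler_normB.
have : C * h <= e.
  by rewrite mulrC -ler_pdivlMr // /h; have := m0; lra.
by rewrite /C mulrDl; lra.
Qed.

Lemma hypH1_within_cont (b : R) : 0 < b -> {within `[0, b], continuous g}.
Proof.
move=> b0; apply/(continuous_within_itvP _ b0); split.
- by move=> s; rewrite in_itv /= => /andP[s0 _]; exact: hypH1_cont.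
- by rewrite hypH1_g0; exact: hypH1_g_lim.
- by apply: cvg_at_left_filter; exact: hypH1_cont.
Qed.

Lemma hypH1_integrable (b : R) : 0 < b ->
  (@lebesgue_measure R).-integrable `[0, b] (EFin \o g).
Proof.
move=> b0; apply: continuous_compact_integrable; first exact: segment_compact.
exact: hypH1_within_cont.
Qed.

Lemma der_primitive0 s : 0 < s -> der G s (g s).
Proof.
move=> s0; have s1 : s < s + 1 by rewrite ltrDl.
have i : (@lebesgue_measure R).-integrable `[0, s + 1] (EFin \o g).
  by apply: hypH1_integrable; rewrite addr_gt0.
have [dG G'] := continuous_FTC1_closed s1 i s0 (hypH1_cont s0).
by rewrite -G'; apply: der_derive1.
Qed.

Lemma primitive0_lim : G s @[s --> 0^'+] --> (0 : R).
Proof.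
apply: cvg_at_right_filter.
exact: (parameterized_integral_cvg_left ltr01 (hypH1_integrable ltr01)).
Qed.

Lemma id_lim0 (f : R -> R) (a : R) : der f 0 a -> f 0 = 0 ->
  f s @[s --> 0^'+] --> (0 : R).
Proof.
by move=> /der_cont fc f0; apply: cvg_at_right_filter; rewrite -[X in _ --> X]f0.
Qed.

Lemma der_monomial (c s : R) : der (fun s => c * s ^+ 2) s (c * (2 * s)).
Proof. by apply: derZ; have := derX2 (der_id s); rewrite mulr1. Qed.

Lemma primitive0_small (e b : R) : 0 <= e ->
  (forall s, 0 < s <= b -> `|g s| <= e * s) ->
  forall s, 0 < s <= b -> `|G s| <= e / 2 * s ^+ 2.
Proof.
move=> e0 gs; apply: (@bound_from_0 _ G g _ (fun s => e / 2 * (2 * s))).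
- by move=> t /andP[t0 _]; exact: der_primitive0.
- by move=> t _; exact: der_monomial.
- by move=> t /gs; lra.
- exact: primitive0_lim.
- by apply: id_lim0 (der_monomial _ _) _; rewrite expr0n mulr0.
Qed.

(** At s = phi^2 these are the potentials of the transformed operators
    - d^2/dx^2 + omega + a. They vanish when g is linear, which is why s g''(s)
    controls them although it does not control g' itself. *)
Definition aplus (s : R) := - g s + 2 * (G s / s).
Definition aminus (s : R) := - 5 * g s + 6 * (G s / s) + 2 * s * g1 s.

Section PotentialBounds.
Variables (e b : R).
Hypothesis g2_le : forall s, 0 < s <= b -> `|s * g2 s| <= e.

Let h s := g s - s * g1 s.

Let dh s : 0 < s -> der h s (- (s * g2 s)).
Proof.
move=> s0; have [d1 d2] := hypH1_der s0.
by apply: (der_eq (derB d1 (derM (der_id s) d2))); rewrite /=; ring.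
Qed.

Let s_lim : s @[s --> 0^'+] --> (0 : R).
Proof. exact: id_lim0 (der_id _) _. Qed.

Let sg1_lim : s * g1 s @[s --> 0^'+] --> (0 : R).
Proof. by rewrite -[X in _ --> X](mulr0 0); apply: cvgM s_lim hypH1_g1_lim. Qed.

Let h_le s : 0 < s <= b -> `|h s| <= e * s.
Proof.
move: s; apply: (@bound_from_0 _ h _ _ (fun=> e)).
- by move=> t /andP[t0 _]; exact: dh.
- by move=> t _; have := derZ e (der_id t); rewrite mulr1.
- by move=> t tb; rewrite normrN g2_le.
- by rewrite -[X in _ --> X](subr0 0); apply: cvgB hypH1_g_lim sg1_lim.
- by apply: id_lim0 (derZ e (der_id _)) _; rewrite mulr0.
Qed.

Let sG_lim c1 c2 c3 :
  c1 * (s * g s) + c2 * G s + c3 * (s * (s * g1 s)) @[s --> 0^'+] --> (0 : R).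
Proof.
rewrite [X in _ --> X](_ : 0 = c1 * (0 * 0) + c2 * 0 + c3 * (0 * 0)); last by ring.
apply: cvgD; first apply: cvgD; apply: cvgMr.
- exact: cvgM s_lim hypH1_g_lim.
- exact: primitive0_lim.
- exact: cvgM s_lim sg1_lim.
Qed.

(** The function s a(s) vanishes at 0 and its derivative is h = g - s g', whose
    own derivative is - s g''. *)
Lemma aplus_le s : 0 < s <= b -> `|aplus s| <= e / 2 * s.
Proof.
move=> sb; have s0 : 0 < s by case/andP: sb.
have -> : aplus s = (- 1 * (s * g s) + 2 * G s + 0 * (s * (s * g1 s))) / s.
  by rewrite /aplus; field; rewrite gt_eqF.
rewrite normrM normfV (gtr0_norm s0) ler_pdivrMr // -[leRHS]mulrA -expr2.
move: s sb {s0}; apply: (@bound_from_0 _ _ h _ (fun s => e / 2 * (2 * s))).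
- move=> t /andP[t0 _]; have [d1 d2] := hypH1_der t0.
  apply: der_eq.
    exact: derD (derD (derZ (-1) (derM (der_id t) d1)) (derZ 2 (der_primitive0 t0)))
      (derZ 0 (derM (der_id t) (derM (der_id t) d2))).
  by rewrite /h; ring.
- by move=> t _; exact: der_monomial.
- by move=> t /h_le; lra.
- exact: sG_lim.
- by apply: id_lim0 (der_monomial _ _) _; rewrite expr0n mulr0.
Qed.

(** Here the derivative of s a(s) is h + 2 s (s g''). *)
Lemma aminus_le s : 0 < s <= b -> `|aminus s| <= 3 / 2 * e * s.
Proof.
move=> sb; have s0 : 0 < s by case/andP: sb.
have -> : aminus s = (- 5 * (s * g s) + 6 * G s + 2 * (s * (s * g1 s))) / s.
  by rewrite /aminus; field; rewrite gt_eqF.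
rewrite normrM normfV (gtr0_norm s0) ler_pdivrMr // -[leRHS]mulrA -expr2.
move: s sb {s0}; apply: (@bound_from_0 _ _ (fun s => h s + 2 * s * (s * g2 s)) _
  (fun s => 3 / 2 * e * (2 * s))).
- move=> t /andP[t0 _]; have [d1 d2] := hypH1_der t0.
  apply: der_eq.
    exact: derD (derD (derZ (-5) (derM (der_id t) d1)) (derZ 6 (der_primitive0 t0)))
      (derZ 2 (derM (der_id t) (derM (der_id t) d2))).
  by rewrite /h; ring.
- by move=> t _; exact: der_monomial.
- move=> t tb; apply: le_trans (ler_normD _ _) _.
  have t0 : 0 < t by case/andP: tb.
  rewrite [`|2 * t * _|]normrM (gtr0_norm (_ : 0 < 2 * t)) ?mulr_gt0 //.
  have t2 : 0 <= 2 * t by rewrite mulr_ge0 // ltW.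
  by have := ler_wpM2l t2 (g2_le tb); have := h_le tb; lra.
- exact: sG_lim.
- by apply: id_lim0 (der_monomial _ _) _; rewrite expr0n mulr0.
Qed.

End PotentialBounds.

(** Since s g''(s) tends to 0, the supremum is taken over a bounded set and is
    small. *)
Lemma epsilon_small (e : R) : 0 < e -> \forall omega \near 0^'+,
  epsilon g omega <= e /\
  forall s, 0 < s <= 3 * omega -> `|s * g2 s| <= epsilon g omega.
Proof.
move=> e0; have [b b0 H] := (cvg_at_right0P _ _).1 hypH1_g2_lim e e0.
apply/at_right0P; exists (b / 3); first by rewrite divr_gt0.
move=> w /andP[w0 wb].
have wI : 0 <= 3 * w by rewrite mulr_ge0 // ltW.
have bnd : forall y, [set `|s * g2 s| | s in `[0, 3 * w]] y -> y <= e.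
  move=> y [s /=]; rewrite in_itv /= => /andP[]; rewrite le_eqVlt => /predU1P[<-|s0] sw <-.
    by rewrite mul0r normr0 ltW.
  by rewrite -[s * _]subr0; apply: H; rewrite s0 /=; lra.
have ne : [set `|s * g2 s| | s in `[0, 3 * w]] !=set0.
  by exists `|0 * g2 0|; exists 0 => //=; rewrite in_itv /= lexx.
split; first exact: ge_sup.
move=> s /andP[s0 sw]; apply: ub_le_sup; first by exists e.
by exists s => //=; rewrite in_itv /= sw ltW.
Qed.

End Nonlinearity.

(** * The soliton *)

Section Soliton.
Context {R : realType}.
Variables (g : R -> R) (w : R) (phi : R -> R).
Hypothesis gH1 : hypH1 g.
Hypothesis w_gt0 : 0 < w.
Hypothesis g_small : forall s, 0 < s <= 3 * w -> `|g s| <= 8^-1 * s.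
Hypothesis phiS : is_soliton g w phi.

Let g1 := derive1 g.
Let G := primitive0 g.
Let phi1 := derive1 phi.
Let sw := Num.sqrt w.

Let dphi x : der phi x (phi1 x).
Proof. by have [_ d _ _] := phiS; apply: der_derive1; exact: (d x).1. Qed.

Let dphi1 x : der phi1 x (w * phi x - phi x ^+ 3 + phi x * g (phi x ^+ 2)).
Proof.
have [_ d e _] := phiS; rewrite -e.
by apply: der_derive1; exact: (d x).2.
Qed.

Let phi_ge0 x : 0 <= phi x.
Proof. by have [_ _ _ [_ _ p _ _]] := phiS. Qed.

Lemma phi_even x : phi (- x) = phi x.
Proof. by have [_ _ _ [_ ev _ _ _]] := phiS. Qed.

Lemma phi_lim : phi x @[x --> +oo] --> (0 : R).
Proof. by have [_ _ _ [_ _ _ l _]] := phiS. Qed.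

Let phi_bounded : exists2 M : R, 0 < M & forall x, phi x <= M.
Proof.
have [N HN] := cvgy_near phi_lim (@ltr01 R).
pose N' := `|N|; have N'0 : - N' <= N' by have := normr_ge0 N; rewrite /N'; lra.
have cphi : {within `[- N', N'], continuous phi}.
  by apply: continuous_subspaceT => x; exact: der_cont (dphi x).
have [c _ Hc] := EVT_max N'0 cphi.
exists (1 + phi c) => [|x]; first by rewrite ltr_pwDl.
have [xN|Nx] := leP `|x| N'.
  have : phi x <= phi c by apply: Hc; rewrite in_itv /= -ler_norml.
  lra.
have -> : phi x = phi `|x| by case: (ler0P x) => _ //; rewrite phi_even.
have : N <= `|x| by apply: ltW; apply: le_lt_trans Nx; exact: ler_norm.
by move=> /HN; rewrite subr0 ger0_norm //; have := phi_ge0 c; lra.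
Qed.

Let g_bounded (M : R) : 0 < M -> exists2 C : R, 0 <= C &
  forall s, 0 <= s <= M -> `|g s| <= C.
Proof.
move=> M0; have cg := hypH1_within_cont gH1 M0.
have [c _ Hc] := EVT_max (ltW M0) cg; have [d _ Hd] := EVT_min (ltW M0) cg.
exists (`|g c| + `|g d|) => [|s sM]; first by rewrite addr_ge0.
have sI : s \in `[0, M]%R by rewrite in_itv.
have := Hc s sI; have := Hd s sI.
have := ler_norm (g c); have := ler_norm (- g d); rewrite normrN.
have := normr_ge0 (g c); have := normr_ge0 (g d).
by rewrite ler_norml; lra.
Qed.

(** A zero of phi would be a minimum, hence a zero of phi' too. *)
Lemma soliton_gt0 x : 0 < phi x.
Proof.
rewrite lt_neqAle phi_ge0 andbT; apply/negP => /eqP /esym phix0.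
have [_ _ _ [[y0 +] _ _ _ _]] := phiS; apply/negP; rewrite negbK; apply/eqP.
have phi1x0 : phi1 x = 0.
  apply: (der_unique (dphi x)); apply: (@derive1_at_min _ phi (x - 1) (x + 1) x).
  - lra.
  - by move=> t _; have [_ d _ _] := phiS; exact: (d t).1.
  - by rewrite in_itv /=; apply/andP; split; lra.
  - by move=> t _; rewrite phix0.
have [M M0 phiM] := phi_bounded.
have [C C0 gC] := g_bounded (exprn_gt0 2 M0).
have phi2 y : 0 <= phi y ^+ 2 <= M ^+ 2.
  by rewrite sqr_ge0 ler_sqr ?nnegrE ?(ltW M0) ?phiM ?phi_ge0.
pose u y := w - phi y ^+ 2 + g (phi y ^+ 2).
have uK y : `|u y| <= w + M ^+ 2 + C.
  have := gC _ (phi2 y); have /andP[h1 h2] := phi2 y.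
  by rewrite /u !ler_norml; have := ltW w_gt0; lra.
apply: (second_order_unique dphi _ uK phix0 phi1x0) => y.
by apply: (der_eq (dphi1 y)); rewrite /u; ring.
Qed.

(** psi is the logarithmic derivative of phi, which factorizes L_-, and psi' the
    value that the equation and its first integral give to its derivative. *)
Definition rho (x : R) := phi x ^+ 2.
Definition psi (x : R) := phi1 x / phi x.
Definition psi' (x : R) := - rho x / 2 + g (rho x) - G (rho x) / rho x.

Lemma rho_gt0 x : 0 < rho x.
Proof. by rewrite exprn_gt0 // soliton_gt0. Qed.

Lemma der_phi x : der phi x (psi x * phi x).
Proof. by rewrite /psi divfK ?gt_eqF ?soliton_gt0. Qed.

Lemma der_rho x : der rho x (2 * psi x * rho x).
Proof. by apply: (der_eq (derX2 (der_phi x))); rewrite /rho; ring. Qed.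

Lemma rho_lim : rho x @[x --> +oo] --> (0 : R).
Proof. by rewrite -(mulr0 0); exact: cvgM phi_lim phi_lim. Qed.

Let near_rho (P : R -> Prop) : (\forall s \near 0^'+, P s) ->
  exists M : R, forall x, M <= x -> P (rho x).
Proof.
move=> /at_right0P [b b0 HP]; have b2 : 0 < b / 2 by rewrite divr_gt0.
have [M HM] := cvgy_near rho_lim b2; exists M => x /HM.
rewrite subr0 gtr0_norm ?rho_gt0 // => h; apply: HP; rewrite rho_gt0 /=; lra.
Qed.

Lemma rho_comp_lim (f : R -> R) : f s @[s --> 0^'+] --> (0 : R) ->
  f (rho x) @[x --> +oo] --> (0 : R).
Proof.
move=> /cvgrPdist_le f0; apply: near_cvgy => e /f0 /near_rho [M HM]; exists M.
by move=> x /HM; rewrite distrC.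
Qed.

(** Energy conservation; the constant is 0 since phi' has arbitrarily far small
    values by the mean value theorem. *)
Lemma soliton_energy x : phi1 x ^+ 2 = w * rho x - rho x ^+ 2 / 2 + G (rho x).
Proof.
pose En y := phi1 y ^+ 2 - (w * rho y - 2^-1 * rho y ^+ 2 + G (rho y)).
have dEn y : der En y 0.
  have dr := der_rho y; have dG := der_comp dr (der_primitive0 gH1 (rho_gt0 y)).
  apply: (der_eq (derB (derX2 (dphi1 y)) (derD (derB (derZ w dr)
    (derZ (2^-1) (derX2 dr))) dG))).
  have p0 : phi y != 0 by rewrite gt_eqF ?soliton_gt0.
  by rewrite /rho /psi; field.
suff c0 : En x = 0 by move: c0; rewrite /En; lra.
apply/eqP; rewrite -normr_le0; apply/ler_addgt0Pr => e e0; rewrite add0r.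
pose d := Num.min 1 (e / 8).
have d0 : 0 < d by rewrite lt_min ltr01 divr_gt0.
have [d1 de] : d <= 1 /\ d <= e / 8 by rewrite /d !ge_min !lexx orbT.
have [M1 H1] := cvgy_near phi_lim d0.
have rl : (w * rho y - 2^-1 * rho y ^+ 2 + G (rho y)) @[y --> +oo] --> (0 : R).
  rewrite [X in _ --> X](_ : 0 = w * 0 - 2^-1 * (0 * 0) + 0); last by ring.
  apply: cvgD (rho_comp_lim (primitive0_lim gH1)).
  apply: cvgB; apply: cvgMr; first exact: rho_lim.
  exact: cvgM rho_lim rho_lim.
have [M2 H2] := cvgy_near rl d0.
pose M := Num.max M1 M2.
have [h1 h2] : M1 <= M /\ M2 <= M by rewrite /M !le_max !lexx orbT.
have MM : M <= M + 1 by lra.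
have [c /andP[Mc _] cE] := @der_mvt _ phi phi1 M (M + 1) MM (fun z _ => dphi z).
have phi1c : `|phi1 c| <= 2 * d.
  have -> : phi1 c = phi (M + 1) - phi M by rewrite cE; ring.
  have h3 : M1 <= M + 1 by lra.
  by have := H1 _ h1; have := H1 _ h3; rewrite !subr0 !ler_norml; lra.
have := H2 c (le_trans h2 Mc); rewrite subr0.
rewrite (der_0_cst dEn x c) /En; set r := _ + G _ => rd.
apply: le_trans (ler_normB _ _) _; rewrite normrX.
have : `|phi1 c| ^+ 2 <= (2 * d) ^+ 2.
  by rewrite ler_sqr ?nnegrE ?normr_ge0 // mulr_ge0 // ltW.
have : d * d <= d * 1 by rewrite ler_pM2l.
by lra.
Qed.

Lemma psi_sqr x : psi x ^+ 2 = w - rho x / 2 + G (rho x) / rho x.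
Proof.
rewrite /psi expr_div_n soliton_energy -/(rho x).
by field; rewrite gt_eqF ?rho_gt0.
Qed.

Lemma der_psi x : der psi x (psi' x).
Proof.
have p0 : phi x != 0 by rewrite gt_eqF ?soliton_gt0.
apply: (der_eq (derM (dphi1 x) (derV (dphi x) p0))).
have := soliton_energy x; rewrite /psi' /rho => h.
have -> : phi1 x * (- phi1 x / phi x ^+ 2) = - (phi1 x ^+ 2) / phi x ^+ 2.
  by field.
by rewrite h; field.
Qed.

Let G_le s : 0 < s <= 3 * w -> `|G s| <= 8^-1 / 2 * s ^+ 2.
Proof. by apply: (primitive0_small gH1 _ g_small); lra. Qed.

(** phi^2 is continuous and tends to 0, so to exceed 3 omega it would have to
    cross that value, where psi^2 would be negative. *)
Lemma rho_lt x : rho x < 3 * w.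
Proof.
have w3 : 0 < 3 * w by rewrite mulr_gt0.
rewrite ltNge; apply/negP => rx.
have [M HM] := cvgy_near rho_lim w_gt0.
pose y := Num.max x M.
have [xy My] : x <= y /\ M <= y by rewrite /y !le_max !lexx orbT.
have ry : rho y <= w.
  by have := HM _ My; rewrite subr0 ger0_norm // ltW // rho_gt0.
have cr : {within `[x, y], continuous rho}.
  by apply: continuous_subspaceT => z; exact: der_cont (der_rho z).
have v : Num.min (rho x) (rho y) <= 3 * w <= Num.max (rho x) (rho y).
  by rewrite ge_min le_max rx /= andbT; apply/orP; right; lra.
have [c _ rc] := IVT xy cr v.
have := psi_sqr c; rewrite rc.
have : `|G (3 * w)| <= 8^-1 / 2 * (3 * w) ^+ 2 by apply: G_le; rewrite w3 /=.
rewrite -ler_pdivrMr; last by rewrite exprn_gt0.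
rewrite -[in X in X -> _](ger0_norm (sqr_ge0 (3 * w))) -normfV -normrM => Gw.
have := sqr_ge0 (psi c).
have : G (3 * w) / (3 * w) = G (3 * w) / (3 * w) ^+ 2 * (3 * w).
  by field; rewrite gt_eqF.
move: Gw; rewrite ler_norml => /andP[_ Gw].
have := ler_wpM2r (ltW w3) Gw; have := w_gt0; lra.
Qed.

Lemma rho_itv x : 0 < rho x <= 3 * w.
Proof. by rewrite rho_gt0 ltW // rho_lt. Qed.

Lemma G_quot_le x : `|G (rho x) / rho x| <= rho x / 16.
Proof.
have r0 := rho_gt0 x; rewrite normrM normfV (gtr0_norm r0) ler_pdivrMr //.
by apply: le_trans (G_le (rho_itv x)) _; lra.
Qed.

(** phi^2 is integrable because it is dominated by the derivative of the bounded
    function - 4 psi. *)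
Lemma rho_le_psi' x : rho x <= - 4 * psi' x.
Proof.
have := g_small (rho_itv x); have := G_quot_le x; have := rho_gt0 x.
by rewrite /psi' !ler_norml; lra.
Qed.

Lemma phi1_odd x : phi1 (- x) = - phi1 x.
Proof.
rewrite -[LHS]opprK; congr (- _); apply/esym; apply: (der_unique (dphi x)).
have := der_flip (dphi (- x)); congr (der _ _ _).
by apply/funext => y; exact: phi_even.
Qed.

Lemma psi_odd x : psi (- x) = - psi x.
Proof. by rewrite /psi phi1_odd phi_even mulNr. Qed.

Lemma rho_even x : rho (- x) = rho x.
Proof. by rewrite /rho phi_even. Qed.

Lemma psi_le0 x : 0 <= x -> psi x <= 0.
Proof.
move=> x0; have psi0 : psi 0 = 0 by have := psi_odd 0; rewrite oppr0; lra.
have := @der_ge0_le _ (fun y => - psi y) (fun y => - psi' y) 0 x x0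
  (fun y _ => derN (der_psi y)).
rewrite psi0 lerN2; apply => y _.
by have := rho_le_psi' y; have := rho_gt0 y; lra.
Qed.

Lemma psi_lim : psi x @[x --> +oo] --> - sw.
Proof.
have l2 : (psi x ^+ 2) @[x --> +oo] --> w.
  have -> : (fun x => psi x ^+ 2) = (fun x => w - rho x / 2 + G (rho x) / rho x).
    by apply/funext => x; exact: psi_sqr.
  have l : (w - rho x / 2) @[x --> +oo] --> w - 0 * 2^-1.
    by apply: cvgB; [exact: cvg_cst|apply: cvgMl; exact: rho_lim].
  rewrite mul0r subr0 in l; rewrite -[w in X in _ --> X]addr0.
  apply: (cvgD l).
  apply: near_cvgy => e /(cvgy_near rho_lim) [M HM]; exists M => x /HM.
  rewrite !subr0 => h; apply: le_trans (G_quot_le x) _.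
  by move: h; rewrite gtr0_norm ?rho_gt0 //; have := rho_gt0 x; lra.
have l3 : Num.sqrt (psi x ^+ 2) @[x --> +oo] --> sw.
  by apply: continuous_cvg l2; exact: sqrt_continuous.
apply: near_cvgy => e /(cvgy_near l3) [M HM]; exists (Num.max 0 M) => x.
rewrite ge_max => /andP[x0 /HM]; rewrite sqrtr_sqr (ler0_norm (psi_le0 x0)).
by move=> h; rewrite opprK -normrN opprD.
Qed.

(** Factor omega - psi^2, which is of the order of phi^2 by the first integral. *)
Lemma psi_tail x : 0 <= x -> psi x + sw <= rho x / sw.
Proof.
move=> x0; have sw0 : 0 < sw by rewrite sqrtr_gt0.
have [neg|pos] := leP (psi x + sw) 0.
  by apply: le_trans neg _; rewrite divr_ge0 // ltW // rho_gt0.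
rewrite ler_pdivlMr //.
have h1 : (psi x + sw) * sw <= (psi x + sw) * (sw - psi x).
  by rewrite ler_pM2l //; have := psi_le0 x0; lra.
apply: le_trans h1 _.
have -> : (psi x + sw) * (sw - psi x) = sw ^+ 2 - psi x ^+ 2 by ring.
rewrite sqr_sqrtr ?(ltW w_gt0) // psi_sqr; have := G_quot_le x.
by have := rho_gt0 x; rewrite ler_norml; lra.
Qed.

End Soliton.

(** * Primitives and the integral of the averaged potential *)

Section Primitives.
Context {R : realType}.
Local Notation mu := (@lebesgue_measure R).

Lemma continuous_integrable_segment (f : R -> R) (a b : R) : continuous f ->
  mu.-integrable `[a, b] (EFin \o f).
Proof.
move=> cf; apply: continuous_compact_integrable; first exact: segment_compact.
exact: continuous_subspaceT.
Qed.

Lemma locally_integrable_segment (v : R -> R) (a b : R) :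
  locally_integrable setT v -> mu.-integrable `[a, b] (EFin \o v).
Proof.
move=> [mv _ iv]; apply/integrableP; split.
  by apply/measurable_EFinP; exact: measurable_funS mv.
by apply: iv => //; exact: segment_compact.
Qed.

Lemma continuous_locally_integrable (f : R -> R) : continuous f ->
  locally_integrable setT f.
Proof.
move=> cf; split; first exact: continuous_measurable_fun.
  exact: openT.
move=> K _ cK; have : mu.-integrable K (EFin \o f).
  apply: continuous_compact_integrable => //; exact: continuous_subspaceT.
by case/integrableP.
Qed.

Definition indefinite_integral (v P : R -> R) : Prop :=
  forall a b, a <= b -> \int[mu]_(t in `[a, b]) v t = P b - P a.

(** The integrals based at - N, for varying N, differ by constants on their
    common domain. *)
Lemma indefinite_integral_exists (v : R -> R) : locally_integrable setT v ->
  exists2 P : R -> R, continuous P & indefinite_integral v P.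
Proof.
move=> lv; pose FN N y := \int[mu]_(t in `[- N, y]) v t.
have FNB N a b : - N <= a -> a <= b -> FN N b - FN N a = \int[mu]_(t in `[a, b]) v t.
  move=> Na ab; rewrite /FN Rintegral_itvB ?bnd_simp //; last first.
    exact: locally_integrable_segment.
  rewrite Rintegral_itv_obnd_cbnd //.
  apply: integrableS (locally_integrable_segment a b lv) => //.
  exact: subset_itv_oc_cc.
have agree N N' y : `|y| <= N' -> N' <= N -> FN N y - FN N 0 = FN N' y - FN N' 0.
  move=> yN' NN'; have y0 : 0 <= N' := le_trans (normr_ge0 y) yN'.
  have shiftN z : - N' <= z -> FN N z = FN N (- N') + FN N' z.
    by move=> N'z; rewrite /(FN N' z) -(@FNB N) ?lerN2 // addrC subrK.
  by move: yN'; rewrite ler_norml => /andP[? _]; rewrite (shiftN y) // (shiftN 0) ?oppr_le0 //; ring.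
pose P y := FN (`|y| + 1) y - FN (`|y| + 1) 0.
have PE N y : `|y| + 1 <= N -> P y = FN N y - FN N 0.
  by move=> yN; rewrite /P -(@agree N) // lerDl.
exists P => [x|a b ab].
  pose N := `|x| + 2.
  have N0 : - N < N by rewrite /N; have := normr_ge0 x; lra.
  have [cN _ _] := (continuous_within_itvP _ N0).1
    (parameterized_integral_continuous (ltW N0) (locally_integrable_segment (- N) N lv)).
  have xN : x \in `]- N, N[%R by rewrite in_itv /= -ltr_norml /N ltrDl.
  have cx : {for x, continuous (fun y => FN N y - FN N 0)}.
    by apply: cvgB; [exact: (cN x xN)|exact: cvg_cst].
  have xE : P x = FN N x - FN N 0 by apply: PE; rewrite /N; lra.
  suff : P y @[y --> x] --> FN N x - FN N 0 by rewrite -xE.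
  have E : \forall y \near x, FN N y - FN N 0 = P y.
    near=> y; rewrite (PE N) //.
    have : `|x - y| < 1 by near: y; exact: nbhsx_ballx.
    have := ler_normD (y - x) x; rewrite subrK (distrC y x) /N; lra.
  exact: cvg_trans (near_eq_cvg E) cx.
pose N := `|a| + `|b| + 1.
have [aN bN] : `|a| + 1 <= N /\ `|b| + 1 <= N.
  by rewrite /N; have := normr_ge0 a; have := normr_ge0 b; lra.
rewrite (PE _ _ aN) (PE _ _ bN) -(@FNB N) //; first by ring.
by have := ler_norm (- a); rewrite normrN /N; have := normr_ge0 b; lra.
Unshelve. all: by end_near. Qed.

Lemma der_indefinite_integral (f P : R -> R) : continuous f ->
  indefinite_integral f P -> forall x, der P x (f x).
Proof.
move=> cf fP x.
have x1 : x - 1 < x by lra.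
have x2 : x < x + 1 by lra.
have [dF F'] := continuous_FTC1_closed x2 (continuous_integrable_segment (x - 1) (x + 1) cf) x1 (cf x).
have := derD (derC (P (x - 1)) x) (der_derive1 dF); rewrite F' add0r.
apply: near_eq_is_derive; near=> y; rewrite fP; first by rewrite addrC subrK.
have : `|x - y| < 1 by near: y; exact: nbhsx_ballx.
by rewrite ltr_norml; lra.
Unshelve. all: by end_near. Qed.

Lemma primitive_exists (f : R -> R) : continuous f ->
  exists F : R -> R, (forall x, der F x (f x)) /\ F 0 = 0.
Proof.
move=> cf.
have [P _ fP] := indefinite_integral_exists (continuous_locally_integrable cf).
exists (fun x => P x - P 0); split; last by rewrite subrr.
move=> x; have := derB (der_indefinite_integral cf fP x) (derC (P 0) x).
by rewrite subr0.
Qed.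

Lemma Rintegral_segment (f F : R -> R) (a b : R) : a <= b -> continuous f ->
  (forall x, der F x (f x)) -> \int[mu]_(t in `[a, b]) f t = F b - F a.
Proof.
move=> ab cf dF.
have [P _ fP] := indefinite_integral_exists (continuous_locally_integrable cf).
have dD x : der (fun x => P x - F x) x 0.
  by rewrite -(subrr (f x)); apply: derB => //; exact: der_indefinite_integral.
by rewrite fP //; have := der_0_cst dD a b; lra.
Qed.

Lemma ge0_even_integral (f F : R -> R) (L : R) : continuous f ->
  (forall x, 0 <= f x) -> (forall x, f (- x) = f x) ->
  (forall x, der F x (f x)) -> F 0 = 0 -> F x @[x --> +oo] --> L ->
  mu.-integrable setT (EFin \o f) /\ \int[mu]_x f x = 2 * L.
Proof.
move=> cf f0 fev dF F0 FL.
have iE : (\int[mu]_x (f x)%:E = (2 * L)%:E)%E.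
  rewrite ge0_symfun_integralT //; last by move=> x /=; rewrite fev.
  rewrite -set_itvcy (@ge0_continuous_FTC2y _ f F 0 L).
  - by rewrite F0 sube0.
  - by [].
  - exact: continuous_subspaceT.
  - by [].
  - by move=> x _; have [] := dF x.
  - by apply: cvg_at_right_filter; exact: der_cont (dF 0).
  - by move=> x _; exact: derive1_val (dF x).
split; last by rewrite /Rintegral iE.
apply/integrableP; split.
  by apply/measurable_EFinP; exact: continuous_measurable_fun.
under eq_integral do rewrite /= ger0_norm //.
by rewrite iE ltry.
Qed.

(** Both f + d and d are nonnegative, so that their primitives have limits, and
    f is their difference. *)
Lemma even_dominated_integral (f d D : R -> R) (L : R) :
  continuous f -> continuous d ->
  (forall x, f (- x) = f x) -> (forall x, d (- x) = d x) ->
  (forall x, `|f x| <= d x) ->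
  (forall x, der D x (d x)) -> D 0 = 0 -> D x @[x --> +oo] --> L ->
  exists (F : R -> R) (S : R), [/\ forall x, der F x (f x), F 0 = 0,
    F x @[x --> +oo] --> S & \int[mu]_x f x = 2 * S].
Proof.
move=> cf cd fev dev fd dD D0 DL.
have [F [dF F0]] := primitive_exists cf.
have fdb x : - d x <= f x <= d x by rewrite -ler_norml.
have d0 x : 0 <= d x := le_trans (normr_ge0 _) (fd x).
pose H x := F x + D x.
have dH x : der H x (f x + d x) by exact: derD.
have DL_le x : D x <= L by apply: (der_ge0_le_lim (fun z _ => dD z) (fun z _ => d0 z) DL).
have h0 x : 0 <= f x + d x by have := fdb x; lra.
have H_nd : nondecreasing_fun H.
  by move=> x y xy; exact: (der_ge0_le xy (fun z _ => dH z) (fun z _ => h0 z)).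
have H_ub : has_ubound (range H).
  exists (2 * L) => _ [x _ <-].
  have L0 : 0 <= L by rewrite -D0.
  have [x0|/ltW x0] := leP 0 x.
    have := der_le_le x0 (fun z _ => dF z) (fun z _ => dD z).
    rewrite F0 D0 !subr0 => h.
    have : F x <= D x by apply: h => z _; have := fdb z; lra.
    by have := DL_le x; rewrite /H; lra.
  by have := H_nd _ _ x0; rewrite {2}/H F0 D0; lra.
have HL := nondecreasing_cvgr H_nd H_ub.
set h := sup _ in HL.
have H00 : H 0 = 0 by rewrite /H F0 D0 addr0.
have fd_even x : f (- x) + d (- x) = f x + d x by rewrite fev dev.
have cfd : continuous (fun x => f x + d x).
  by move=> x; apply: continuousD; [exact: cf|exact: cd].
have [iH IH] := ge0_even_integral cfd h0 fd_even dH H00 HL.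
have [iD ID] := ge0_even_integral cd d0 dev dD D0 DL.
exists F, (h - L); split => //.
  rewrite (_ : F = fun x => H x - D x); last by apply/funext => x; rewrite /H addrK.
  exact: cvgB.
rewrite mulrBr -IH -ID -RintegralB //.
by apply: eq_Rintegral => x _; rewrite addrK.
Qed.

End Primitives.

(** * A smooth step function *)

Section SmoothStep.
Context {R : realType}.
Implicit Types f g : R -> R.

Fixpoint n_derivable (n : nat) f : Prop :=
  if n is m.+1 then (forall x, derivable f x 1) /\ n_derivable m (derive1 f)
  else True.

Lemma n_derivableP f : (forall n, n_derivable n f) ->
  forall n x, derivable (derive1n n f) x 1.
Proof.
move=> fd n; elim: n f fd => [|n IH] f fd x; first exact: (fd 1%N).1.
by rewrite derive1Sn; apply: IH => m; exact: (fd m.+1).2.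
Qed.

Lemma n_derivable_der n f f' : (forall x, der f x (f' x)) ->
  n_derivable n f' -> n_derivable n.+1 f.
Proof.
move=> df nf'; split; first by move=> x; have [] := df x.
by rewrite (_ : derive1 f = f') //; apply/funext => x; exact: derive1_val (df x).
Qed.

Lemma n_derivable_der1 n f x : n_derivable n.+1 f -> der f x (derive1 f x).
Proof. by move=> [df _]; exact: der_derive1. Qed.

Lemma n_derivableW n f : n_derivable n.+1 f -> n_derivable n f.
Proof. by elim: n f => //= n IH f [df /IH]. Qed.

Lemma n_derivableD n f g : n_derivable n f -> n_derivable n g ->
  n_derivable n (fun x => f x + g x).
Proof.
elim: n f g => //= n IH f g fn gn.
apply: n_derivable_der (IH _ _ fn.2 gn.2) => x.
by apply: derD; apply: n_derivable_der1; [exact: fn|exact: gn].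
Qed.

Lemma n_derivableM n f g : n_derivable n f -> n_derivable n g ->
  n_derivable n (fun x => f x * g x).
Proof.
elim: n f g => // n IH f g fn gn.
apply: (@n_derivable_der n _ (fun x => derive1 f x * g x + f x * derive1 g x)).
  by move=> x; apply: derM; apply: n_derivable_der1; [exact: fn|exact: gn].
apply: n_derivableD; apply: IH; [exact: fn.2|exact: n_derivableW|
  exact: n_derivableW|exact: gn.2].
Qed.

Lemma n_derivableC n (c : R) : n_derivable n (fun=> c).
Proof.
elim: n c => // n IH c; apply: (@n_derivable_der n _ (fun=> 0)) => // x.
exact: derC.
Qed.

Lemma n_derivable_affine n f (a b : R) : n_derivable n f ->
  n_derivable n (fun x => f (a * x + b)).
Proof.
elim: n f => // n IH f fn.
apply: (@n_derivable_der n _ (fun x => derive1 f (a * x + b) * a)).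
  move=> x; apply: der_comp (n_derivable_der1 _ fn).
  by have := derD (derZ a (der_id x)) (derC b x); rewrite mulr1 addr0.
by apply: n_derivableM; [exact: IH fn.2|exact: n_derivableC].
Qed.

Lemma derXn f x a n : der f x a ->
  der (fun y => f y ^+ n) x (n%:R * f x ^+ n.-1 * a).
Proof.
move=> df; elim: n => [|n IH]; first by rewrite !mul0r; exact: derC.
rewrite (_ : (fun y => _) = fun y => f y * f y ^+ n); last first.
  by apply/funext => y; rewrite exprS.
apply: (der_eq (derM df IH)); case: n {IH} => [|n].
  by rewrite /=; ring.
by rewrite /= -(natr1 n.+1) (exprS _ n); ring.
Qed.

(** The functions x^(-k) e^(-1/x) are stable under differentiation, up to
    linear combinations. *)
Definition flat (k : nat) (x : R) : R :=
  if 0 < x then x^-1 ^+ k * expR (- x^-1) else 0.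

Lemma flat_ge0 k x : 0 <= flat k x.
Proof.
by rewrite /flat; case: ifP => // x0; rewrite mulr_ge0 ?expR_ge0 ?exprn_ge0 // invr_ge0 ltW.
Qed.

Lemma flat_le k x : 0 < x -> flat k x <= k.+1%:R ^+ k.+1 * x.
Proof.
move=> x0; rewrite /flat x0 expRN ler_pdivrMr ?expR_gt0 //.
have k0 : 0 < k.+1%:R :> R by rewrite ltr0n.
have : (x^-1 / k.+1%:R) ^+ k.+1 <= expR x^-1.
  have -> : expR x^-1 = expR (x^-1 / k.+1%:R) ^+ k.+1.
    by rewrite -expRM_natl; congr expR; rewrite mulrC divfK ?gt_eqF.
  apply: lerXn2r; rewrite ?nnegrE ?expR_ge0 ?divr_ge0 ?invr_ge0 ?(ltW x0) //.
  by apply: le_trans (expR_ge1Dx _); rewrite lerDr.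
rewrite expr_div_n ler_pdivrMr ?exprn_gt0 // => h.
have -> : x^-1 ^+ k = x * x^-1 ^+ k.+1 by rewrite exprS mulVKf ?gt_eqF.
by rewrite [_ * x]mulrC -mulrA ler_pM2l // mulrC.
Qed.

Lemma der_flat k x : der (flat k) x (flat k.+2 x - k%:R * flat k.+1 x).
Proof.
have [x0|x0|->] := ltgtP x 0.
- have -> : flat k.+2 x - k%:R * flat k.+1 x = 0.
    by rewrite /flat ltNge (ltW x0) /= mulr0 subr0.
  apply: near_eq_is_derive (derC 0 x).
  near=> y; rewrite /flat ltNge ifF //; apply/negbTE; rewrite negbK ltW //.
  by near: y; exact: lt_nbhsl.
- have xN0 : x != 0 by rewrite gt_eqF.
  have dV : der (fun y => y^-1) x (- 1 / x ^+ 2) by exact: derV (der_id x) xN0.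
  have dX : der (fun y => y^-1 ^+ k) x (k%:R * x^-1 ^+ k.-1 * (- 1 / x ^+ 2)).
    exact: derXn.
  have dE : der (fun y => expR (- y^-1)) x (expR (- x^-1) * - (- 1 / x ^+ 2)).
    exact: der_comp (derN dV) (@is_derive_expR _ _).
  have := derM dX dE => /near_eq_is_derive h.
  have {}h := h (flat k); apply: (der_eq (h _)).
    near=> y; rewrite /flat ifT //.
    by near: y; exact: lt_nbhsr.
  rewrite /flat x0 /= !mulN1r !opprK -exprVn.
  case: k {dX h} => [|k]; first by rewrite !(mul0r, mulr0, add0r, subr0, expr0, mul1r) mulrC.
  by rewrite !exprS /=; ring.
rewrite {2 3}/flat ltxx mulr0 subr0.
have flat_sqr h : `|flat k h| <= k.+2%:R ^+ k.+2 * h ^+ 2.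
  rewrite ger0_norm ?flat_ge0 //; have [h0|h0] := ltP 0 h; last first.
    by rewrite /flat ltNge h0 /= mulr_ge0 ?sqr_ge0 // exprn_ge0.
  have -> : flat k h = flat k.+1 h * h.
    by rewrite /flat h0 exprS; field; rewrite gt_eqF.
  by rewrite expr2 mulrA ler_pM2r // flat_le.
have flat00 : flat k 0 = 0 by rewrite /flat ltxx.
set C := k.+2%:R ^+ k.+2 in flat_sqr.
have C0 : 0 < C by rewrite exprn_gt0 // ltr0n.
have lim0 : h^-1 *: ((flat k \o shift 0) (h *: 1) - flat k 0) @[h --> 0^']
    --> (0 : R).
  apply/cvgrPdist_le => e e0; near=> h.
  rewrite flat00 subr0 /= addr0 sub0r normrN /GRing.scale /= mulr1 normrM normfV.
  have h0 : h != 0 by near: h; exact: nbhs_dnbhs_neq.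
  rewrite mulrC ler_pdivrMr ?normr_gt0 //.
  apply: le_trans (flat_sqr h) _.
  rewrite -(real_normK (num_real h)) expr2 mulrA ler_pM2r ?normr_gt0 //.
  rewrite mulrC -ler_pdivlMr //.
  near: h; apply: dnbhs0_le; exact: divr_gt0.
apply: DeriveDef; first by apply/cvg_ex; exists 0.
exact/cvg_lim.
Unshelve. all: by end_near. Qed.

Lemma n_derivable_flat n k : n_derivable n (flat k).
Proof.
elim: n k => // n IH k; apply: n_derivable_der (der_flat k) _.
rewrite (_ : (fun x => _) = fun x => flat k.+2 x + (- k%:R) * flat k.+1 x); last first.
  by apply/funext => x; rewrite mulNr.
by apply: n_derivableD => //; apply: n_derivableM => //; exact: n_derivableC.
Qed.

(** The bump is flat(x) flat(1 - x). That it is carried by one side of 0 makes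
    E(n (x - a)) converge to the indicator of ]a, +oo[ at every x, even x = a. *)
Lemma smooth_step : exists (eta E : R -> R) (B : R),
  [/\ forall n, n_derivable n eta,
      forall x, der E x (eta x),
      forall x, x <= 0 -> E x = 0, forall x, 1 <= x -> E x = 1 &
      forall x, 0 <= eta x <= B /\ (~~ (0 < x < 1) -> eta x = 0)].
Proof.
pose b x := flat 0 x * flat 0 (- 1 * x + 1).
have b_nd n : n_derivable n b.
  by apply: n_derivableM; [|apply: n_derivable_affine]; exact: n_derivable_flat.
have b_out x : ~~ (0 < x < 1) -> b x = 0.
  rewrite negb_and -!leNgt /b /flat => /orP[x0|x1].
    by rewrite ltNge x0 mul0r.
  by rewrite [X in _ * X](_ : _ = 0) ?mulr0 // mulN1r addrC subr_gt0 ltNge x1.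
have flat01 x : flat 0 x <= 1.
  rewrite /flat; case: ifP => // x0; rewrite expr0 mul1r -expR0 ler_expR.
  by rewrite oppr_le0 invr_ge0 ltW.
have b_01 x : 0 <= b x <= 1.
  by rewrite mulr_ge0 ?flat_ge0 //= mulr_ile1 ?flat_ge0.
have cb : continuous b by move=> x; exact: der_cont (n_derivable_der1 _ (b_nd 1%N)).
have [P [dP P0]] := primitive_exists cb.
have P_left x : x <= 0 -> P x = 0.
  move=> x0; have dI z : x <= z <= 0 -> der P z 0.
    by move=> /andP[_ z0]; rewrite -(b_out z) //; rewrite ltNge z0.
  by have [c _] := der_mvt x0 dI; rewrite P0 mul0r; lra.
have P_right x : 1 <= x -> P x = P 1.
  move=> x1; have dI z : 1 <= z <= x -> der P z 0.
    by move=> /andP[z1 _]; rewrite -(b_out z) // negb_and -!leNgt z1 orbT.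
  by have [c _] := der_mvt x1 dI; rewrite mul0r; lra.
have P1 : 0 < P 1.
  have h0 : 0 <= 2^-1 :> R by rewrite invr_ge0.
  have h1 : 2^-1 < 1 :> R by lra.
  have b_pos : 0 < b 2^-1.
    rewrite /b mulr_gt0 // /flat ifT ?mulr_gt0 ?expR_gt0 ?exprn_gt0 ?invr_gt0 //; lra.
  have mono x y : x <= y -> P x <= P y.
    by move=> xy; apply: (der_ge0_le xy (fun z _ => dP z)) => z _; case/andP: (b_01 z).
  rewrite lt_neqAle -{2}P0 mono // andbT; apply/eqP => P10.
  have PI z : 0 < z < 1 -> P z = 0.
    move=> /andP[z0 z1]; apply/eqP; rewrite eq_le {1}P10 mono ?(ltW z1) //=.
    by rewrite -P0 mono ?(ltW z0).
  have : b 2^-1 = 0.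
    apply: (der_unique (dP _)); apply: near_eq_is_derive (derC 0 _).
    near=> z; rewrite PI //; apply/andP; split; near: z.
      by apply: lt_nbhsr; rewrite invr_gt0.
    exact: lt_nbhsl.
  by move=> b0; rewrite b0 ltxx in b_pos.
exists (fun x => b x * (P 1)^-1), (fun x => (P 1)^-1 * P x), (P 1)^-1; split.
- by move=> n; apply: n_derivableM => //; exact: n_derivableC.
- by move=> x; rewrite mulrC; exact: derZ.
- by move=> x /P_left ->; rewrite mulr0.
- by move=> x /P_right ->; rewrite mulVf // gt_eqF.
- move=> x; have /andP[bx0 bx1] := b_01 x; split.
    by rewrite mulr_ge0 //= ?invr_ge0 ?(ltW P1) // ler_piMl // invr_ge0 ltW.
  by move=> /b_out ->; rewrite mul0r.
Unshelve. all: by end_near. Qed.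

End SmoothStep.

(** * Weak derivatives *)

Section WeakDerivative.
Context {R : realType}.
Local Notation mu := (@lebesgue_measure R).

Lemma ae_imp (P Q : R -> Prop) : (forall x, P x -> Q x) ->
  {ae mu, forall x, P x} -> {ae mu, forall x, Q x}.
Proof. by move=> PQ; apply: negligibleS => x /= nQ /PQ. Qed.

Lemma ae_and (P Q : R -> Prop) : {ae mu, forall x, P x} ->
  {ae mu, forall x, Q x} -> {ae mu, forall x, P x /\ Q x}.
Proof.
move=> aeP aeQ; apply: negligibleS (negligibleU aeP aeQ) => x /= /not_andP.
by case; [left|right].
Qed.

Lemma ae_exists (Q : R -> Prop) (a b : R) : a < b ->
  {ae mu, forall x, Q x} -> exists2 x, a < x < b & Q x.
Proof.
move=> ab aeQ; apply: contrapT => no.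
have n0 : mu.-negligible `]a, b[.
  apply: negligibleS aeQ => x /=; rewrite in_itv /= => xab Qx.
  by apply: no; exists x.
have : mu `]a, b[%classic = 0%E by exact: measure_negligible.
rewrite lebesgue_measure_itv /= lte_fin ab -EFinB => -[] /eqP.
by rewrite subr_eq0 gt_eqF.
Qed.

(** The set where f > h is open, so it is empty or of positive measure. *)
Lemma ae_le_everywhere (f h : R -> R) : continuous f -> continuous h ->
  {ae mu, forall x, f x <= h x} -> forall x, f x <= h x.
Proof.
move=> cf ch fh x; rewrite leNgt; apply/negP => hfx.
have cd : {for x, continuous (fun y => f y - h y)}.
  by apply: cvgB; [exact: cf|exact: ch].
have d0 : 0 < f x - h x by rewrite subr_gt0.
have : \forall y \near x, 0 < f y - h y by exact: (cvgr_gt _ cd _ d0).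
move=> [/= r r0 H].
have xr : x < x + r by rewrite ltrDl.
have [y /andP[y1 y2] +] := ae_exists xr fh.
rewrite leNgt => /negP; apply; rewrite -subr_gt0; apply: H => /=.
by rewrite distrC gtr0_norm ?subr_gt0 // ltrBlDl.
Qed.

Lemma integrable_mul_cutoff (u k : R -> R) (B c d : R) :
  locally_integrable setT u -> measurable_fun setT k ->
  (forall x, `|k x| <= B) -> (forall x, ~~ (c <= x <= d) -> k x = 0) ->
  mu.-integrable setT (EFin \o (fun x => u x * k x)) /\
  \int[mu]_x (u x * k x) = \int[mu]_(x in `[c, d]) (u x * k x).
Proof.
move=> lu mk kB k0.
have ukE : (fun x => u x * k x) = (fun x => u x * k x) \_ `[c, d].
  apply/funext => x; rewrite patchE; case: ifPn => // /negP xcd.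
  rewrite k0 ?mulr0 //; apply/negP => h; apply: xcd.
  by rewrite inE /= in_itv.
have B0 : 0 <= B := le_trans (normr_ge0 _) (kB 0).
have iuk : mu.-integrable `[c, d] (EFin \o (fun x => u x * k x)).
  have iBu : mu.-integrable `[c, d] (EFin \o (fun x => B * u x)).
    rewrite (_ : _ \o _ = (fun x => B%:E * (EFin \o u) x)%E) //.
    exact: integrableZl (locally_integrable_segment c d lu).
  apply: le_integrable iBu => //.
  - apply/measurable_EFinP; apply: measurable_funM.
      by case: lu => mf _ _; exact: measurable_funS mf.
    exact: measurable_funS mk.
  - move=> x _ /=; rewrite lee_fin !normrM (ger0_norm B0) mulrC.
    by rewrite ler_wpM2r.
split; last by rewrite {1}ukE -Rintegral_mkcond.
by rewrite ukE -restrict_EFin; apply: (integrable_mkcond _ _).1.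
Qed.

Section Test.
Variables (eta E : R -> R) (B : R).
Hypothesis eta_nd : forall n, n_derivable n eta.
Hypothesis dE : forall x, der E x (eta x).
Hypothesis E_left : forall x, x <= 0 -> E x = 0.
Hypothesis E_right : forall x, 1 <= x -> E x = 1.
Hypothesis eta_bnd : forall x, 0 <= eta x <= B.
Hypothesis eta_out : forall x, ~~ (0 < x < 1) -> eta x = 0.

Let N (n : nat) : R := n.+1%:R.
Let N0 n : 0 < N n. Proof. by rewrite ltr0n. Qed.
Let N1 n : 1 <= N n. Proof. by rewrite ler1n. Qed.

Let kern (a : R) (n : nat) (x : R) := eta (N n * x + - (N n * a)) * N n.
Let step (a : R) (n : nat) (x : R) := E (N n * x + - (N n * a)).

Let dstep a n x : der (step a n) x (kern a n x).
Proof.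
apply: der_comp (dE _).
by have := derD (derZ (N n) (der_id x)) (derC (- (N n * a)) x); rewrite mulr1 addr0.
Qed.

Let kern_nd m a n : n_derivable m (kern a n).
Proof.
apply: n_derivableM; last exact: n_derivableC.
exact: (n_derivable_affine _ _ (eta_nd m)).
Qed.

Let kern_cont a n : continuous (kern a n).
Proof. by move=> x; exact: der_cont (n_derivable_der1 _ (kern_nd 1 a n)). Qed.

Let kern_ge0 a n x : 0 <= kern a n x.
Proof.
apply: mulr_ge0; last exact: ltW.
by case/andP: (eta_bnd (N n * x + - (N n * a))).
Qed.

Let kern_le a n x : `|kern a n x| <= B * N n.
Proof.
rewrite ger0_norm // /kern ler_wpM2r ?(ltW (N0 n)) //.
by case/andP: (eta_bnd (N n * x + - (N n * a))).
Qed.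

Let kern_out a n x : ~~ (a <= x <= a + (N n)^-1) -> kern a n x = 0.
Proof.
move=> xa; rewrite /kern eta_out ?mul0r //; apply: contra xa => /andP[h1 h2].
have Nn := N0 n; apply/andP; split.
  by rewrite -(ler_pM2l Nn); lra.
by rewrite -(ler_pM2l Nn) mulrDr divff ?gt_eqF //; lra.
Qed.

Let E_le x : `|E x| <= 1.
Proof.
have mono x' y : x' <= y -> E x' <= E y.
  by move=> xy; apply: (der_ge0_le xy (fun z _ => dE z)) => z _; case/andP: (eta_bnd z).
have [x0|x0] := leP x 0; first by rewrite E_left // normr0.
have [x1|x1] := leP 1 x; first by rewrite E_right // normr1.
have := mono _ _ (ltW x0); have := mono _ _ (ltW x1).
rewrite (E_left (lexx 0)) (E_right (lexx 1)) => h1 h0; rewrite ger0_norm //.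
Qed.

(** The kernel is at most a constant times the normalized indicator of a ball
    around a; the error is thus controlled by the mean of |u - u(a)| over it. *)
Let kern_average (u : R -> R) (a e : R) : locally_integrable setT u ->
  lebesgue_pt u a -> 0 < e ->
  \forall n \near \oo, `|\int[mu]_x (u x * kern a n x) - u a| <= e.
Proof.
move=> lu ua e0; have B0 : 0 <= B by case/andP: (eta_bnd 0) => /le_trans h /h.
pose e' := e / (4 * (B + 1)).
have e'0 : 0 < e' by rewrite divr_gt0 // mulr_gt0 // ltr_wpDl.
move: (ua) => /fine_cvgP [] /at_right0P [b1 b10 H1] /cvg_at_right0P /(_ _ e'0) [b2 b20 H2].
pose b := Num.min b1 b2.
have b0 : 0 < b by rewrite lt_min b10 b20.
have b20' : 0 < b / 2 by rewrite divr_gt0.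
near=> n.
have nb : (N n)^-1 < b / 2.
  by near: n; exact: (near_infty_natSinv_lt (PosNum b20')).
have Nn := N0 n; set M := N n in nb Nn *.
have Mi : 0 < M^-1 by rewrite invr_gt0.
pose S := `[a, a + M^-1]%classic : set R.
have mS : measurable S by exact: measurable_itv.
have aS : a <= a + M^-1 by rewrite lerDl ltW.
have [_ ->] := integrable_mul_cutoff lu
  (continuous_measurable_fun (@kern_cont a n)) (kern_le a n) (@kern_out a n).
have one : \int[mu]_(x in S) kern a n x = 1.
  rewrite (Rintegral_segment aS (@kern_cont a n) (dstep a n)) /step.
  by rewrite E_right ?E_left ?subr0 // -/M ?mulrDr ?divff ?gt_eqF //; lra.
have luc : locally_integrable setT (fun x => u x - u a).
  by apply: locally_integrableB lu (continuous_locally_integrable _); exact: cst_continuous.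
have ik : mu.-integrable S (EFin \o kern a n).
  exact: continuous_integrable_segment.
have iuk : mu.-integrable S (EFin \o (fun x => u x * kern a n x)).
  have [i _] := integrable_mul_cutoff lu
    (continuous_measurable_fun (@kern_cont a n)) (kern_le a n) (@kern_out a n).
  by apply: integrableS i.
have iuk' : mu.-integrable S (EFin \o (fun x => (u x - u a) * kern a n x)).
  have [i _] := integrable_mul_cutoff luc
    (continuous_measurable_fun (@kern_cont a n)) (kern_le a n) (@kern_out a n).
  by apply: integrableS i.
have -> : \int[mu]_(x in S) (u x * kern a n x) - u a =
    \int[mu]_(x in S) ((u x - u a) * kern a n x).
  have uaE : u a = \int[mu]_(x in S) (u a * kern a n x).
    by rewrite RintegralZl // one mulr1.
  rewrite [X in _ - X = _]uaE -RintegralB //.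
    by apply: eq_Rintegral => x _; rewrite mulrBl.
  rewrite (_ : _ \o _ = (fun x => (u a)%:E * (EFin \o kern a n) x)%E) //.
  exact: integrableZl.
have iabs : mu.-integrable S (EFin \o (fun x => `|u x - u a|)).
  exact: integrable_norm (locally_integrable_segment _ _ luc).
apply: le_trans (le_normr_Rintegral _ _) _ => //.
apply: (@le_trans _ _ (B * M * \int[mu]_(x in S) `|u x - u a|)).
  rewrite -RintegralZl //; apply: le_Rintegral => //.
  - exact: integrable_norm iuk'.
  - rewrite (_ : _ \o _ = (fun x => (B * M)%:E * (EFin \o (fun x => `|u x - u a|%R)) x)%E) //.
    exact: integrableZl.
  - move=> x _; rewrite normrM mulrC ler_wpM2r ?normr_ge0 //; exact: kern_le.
pose r := 2 * M^-1.
have r0 : 0 < r by rewrite mulr_gt0.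
have rb : r < b by rewrite /r mulrC -ltr_pdivlMr.
have rb1 : 0 < r < b1 by rewrite r0 (lt_le_trans rb) // /b ge_min lexx.
have rb2 : 0 < r < b2 by rewrite r0 (lt_le_trans rb) // /b ge_min lexx orbT.
have := H2 _ rb2; rewrite subr0 /= => /(le_trans (ler_norm _)) dav.
have davE : (davg u a r = (r *+ 2)^-1%:E * \int[mu]_(y in ball a r) `|u y - u a|%:E)%E.
  by rewrite /davg /iavg lebesgue_measure_ball ?(ltW r0) // inver mulrn_eq0 /= gt_eqF.
have ib : mu.-integrable (ball a r) (EFin \o (fun x => `|u x - u a|)).
  apply: integrableS (integrable_norm (locally_integrable_segment (a - r) (a + r) luc)) => //.
    exact: measurable_ball.
  by rewrite ball_itv; exact: subset_itv_oo_cc.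
have Sball : S `<=` ball a r.
  rewrite ball_itv => x; rewrite /S /= !in_itv /= /r.
  by move: (M^-1) Mi => y y0 /andP[h1 h2]; apply/andP; split; lra.
have SI : \int[mu]_(x in S) `|u x - u a| <= \int[mu]_(x in ball a r) `|u x - u a|.
  apply: fine_le.
  - exact: integrable_fin_num.
  - by apply: integrable_fin_num ib; exact: measurable_ball.
  - apply: ge0_subset_integral => //; first exact: measurable_ball.
    by case/integrableP: ib.
have {dav}dav : (r *+ 2)^-1 * \int[mu]_(x in ball a r) `|u x - u a| <= e'.
  by move: dav; rewrite davE fineM // integrable_fin_num //; exact: measurable_ball.
rewrite mulrC ler_pdivrMr in dav; last by rewrite pmulrn_lgt0.
apply: le_trans (ler_wpM2l (mulr_ge0 B0 (ltW Nn)) (le_trans SI dav)) _.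
have -> : B * M * (e' * (r *+ 2)) = 4 * B * e'.
  by rewrite /r; field; rewrite gt_eqF.
rewrite /e' mulrA ler_pdivrMr ?mulr_gt0 ?ltr_wpDl //; have := e0; nra.
Unshelve. all: by end_near. Qed.

Let plateau a b n x := step a n x - step b n x.

(** At each x the difference of the two steps is eventually equal to the
    indicator of ]a, b], and dominated convergence applies. *)
Let plateau_integral (v : R -> R) (a b e : R) : a < b ->
  locally_integrable setT v -> 0 < e ->
  \forall n \near \oo,
    `|\int[mu]_x (v x * plateau a b n x) - \int[mu]_(x in `[a, b]) v x| <= e.
Proof.
move=> ab lv e0.
pose f_ n x := (v x * plateau a b n x)%:E.
pose f x := ((v \_ `]a, b]) x)%:E.
pose g x := (((fun x => 2 * v x) \_ `[a, b + 1]) x)%:E.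
have cplateau n : continuous (plateau a b n).
  move=> x; apply: cvgB.
    exact: der_cont (dstep a n x).
  exact: der_cont (dstep b n x).
have NE c n x : N n * x + - (N n * c) = N n * (x - c) by rewrite mulrBr.
have step_left c n x : x <= c -> step c n x = 0.
  by move=> xc; rewrite /step NE E_left // mulr_ge0_le0 ?(ltW (N0 n)) // subr_le0.
have step_right c x : c < x -> \forall n \near \oo, step c n x = 1.
  rewrite -subr_gt0 => xc; near=> n; rewrite /step NE E_right //.
  rewrite -ler_pdivrMl // mulr1 ltW //.
  by near: n; exact: (near_infty_natSinv_lt (PosNum xc)).
have f_f x : f_ ^~ x @ \oo --> f x.
  apply: cvg_near_cst; rewrite /f_ /f patchE.
  case: ifPn => [|/negP]; rewrite inE /= in_itv /=.
    move=> /andP[ax xb]; near=> n.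
    rewrite /plateau (step_left b) // subr0 (near (step_right a x ax) n) ?mulr1 //.
  move=> xab; have [xa|ax] := leP x a.
    near=> n; rewrite /plateau !step_left ?subrr ?mulr0 //.
    by apply: le_trans xa _; exact: ltW.
  have xb : b < x by rewrite ltNge; apply/negP => h; apply: xab; rewrite ax.
  near=> n; rewrite /plateau (near (step_right a x ax) n) //.
  by rewrite (near (step_right b x xb) n) // subrr mulr0.
have ig : mu.-integrable setT (fun x => `|g x|%E).
  apply: integrable_abse; rewrite /g.
  rewrite (_ : (fun x => _) = EFin \o ((fun x => 2 * v x) \_ `[a, b + 1])) //.
  rewrite -restrict_EFin; apply/(integrable_mkcond _ _).1 => //.
  rewrite (_ : _ \o _ = (fun x => 2%:E * (EFin \o v) x)%E) //.
  exact: integrableZl (locally_integrable_segment _ _ lv).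
have plateau_out n x : ~~ (a <= x <= b + 1) -> plateau a b n x = 0.
  rewrite negb_and -!ltNge => /orP[xa|bx].
    by rewrite /plateau !step_left ?subrr //; lra.
  rewrite /plateau /step !NE !E_right ?subrr //.
    by apply: le_trans (ler_peMl _ (N1 n)); lra.
  by apply: le_trans (ler_peMl _ (N1 n)); lra.
have f_g x n : (`|f_ n x| <= `|g x|)%E.
  rewrite /f_ /g /= lee_fin patchE; case: ifPn => [_|/negP].
    rewrite !normrM mulrC ler_wpM2r //; apply: le_trans (ler_normB _ _) _.
    by rewrite (ger0_norm (ler0n _ 2)); have := E_le (N n * x + - (N n * a));
      have := E_le (N n * x + - (N n * b)); rewrite /step; lra.
  rewrite inE /= in_itv /= => /negP xab.
  by rewrite plateau_out // mulr0.
have [|||||if1 _ lim] := @dominated_convergence _ _ R mu setT measurableT f_ f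
    (fun x => `|g x|%E).
- by move=> n; apply/measurable_EFinP; apply: measurable_funM;
    [by case: lv|exact: continuous_measurable_fun].
- apply/measurable_EFinP; apply/(measurable_restrict _ _ _).1 => //.
  by case: lv => mv _ _; exact: measurable_funS mv.
- by apply: aeW => x _; exact: f_f.
- exact: ig.
- by apply: aeW => x n _; exact: f_g.
have fE : (\int[mu]_x f x = (\int[mu]_(x in `[a, b]) v x)%:E)%E.
  rewrite -Rintegral_itv_obnd_cbnd; last first.
    apply: integrableS (locally_integrable_segment a b lv) => //.
    exact: subset_itv_oc_cc.
  by rewrite Rintegral_mkcond /Rintegral fineK // integrable_fin_num.
rewrite fE in lim; move/fine_cvg/cvgrPdist_le: lim => /(_ _ e0).
by apply: filterS => n; rewrite distrC.
Unshelve. all: by end_near. Qed.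

Let weak_derivative_lebesgue_pt (u v : R -> R) (a b : R) :
  weak_derivative u v -> a < b -> lebesgue_pt u a -> lebesgue_pt u b ->
  \int[mu]_(x in `[a, b]) v x = u b - u a.
Proof.
move=> [lu lv uv] ab ua ub.
suff : `|\int[mu]_(x in `[a, b]) v x - (u b - u a)| <= 0.
  by rewrite normr_le0 subr_eq0 => /eqP.
apply/ler_addgt0Pr => e e0; rewrite add0r.
have e3 : 0 < e / 3 by rewrite divr_gt0.
have [n [Ha Hb Hv]] : exists n,
   [/\ `|\int[mu]_x (u x * kern a n x) - u a| <= e / 3,
       `|\int[mu]_x (u x * kern b n x) - u b| <= e / 3 &
       `|\int[mu]_x (v x * plateau a b n x) - \int[mu]_(x in `[a, b]) v x| <= e / 3].
  near \oo => n; exists n; split; near: n; [exact: kern_average|exact: kern_average|].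
  exact: plateau_integral.
have dpl x : der (plateau a b n) x (kern a n x - kern b n x).
  exact: derB.
have plE : derive1 (plateau a b n) = fun x => kern a n x - kern b n x.
  by apply/funext => x; exact: derive1_val (dpl x).
have test : test_function (plateau a b n).
  split.
    apply: n_derivableP => -[//|m]; apply: n_derivable_der dpl _.
    rewrite (_ : (fun x => _) = fun x => kern a n x + (-1) * kern b n x).
      apply: n_derivableD => //; apply: n_derivableM => //; exact: n_derivableC.
    by apply/funext => x; rewrite mulN1r.
  apply: (@subclosed_compact _ _ `[a, b + 1]); first exact: closed_closure.
    exact: segment_compact.
  rewrite [X in _ `<=` X](closure_id _).1; last exact: itv_closed.
  apply: closure_subset => x /= plx; rewrite in_itv /=.
  have NE c z : N n * z + - (N n * c) = N n * (z - c) by rewrite mulrBr.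
  apply: contraNT plx; rewrite negb_and -!ltNge => /orP[xa|bx]; apply/eqP.
    by rewrite /plateau /step !NE !E_left ?subrr // pmulr_rle0 //; lra.
  rewrite /plateau /step !NE !E_right ?subrr //.
    by apply: le_trans (ler_peMl _ (N1 n)); lra.
  by apply: le_trans (ler_peMl _ (N1 n)); lra.
have := uv _ test; rewrite plE.
have [ia _] := integrable_mul_cutoff lu
    (continuous_measurable_fun (@kern_cont a n)) (kern_le a n) (@kern_out a n).
have [ib _] := integrable_mul_cutoff lu
    (continuous_measurable_fun (@kern_cont b n)) (kern_le b n) (@kern_out b n).
rewrite (_ : \int[mu]_x (u x * (kern a n x - kern b n x)) =
  \int[mu]_x (u x * kern a n x) - \int[mu]_x (u x * kern b n x)); last first.
  by rewrite -RintegralB //; apply: eq_Rintegral => x _; rewrite mulrBr.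
move: Ha Hb Hv; rewrite !ler_norml; lra.
Unshelve. all: by end_near. Qed.

Lemma weak_derivative_increments (u v : R -> R) (a b : R) :
  weak_derivative u v -> a <= b -> lebesgue_pt u a -> lebesgue_pt u b ->
  \int[mu]_(x in `[a, b]) v x = u b - u a.
Proof.
move=> uv; rewrite le_eqVlt => /predU1P[->|ab].
  by rewrite set_itv1 Rintegral_set1 subrr.
exact: weak_derivative_lebesgue_pt.
Qed.

End Test.

(** Testing against a plateau that steepens at two Lebesgue points a < b of u
    turns the weak formulation into the increment of u from a to b. *)
Lemma weak_derivative_primitive (u v : R -> R) : weak_derivative u v ->
  exists P : R -> R, [/\ continuous P, indefinite_integral v P &
    {ae mu, forall x, u x = P x}].
Proof.
move=> uv; have [lu lv _] := uv.
have [eta [E [B [h1 h2 h3 h4 h5]]]] := @smooth_step R.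
have incr := weak_derivative_increments h1 h2 h3 h4 (fun x => (h5 x).1) (fun x => (h5 x).2) uv.
have [P cP vP] := indefinite_integral_exists lv.
have leb := lebesgue_differentiation lu.
have [x0 _ x0L] := ae_exists (@ltr01 R) leb.
exists (fun x => P x + (u x0 - P x0)); split.
- by move=> x; apply: cvgD; [exact: cP|exact: cvg_cst].
- by move=> a b ab; rewrite vP //; ring.
- apply: ae_imp leb => x xL; have [xx0|/ltW xx0] := leP x0 x.
    by have := incr _ _ xx0 x0L xL; rewrite vP //; lra.
  by have := incr _ _ xx0 xL x0L; rewrite vP //; lra.
Qed.

End WeakDerivative.

(** * Resonances are classical solutions *)

Section Regularity.
Context {R : realType}.
Local Notation mu := (@lebesgue_measure R).

Lemma indefinite_integral_ae (v h P : R -> R) : measurable_fun setT v ->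
  continuous h -> {ae mu, forall x, v x = h x} ->
  indefinite_integral v P -> indefinite_integral h P.
Proof.
move=> mv ch vh vP a b ab; rewrite -vP //; congr fine.
apply: ae_eq_integral => //.
- by apply/measurable_EFinP; apply: measurable_funS (continuous_measurable_fun ch).
- by apply/measurable_EFinP; apply: measurable_funS mv.
- by apply: ae_imp vh => x /= -> _.
Qed.

Lemma weak_derivative2_regular (u u1 u2 : R -> R) :
  weak_derivative u u1 -> weak_derivative u1 u2 ->
  exists P P1 : R -> R, [/\ {ae mu, forall x, u x = P x},
    {ae mu, forall x, u1 x = P1 x}, continuous P, continuous P1 &
    (forall x, der P x (P1 x)) /\
    forall h : R -> R, continuous h -> {ae mu, forall x, u2 x = h x} ->
      forall x, der P1 x (h x)].
Proof.
move=> uu1 u1u2.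
have [P [cP u1P uP]] := weak_derivative_primitive uu1.
have [P1 [cP1 u2P1 u1P1]] := weak_derivative_primitive u1u2.
have [_ [mu1 _ _] _] := uu1; have [_ [mu2 _ _] _] := u1u2.
exists P, P1; split => //; split.
  apply: der_indefinite_integral => //.
  exact: indefinite_integral_ae u1P.
move=> h ch u2h; apply: der_indefinite_integral => //.
exact: indefinite_integral_ae u2P1.
Qed.

Lemma Linfty_bounded (u P : R -> R) : u \in Lfun mu +oo%E -> continuous P ->
  {ae mu, forall x, u x = P x} -> exists K : R, forall x, `|P x| <= K.
Proof.
rewrite inE => /andP[_]; rewrite inE /= /finite_norm unlock.
have -> : (0 < mu [set: R])%E.
  apply: (@lt_le_trans _ _ (mu `[0, 1]%classic)).
    by rewrite lebesgue_measure_itv /= lte_fin ltr01 sube0 lte_fin.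
  by apply: le_measure => //; rewrite inE.
move=> /ess_supr_bounded [K uK] cP uP; exists K.
apply: ae_le_everywhere.
- by move=> x; apply: (continuous_comp (cP x)); exact: norm_continuous.
- by move=> x; exact: cvg_cst.
- by apply: ae_imp (ae_and uK uP) => x /= [h <-].
Qed.

Lemma L2_sqr_primitive (u P : R -> R) : u \in Lfun mu 2%:E -> continuous P ->
  {ae mu, forall x, u x = P x} ->
  exists (Q : R -> R) (C : R), (forall x, der Q x (P x ^+ 2)) /\
    forall x, `|Q x| <= C.
Proof.
move=> u2 cP uP.
have iu := Lfun2_integrable_sqr u2.
have cP2 : continuous (fun x => P x ^+ 2).
  by move=> x; rewrite (_ : (fun x => _) = (fun x => P x * P x)) //; apply: cvgM; exact: cP.
have iE : (\int[mu]_x `|(EFin \o (fun x => (u x ^+ 2)%R)) x| =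
    \int[mu]_x `|(EFin \o (fun x => (P x ^+ 2)%R)) x|)%E.
  apply: ae_eq_integral => //.
  - by apply: measurableT_comp => //; case/integrableP: iu.
  - apply: measurableT_comp => //; apply/measurable_EFinP.
    exact: continuous_measurable_fun.
  - by apply: ae_imp uP => x /= -> _.
have iP : mu.-integrable setT (EFin \o (fun x => P x ^+ 2)).
  apply/integrableP; split.
    by apply/measurable_EFinP; exact: continuous_measurable_fun.
  by rewrite -iE; case/integrableP: iu.
have [Q [dQ Q0]] := primitive_exists cP2.
exists Q, (\int[mu]_x (P x ^+ 2)); split => //.
have Qle a b : a <= b -> Q b - Q a <= \int[mu]_x (P x ^+ 2).
  move=> ab; rewrite -(Rintegral_segment ab cP2 dQ).
  apply: fine_le.
  - by apply: integrable_fin_num; [|exact: continuous_integrable_segment].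
  - exact: integrable_fin_num.
  - apply: ge0_subset_integral => //.
      by case/integrableP: iP.
    by move=> x _; rewrite lee_fin sqr_ge0.
have Qmono a b : a <= b -> Q a <= Q b.
  by move=> ab; apply: (der_ge0_le ab (fun z _ => dQ z)) => z _; exact: sqr_ge0.
move=> x; have [x0|/ltW x0] := leP 0 x.
  by have := Qle _ _ x0; have := Qmono _ _ x0; rewrite Q0 subr0 => h; rewrite ger0_norm.
by have := Qle _ _ x0; have := Qmono _ _ x0; rewrite Q0 sub0r => h; rewrite ler0_norm.
Qed.

(** If |f(x)| > e then |f| > e / 2 on an interval of fixed length, which costs a
    fixed amount of the convergent integral of f^2. *)
Lemma sqr_integrable_lipschitz_lim (f f' Q : R -> R) (L C : R) :
  (forall x, der f x (f' x)) -> (forall x, `|f' x| <= L) ->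
  (forall x, der Q x (f x ^+ 2)) -> (forall x, `|Q x| <= C) ->
  f x @[x --> +oo] --> (0 : R).
Proof.
move=> df f'L dQ QC.
have Qnd : nondecreasing_fun Q.
  by move=> x y xy; apply: (der_ge0_le xy (fun z _ => dQ z)) => z _; exact: sqr_ge0.
have Qub : has_ubound (range Q).
  by exists C => _ [x _ <-]; apply: le_trans (QC x); exact: ler_norm.
have Ql := nondecreasing_cvgr Qnd Qub.
have L0 : 0 <= L := le_trans (normr_ge0 _) (f'L 0).
apply: near_cvgy => e e0.
pose d := e / (2 * (L + 1)).
have L1 : 0 < 2 * (L + 1) by rewrite mulr_gt0 // ltr_wpDl.
have d0 : 0 < d by rewrite divr_gt0.
have dL : L * d <= e / 2.
  rewrite /d mulrA ler_pdivrMr //.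
  have -> : e / 2 * (2 * (L + 1)) = L * e + e by field.
  by rewrite lerDl ltW.
have k0 : 0 < d * e ^+ 2 / 16 by rewrite divr_gt0 // mulr_gt0 // exprn_gt0.
have [M HM] := cvgy_near Ql k0; exists M => x Mx; rewrite subr0 leNgt.
apply/negP => ex.
have xd : x <= x + d by rewrite lerDl ltW.
have big y : x <= y <= x + d -> e ^+ 2 / 4 <= f y ^+ 2.
  move=> /andP[xy yd].
  have [c _ fE] := der_mvt xy (fun z _ => df z).
  have : `|f y - f x| <= e / 2.
    rewrite fE normrM; apply: le_trans dL; apply: ler_pM => //.
    by rewrite ger0_norm ?subr_ge0 // lerBlDl.
  have := ler_normB (f y) (f y - f x); rewrite opprB addrC subrK => h1 h2.
  have h3 : e / 2 <= `|f y| by lra.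
  rewrite -(real_normK (num_real (f y))) (_ : e ^+ 2 / 4 = (e / 2) ^+ 2); last by field.
  by rewrite ler_sqr // nnegrE // divr_ge0 // ltW.
have dlin y : der (fun y => e ^+ 2 / 4 * y) y (e ^+ 2 / 4).
  by have := derZ (e ^+ 2 / 4) (der_id y); rewrite mulr1.
have := der_le_le xd (fun y _ => dlin y) (fun y _ => dQ y) big.
have := HM _ Mx; have := HM _ (le_trans Mx xd).
by rewrite !ler_norml; have := k0; lra.
Qed.

End Regularity.

(** * Darboux transformation of the linearized system *)

Section Vanishing.
Context {R : realType}.
Implicit Types f h : R -> R[i].

Definition vanishes f : Prop := normc (f x) @[x --> +oo] --> (0 : R).

Definition bounded_by (K : R) f : Prop := forall x, normc (f x) <= K.

Lemma vanishesP f : vanishes f <-> forall e, 0 < e ->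
  exists M : R, forall x, M <= x -> normc (f x) <= e.
Proof.
split=> [f0 e e0|H].
  by have [M H] := cvgy_near f0 e0; exists M => x /H; rewrite subr0 ger0_norm ?normc_ge0.
by apply: near_cvgy => e /H [M HM]; exists M => x /HM; rewrite subr0 ger0_norm ?normc_ge0.
Qed.

Lemma vanishes_le f h : (forall x, normc (f x) <= normc (h x)) ->
  vanishes h -> vanishes f.
Proof.
move=> fh /vanishesP h0; apply/vanishesP => e /h0 [M HM].
by exists M => x /HM; apply: le_trans.
Qed.

Lemma vanishesD f h : vanishes f -> vanishes h -> vanishes (fun x => f x + h x).
Proof.
move=> /vanishesP f0 /vanishesP h0; apply/vanishesP => e e0.
have e2 : 0 < e / 2 by rewrite divr_gt0.
have [M1 H1] := f0 _ e2; have [M2 H2] := h0 _ e2.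
exists (Num.max M1 M2) => x; rewrite ge_max => /andP[/H1 h1 /H2 h2].
by apply: le_trans (normc_add _ _) _; lra.
Qed.

Lemma vanishesM (K : R) f h : bounded_by K f -> vanishes h ->
  vanishes (fun x => f x * h x).
Proof.
move=> fK /vanishesP h0; apply/vanishesP => e e0.
have K1 : 0 < K + 1 by rewrite ltr_wpDl // (le_trans _ (fK 0)) ?normc_ge0.
have eK : 0 < e / (K + 1) by rewrite divr_gt0.
have [M H] := h0 _ eK; exists M => x /H hx; rewrite normcM.
apply: (@le_trans _ _ ((K + 1) * (e / (K + 1)))).
  by apply: ler_pM; rewrite ?normc_ge0 // (le_trans (fK x)) // lerDl.
by rewrite mulrCA divff ?mulr1 // gt_eqF.
Qed.

Lemma vanishesMr (K : R) f h : bounded_by K f -> vanishes h ->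
  vanishes (fun x => h x * f x).
Proof.
move=> fK /(vanishesM fK); apply: vanishes_le => x.
by rewrite mulrC.
Qed.

Lemma vanishes_mul f h : vanishes f -> vanishes h ->
  vanishes (fun x => f x * h x).
Proof.
move=> /vanishesP f0 /vanishesP h0; apply/vanishesP => e e0.
have [M1 H1] := f0 _ ltr01; have [M2 H2] := h0 _ e0.
exists (Num.max M1 M2) => x; rewrite ge_max => /andP[/H1 h1 /H2 h2].
by rewrite normcM -[e]mul1r; apply: ler_pM; rewrite ?normc_ge0.
Qed.

Lemma vanishesZ (c : R[i]) f : vanishes f -> vanishes (fun x => c * f x).
Proof. by apply: (@vanishesM (normc c)) => x. Qed.

Lemma vanishesN f : vanishes f -> vanishes (fun x => - f x).
Proof. by apply: vanishes_le => x; rewrite normc_opp. Qed.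

Lemma vanishes_real (a : R -> R) : a x @[x --> +oo] --> (0 : R) ->
  vanishes (fun x => (a x)%:C%C).
Proof.
move=> a0; apply/vanishesP => e e0; have [M H] := cvgy_near a0 e0.
by exists M => x /H; rewrite subr0 normc_real.
Qed.

Lemma vanishes_eq f h : f =1 h -> vanishes f -> vanishes h.
Proof. by move=> fh; apply: vanishes_le => x; rewrite fh. Qed.

(** The increment of u1 over [x, x + 1] is c u(x) up to vanishing terms. *)
Lemma vanishes_driven (u u1 E : R -> R[i]) (c : R[i]) :
  (forall x, cder u x (u1 x)) -> (forall x, cder u1 x (c * u x + E x)) ->
  vanishes u1 -> vanishes E -> vanishes (fun x => c * u x).
Proof.
move=> du du1 /vanishesP u10 /vanishesP E0; apply/vanishesP => e e0.
pose e1 := e / (4 * (normc c + 1)).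
have c1 : 0 < normc c + 1 by rewrite ltr_wpDl ?normc_ge0.
have e10 : 0 < e1 by rewrite divr_gt0 // mulr_gt0.
have ce1 : normc c * e1 <= e / 4.
  rewrite /e1 mulrA ler_pdivrMr ?mulr_gt0 //.
  have -> : e / 4 * (4 * (normc c + 1)) = normc c * e + e by field.
  by rewrite lerDl ltW.
have e11 : e1 <= e / 4.
  rewrite /e1 ler_pdivrMr ?mulr_gt0 //.
  have -> : e / 4 * (4 * (normc c + 1)) = e + normc c * e by field.
  by rewrite lerDl mulr_ge0 ?normc_ge0 // ltW.
have [M1 H1] := u10 _ e10; have [M2 H2] := E0 _ e10.
exists (Num.max M1 M2) => x; rewrite ge_max => /andP[M1x M2x].
have cdcst (z : R[i]) y : cder (fun=> z) y (0 : R[i]) by split; exact: derC.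
have x1 : x <= x + 1 by lra.
have u_var y : x <= y <= x + 1 -> normc (u y - u x) <= e1.
  move=> /andP[xy yx1].
  have dlin t : der (fun t => e1 * t) t e1.
    by have := derZ e1 (der_id t); rewrite mulr1.
  have dux t : x <= t <= y -> cder (fun t => u t - u x) t (u1 t).
    by move=> _; have := cderB (du t) (cdcst (u x) t); rewrite subr0.
  have b t : x <= t <= y -> normc (u1 t) <= e1.
    by move=> /andP[xt _]; apply: H1; lra.
  have := normc_growth_le xy dux (fun t _ => dlin t) b.
  rewrite subrr normc_zero add0r -mulrBr => /le_trans; apply.
  by rewrite ler_piMr ?(ltW e10) //; lra.
pose D y := u1 y - u1 x - c * u x * (y - x)%:C%C.
have dD y : x <= y <= x + 1 -> cder D y (c * (u y - u x) + E y).
  move=> _; have dyx : der (fun y => y - x) y 1.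
    by have := derB (der_id y) (derC x y); rewrite subr0.
  apply: (cder_eq (cderB (cderB (du1 y) (cdcst (u1 x) y)) (cderZ (c * u x) (cder_real dyx)))).
  by cbv beta; rewrite rmorph1; ring.
have dlin t : der (fun t => e / 2 * t) t (e / 2).
  by have := derZ (e / 2) (der_id t); rewrite mulr1.
have bD y : x <= y <= x + 1 -> normc (c * (u y - u x) + E y) <= e / 2.
  move=> xy; apply: le_trans (normc_add _ _) _; rewrite normcM.
  have h1 := ler_wpM2l (normc_ge0 c) (u_var y xy).
  have h2 : normc (E y) <= e1 by apply: H2; case/andP: xy; lra.
  by lra.
have := normc_growth_le x1 dD (fun t _ => dlin t) bD.
have -> : D x = 0 by rewrite /D !subrr rmorph0; ring.
rewrite normc_zero add0r => Dx1.
have -> : c * u x = u1 (x + 1) - u1 x - D (x + 1).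
  by rewrite /D (_ : x + 1 - x = 1) ?rmorph1; ring.
apply: le_trans (normc_sub _ _) _; apply: le_trans (lerD (normc_sub _ _) (lexx _)) _.
have h1 : normc (u1 (x + 1)) <= e1 by apply: H1; lra.
have h2 : normc (u1 x) <= e1 by exact: H1.
by lra.
Qed.

Lemma cder_0_cst f : (forall x, cder f x 0) -> forall x y, f x = f y.
Proof.
move=> df x y; apply: complex_eq.
  by apply: (@der_0_cst _ (fun z => complex.Re (f z))) => z; have [] := df z.
by apply: (@der_0_cst _ (fun z => complex.Im (f z))) => z; have [] := df z.
Qed.

(** The Wronskian is constant, and it vanishes at infinity. *)
Lemma wronskian_zero (U a a1 : R -> R) (X X1 : R -> R[i]) (K : R) :
  (forall x, der a x (a1 x)) -> (forall x, der a1 x (U x * a x)) ->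
  (forall x, cder X x (X1 x)) -> (forall x, cder X1 x ((U x)%:C%C * X x)) ->
  a x @[x --> +oo] --> (0 : R) -> a1 x @[x --> +oo] --> (0 : R) ->
  bounded_by K X -> vanishes X1 ->
  forall x, X1 x * (a x)%:C%C = X x * (a1 x)%:C%C.
Proof.
move=> da da1 dX dX1 /vanishes_real a0 /vanishes_real a10 XK X10 x.
pose Wr x := X1 x * (a x)%:C%C - X x * (a1 x)%:C%C.
have dWr y : cder Wr y 0.
  apply: (cder_eq (cderB (cderM (dX1 y) (cder_real (da y)))
    (cderM (dX y) (cder_real (da1 y))))).
  by cbv beta; rewrite rmorphM /=; ring.
have /vanishesP Wr0 : vanishes Wr.
  apply: vanishesD; first exact: vanishes_mul.
  by apply: vanishesN; exact: vanishesM XK a10.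
suff : Wr x = 0 by move/eqP; rewrite subr_eq0 => /eqP.
apply: normc_eq0; apply/ler_addgt0Pr => e /Wr0 [M HM]; rewrite add0r.
by rewrite (cder_0_cst dWr x M) HM.
Qed.

(** Landau's inequality: f1(x) differs from f(x + 1) - f(x) by at most L. *)
Lemma landau_bound (f f1 f2 : R -> R[i]) (K L : R) :
  (forall x, cder f x (f1 x)) -> (forall x, cder f1 x (f2 x)) ->
  bounded_by K f -> bounded_by L f2 -> bounded_by (K + K + L) f1.
Proof.
move=> df df1 fK f2L x.
have L0 : 0 <= L := le_trans (normc_ge0 _) (f2L 0).
have dlin t : der (fun t => L * t) t L.
  by have := derZ L (der_id t); rewrite mulr1.
have cdcst (z : R[i]) y : cder (fun=> z) y (0 : R[i]) by split; exact: derC.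
have x1 : x <= x + 1 by lra.
have f1_var y : x <= y <= x + 1 -> normc (f1 y - f1 x) <= L.
  move=> /andP[xy yx1].
  have dfx t : x <= t <= y -> cder (fun t => f1 t - f1 x) t (f2 t).
    by move=> _; have := cderB (df1 t) (cdcst (f1 x) t); rewrite subr0.
  have := normc_growth_le xy dfx (fun t _ => dlin t) (fun t _ => f2L t).
  rewrite subrr normc_zero add0r -mulrBr => /le_trans; apply.
  by rewrite ler_piMr //; lra.
pose D y := f y - f x - f1 x * (y - x)%:C%C.
have dD y : x <= y <= x + 1 -> cder D y (f1 y - f1 x).
  move=> _; have dyx : der (fun y => y - x) y 1.
    by have := derB (der_id y) (derC x y); rewrite subr0.
  apply: (cder_eq (cderB (cderB (df y) (cdcst (f x) y)) (cderZ (f1 x) (cder_real dyx)))).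
  by cbv beta; rewrite rmorph1; ring.
have := normc_growth_le x1 dD (fun t _ => dlin t) f1_var.
have -> : D x = 0 by rewrite /D !subrr rmorph0; ring.
rewrite normc_zero add0r => Dx1.
have -> : f1 x = f (x + 1) - f x - D (x + 1).
  by rewrite /D (_ : x + 1 - x = 1) ?rmorph1; ring.
apply: le_trans (normc_sub _ _) _; apply: le_trans (lerD (normc_sub _ _) (lexx _)) _.
by have := fK (x + 1); have := fK x; lra.
Qed.

End Vanishing.

Section Darboux.
Context {R : realType}.

(** The coefficients are those of the linearization at the soliton, written
    in terms of psi = phi'/phi and r = phi^2; gr, g1r and q stand for g(r),
    g'(r) and G(r)/r. *)
Variables (w : R) (psi r gr g1r q : R -> R).

Let psi' x := - r x / 2 + gr x - q x.
Let psi'' x := psi x * (- r x + 2 * r x * g1r x - 2 * gr x + 2 * q x).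
Let Um x := w - r x + gr x.
Let Up x := w - 3 * r x + gr x + 2 * r x * g1r x.
Let ap x := - gr x + 2 * q x.
Let am x := - 5 * gr x + 6 * q x + 2 * r x * g1r x.

Hypothesis psi_sqr : forall x, psi x ^+ 2 = w - r x / 2 + q x.
Hypothesis dpsi : forall x, der psi x (psi' x).
Hypothesis dpsi' : forall x, der psi' x (psi'' x).

Definition linearized (X X1 Y Y1 : R -> R[i]) (lam : R[i]) : Prop :=
  [/\ forall x, cder X x (X1 x), forall x, cder Y x (Y1 x),
      forall x, cder X1 x ((Um x)%:C%C * X x - lam * Y x) &
      forall x, cder Y1 x ((Up x)%:C%C * Y x - lam * X x)].

(** With S = d/dx - psi, V is S^2 X and W the second-order expression of Y that
    intertwines in the same way; second derivatives are eliminated by means of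
    the equations. V1 and W1 are the derivatives of V and W. *)
Definition darbouxV (X X1 Y Y1 : R -> R[i]) (lam : R[i]) (x : R) : R[i] :=
  (- 2 * psi x)%:C%C * X1 x + (2 * psi x ^+ 2)%:C%C * X x - lam * Y x.
Definition darbouxV1 (X X1 Y Y1 : R -> R[i]) (lam : R[i]) (x : R) : R[i] :=
  (2 * psi x ^+ 2 - 2 * psi' x)%:C%C * X1 x
  + (2 * psi x * psi' x - 2 * psi x ^+ 3)%:C%C * X x
  + (2 * psi x)%:C%C * (lam * Y x) - lam * Y1 x.
Definition darbouxW (X X1 Y Y1 : R -> R[i]) (lam : R[i]) (x : R) : R[i] :=
  (- 2 * psi x)%:C%C * Y1 x + (2 * (psi x ^+ 2 + psi' x))%:C%C * Y x - lam * X x.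
Definition darbouxW1 (X X1 Y Y1 : R -> R[i]) (lam : R[i]) (x : R) : R[i] :=
  (2 * psi x ^+ 2)%:C%C * Y1 x
  + (- 2 * psi x * (psi x ^+ 2 + psi' x))%:C%C * Y x
  + (2 * psi x)%:C%C * (lam * X x) - lam * X1 x.

Section Derivatives.
Variables (X X1 Y Y1 : R -> R[i]) (lam : R[i]).
Hypothesis XY : linearized X X1 Y Y1 lam.

Let wE x : w = psi x ^+ 2 + r x / 2 - q x.
Proof. by rewrite psi_sqr; ring. Qed.

Let combine (a b c : R -> R) (a' b' c' : R) (A B C D : R -> R[i])
    (A' B' C' D' : R[i]) x :
  der a x a' -> der b x b' -> der c x c' ->
  cder A x A' -> cder B x B' -> cder C x C' -> cder D x D' ->
  cder (fun x => (a x)%:C%C * A x + (b x)%:C%C * B x + (c x)%:C%C * (lam * C x)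
          - lam * D x) x
    ((a'%:C%C * A x + (a x)%:C%C * A') + (b'%:C%C * B x + (b x)%:C%C * B')
     + (c'%:C%C * (lam * C x) + (c x)%:C%C * (lam * C')) - lam * D').
Proof.
move=> da db dc dA dB dC dD; apply: cderB; last exact: cderZ.
apply: cderD; last exact: (cderM (cder_real dc) (cderZ lam dC)).
by apply: cderD; [exact: (cderM (cder_real da) dA)|exact: (cderM (cder_real db) dB)].
Qed.

Let dm2psi x : der (fun x => - 2 * psi x) x (- 2 * psi' x).
Proof. exact: derZ. Qed.
Let d2psi x : der (fun x => 2 * psi x) x (2 * psi' x).
Proof. exact: derZ. Qed.
Let d2psi2 x : der (fun x => 2 * psi x ^+ 2) x (2 * (2 * psi x * psi' x)).
Proof. by apply: derZ; exact: derX2. Qed.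
Let dpsi3 x : der (fun x => psi x ^+ 3) x (psi' x * psi x ^+ 2 + psi x * (2 * psi x * psi' x)).
Proof.
rewrite (_ : (fun x => _) = fun x => psi x * psi x ^+ 2); last by apply/funext => y; rewrite exprS.
by apply: derM => //; exact: derX2.
Qed.

Lemma cderV x : cder (darbouxV X X1 Y Y1 lam) x (darbouxV1 X X1 Y Y1 lam x).
Proof.
have [dX dY dX1 dY1] := XY.
have z : cder (fun=> 0 : R[i]) x (0 : R[i]) by split; exact: derC.
have := combine (dm2psi x) (d2psi2 x) (derC 0 x) (dX1 x) (dX x) z (dY x).
rewrite (_ : (fun x => _) = darbouxV X X1 Y Y1 lam); last first.
  by apply/funext => y; rewrite /darbouxV mulr0 mulr0 addr0.
move=> /cder_eq; apply; rewrite /darbouxV1 /Um (wE x) /psi'.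
by move: (psi x) (r x) (gr x) (q x) => ps rr gg qq; rewrite !rmorph0; field.
Qed.

Lemma cderV1 x : cder (darbouxV1 X X1 Y Y1 lam) x
  ((w + am x)%:C%C * darbouxV X X1 Y Y1 lam x - lam * darbouxW X X1 Y Y1 lam x).
Proof.
have [dX dY dX1 dY1] := XY.
have d1 : der (fun x => 2 * psi x ^+ 2 - 2 * psi' x) x
    (2 * (2 * psi x * psi' x) - 2 * psi'' x).
  by apply: derB => //; exact: derZ.
have d2 : der (fun x => 2 * psi x * psi' x - 2 * psi x ^+ 3) x
    (2 * psi' x * psi' x + 2 * psi x * psi'' x
     - 2 * (psi' x * psi x ^+ 2 + psi x * (2 * psi x * psi' x))).
  by apply: derB; [exact: derM|exact: derZ].
apply: (cder_eq (combine d1 d2 (d2psi x) (dX1 x) (dX x) (dY x) (dY1 x))).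
rewrite /darbouxV /darbouxW /Um /Up /am (wE x) /psi'' /psi'.
by move: (psi x) (r x) (gr x) (g1r x) (q x) => ps rr gg gg1 qq; field.
Qed.

Lemma cderW x : cder (darbouxW X X1 Y Y1 lam) x (darbouxW1 X X1 Y Y1 lam x).
Proof.
have [dX dY dX1 dY1] := XY.
have z : cder (fun=> 0 : R[i]) x (0 : R[i]) by split; exact: derC.
have d1 : der (fun x => 2 * (psi x ^+ 2 + psi' x)) x
    (2 * (2 * psi x * psi' x + psi'' x)).
  by apply: derZ; apply: derD => //; exact: derX2.
have := combine (dm2psi x) d1 (derC 0 x) (dY1 x) (dY x) z (dX x).
rewrite (_ : (fun x => _) = darbouxW X X1 Y Y1 lam); last first.
  by apply/funext => y; rewrite /darbouxW mulr0 mulr0 addr0.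
move=> /cder_eq; apply; rewrite /darbouxW1 /Up (wE x) /psi'' /psi'.
by move: (psi x) (r x) (gr x) (g1r x) (q x) => ps rr gg gg1 qq; rewrite !rmorph0; field.
Qed.

Lemma cderW1 x : cder (darbouxW1 X X1 Y Y1 lam) x
  ((w + ap x)%:C%C * darbouxW X X1 Y Y1 lam x - lam * darbouxV X X1 Y Y1 lam x).
Proof.
have [dX dY dX1 dY1] := XY.
have d2 : der (fun x => - 2 * psi x * (psi x ^+ 2 + psi' x)) x
    (- 2 * psi' x * (psi x ^+ 2 + psi' x)
     + - 2 * psi x * (2 * psi x * psi' x + psi'' x)).
  by apply: derM => //; apply: derD => //; exact: derX2.
apply: (cder_eq (combine (d2psi2 x) d2 (d2psi x) (dY1 x) (dY x) (dX x) (dX1 x))).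
rewrite /darbouxV /darbouxW /Um /Up /ap (wE x) /psi'' /psi'.
by move: (psi x) (r x) (gr x) (g1r x) (q x) => ps rr gg gg1 qq; field.
Qed.

(** Injectivity of the transformation off lambda = 0: with Z = X' - psi X, the
    equations V = 0 and V' = 0 give lam Y and lam Y' in terms of Z, and W = 0
    then reads lam^2 X = 0. *)
Lemma darboux_injective : lam != 0 -> (forall x, darbouxV X X1 Y Y1 lam x = 0) ->
  (forall x, darbouxW X X1 Y Y1 lam x = 0) -> forall x, X x = 0 /\ Y x = 0.
Proof.
move=> lam0 V0 W0; have [dX dY dX1 dY1] := XY.
have cz x : cder (fun=> 0 : R[i]) x (0 : R[i]) by split; exact: derC.
have V10 x : darbouxV1 X X1 Y Y1 lam x = 0.
  apply: cder_unique (cderV x) _.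
  by rewrite (_ : darbouxV X X1 Y Y1 lam = fun=> 0) //; apply/funext => y; rewrite V0.
have X0 x : X x = 0.
  have h : lam * (lam * X x) = (- 2 * psi x)%:C%C * (- darbouxV1 X X1 Y Y1 lam x + (2 * psi x)%:C%C * - darbouxV X X1 Y Y1 lam x)
     + (2 * (psi x ^+ 2 + psi' x))%:C%C * (- darbouxV X X1 Y Y1 lam x) - lam * darbouxW X X1 Y Y1 lam x.
    rewrite /darbouxV /darbouxV1 /darbouxW; move: (psi x) (psi' x) => ps pp.
    by field.
  move: h; rewrite V10 V0 W0 !(oppr0, mulr0, addr0) => /eqP.
  by rewrite !mulf_eq0 (negbTE lam0) /= => /eqP.
have X10 x : X1 x = 0.
  apply: cder_unique (dX x) _.
  by rewrite (_ : X = fun=> 0) //; apply/funext => y; rewrite X0.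
move=> x; split; first exact: X0.
have := V0 x; rewrite /darbouxV X0 X10 !mulr0 add0r sub0r => /eqP.
by rewrite oppr_eq0 mulf_eq0 (negbTE lam0) => /eqP.
Qed.

End Derivatives.

Section Tails.
Variables (B : R).
Hypothesis psi_le : forall x, `|psi x| <= B.
Hypothesis r_lim : r x @[x --> +oo] --> (0 : R).
Hypothesis gr_lim : gr x @[x --> +oo] --> (0 : R).
Hypothesis rg1r_lim : (r x * g1r x) @[x --> +oo] --> (0 : R).
Hypothesis q_lim : q x @[x --> +oo] --> (0 : R).

Let lin_lim (a b c d : R) :
  (a * r x + b * gr x + c * q x + d * (r x * g1r x)) @[x --> +oo] --> (0 : R).
Proof.
rewrite [X in _ --> X](_ : 0 = a * 0 + b * 0 + c * 0 + d * 0); last by ring.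
by apply: cvgD; first apply: cvgD; first apply: cvgD; apply: cvgMr.
Qed.

Let psi'_lim : psi' x @[x --> +oo] --> (0 : R).
Proof.
rewrite (_ : psi' = fun x => - 2^-1 * r x + 1 * gr x + (-1) * q x + 0 * (r x * g1r x)).
  exact: lin_lim.
by apply/funext => x; rewrite /psi'; field.
Qed.

(** Adding the equations, u = X + Y solves u'' = k^2 u + o(1), whence k^2 u and
    then k u vanish; V + W and its derivative consist of k u and of vanishing
    terms. *)
Lemma outgoing_tail (X X1 Y Y1 : R -> R[i]) (lam k : R[i]) (K : R) :
  linearized X X1 Y Y1 lam -> k ^+ 2 = w%:C%C - lam ->
  bounded_by K X -> bounded_by K Y -> vanishes X1 -> vanishes Y1 ->
  vanishes (fun x => darbouxV1 X X1 Y Y1 lam x + darbouxW1 X X1 Y Y1 lam x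
    + k * (darbouxV X X1 Y Y1 lam x + darbouxW X X1 Y Y1 lam x)).
Proof.
move=> [dX dY dX1 dY1] k2 XK YK X10 Y10.
have K0 : 0 <= K := le_trans (normc_ge0 _) (XK 0).
have B0 : 0 <= B := le_trans (normr_ge0 _) (psi_le 0).
pose u x := X x + Y x.
have k2u0 : vanishes (fun x => k ^+ 2 * u x).
  pose E x := (Um x - w)%:C%C * X x + (Up x - w)%:C%C * Y x.
  apply: (@vanishes_driven _ u (fun x => X1 x + Y1 x) E).
  - by move=> x; exact: cderD.
  - move=> x; apply: (cder_eq (cderD (dX1 x) (dY1 x))).
    by rewrite /E /u k2; ring.
  - exact: vanishesD.
  - apply: vanishesD; [apply: (vanishesMr XK)|apply: (vanishesMr YK)];
      apply: vanishes_real.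
    + rewrite (_ : (fun x => _) = fun x => - 1 * r x + 1 * gr x + 0 * q x + 0 * (r x * g1r x)).
        exact: lin_lim.
      by apply/funext => x; rewrite /Um; ring.
    + rewrite (_ : (fun x => _) = fun x => - 3 * r x + 1 * gr x + 0 * q x + 2 * (r x * g1r x)).
        exact: lin_lim.
      by apply/funext => x; rewrite /Up; ring.
have ku0 : vanishes (fun x => k * u x).
  apply/vanishesP => e e0; have K1 : 0 < K + K + 1 by lra.
  have eK : 0 < e ^+ 2 / (K + K + 1) by rewrite divr_gt0 // exprn_gt0.
  have [M HM] := (vanishesP _).1 k2u0 _ eK; exists M => x /HM ux.
  rewrite -ler_sqr ?nnegrE ?normc_ge0 ?(ltW e0) //.
  have -> : normc (k * u x) ^+ 2 = normc (k ^+ 2 * u x) * normc (u x).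
    by rewrite !normcM expr2; ring.
  have uK : normc (u x) <= K + K + 1.
    by apply: le_trans (normc_add _ _) _; have := XK x; have := YK x; lra.
  apply: (@le_trans _ _ (e ^+ 2 / (K + K + 1) * (K + K + 1))).
    by apply: ler_pM; rewrite ?normc_ge0.
  by rewrite divfK ?gt_eqF.
have psiB : bounded_by B (fun x => (psi x)%:C%C) by move=> x; rewrite normc_real.
have vpsi' : vanishes (fun x => (psi' x)%:C%C) by exact: vanishes_real.
have vres : vanishes (fun x => (- r x / 2 + q x)%:C%C).
  apply: vanishes_real.
  rewrite (_ : (fun x => _) = fun x => - 2^-1 * r x + 0 * gr x + 1 * q x + 0 * (r x * g1r x)).
    exact: lin_lim.
  by apply/funext => x; field.
have vpsiM f : vanishes f -> vanishes (fun x => (psi x)%:C%C * f x).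
  exact: vanishesM.
have vX1Y1 : vanishes (fun x => X1 x + Y1 x) by exact: vanishesD.
have XmY : bounded_by (K + K) (fun x => X x - Y x).
  by move=> x; apply: le_trans (normc_sub _ _) (lerD (XK x) (YK x)).
have uK : bounded_by (K + K) u.
  by move=> x; apply: le_trans (normc_add _ _) (lerD (XK x) (YK x)).
apply: (@vanishes_eq _ (fun x =>
   (- 2 * k) * ((psi x)%:C%C * (X1 x + Y1 x))
   + 2 * ((psi x)%:C%C * ((psi x)%:C%C * (k * u x))) + (- lam) * (k * u x)
   + (2 * k) * ((psi' x)%:C%C * Y x)
   + 2 * ((psi x)%:C%C * ((psi x)%:C%C * (X1 x + Y1 x)))
   + (- lam) * (X1 x + Y1 x)
   + (-2) * ((psi' x)%:C%C * X1 x)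
   + (- 2 * k) * ((psi x)%:C%C * (k * u x))
   + (-2) * ((psi x)%:C%C * ((- r x / 2 + q x)%:C%C * u x))
   + 2 * ((psi x)%:C%C * ((psi' x)%:C%C * (X x - Y x))))).
  move=> x; rewrite /darbouxV1 /darbouxW1 /darbouxV /darbouxW /u /psi'.
  have -> : lam = w%:C%C - k ^+ 2 by rewrite k2; ring.
  have -> : w = psi x ^+ 2 + r x / 2 - q x by rewrite psi_sqr; ring.
  by move: (psi x) (r x) (gr x) (q x) => ps rr gg qq; field.
repeat (apply: vanishesD); apply: vanishesZ => //.
- exact: vpsiM.
- by do 2 apply: (vpsiM).
- exact: vanishesMr YK _.
- by do 2 apply: (vpsiM).
- exact: vanishes_mul.
- exact: vpsiM.
- by apply: (vpsiM); exact: vanishesMr uK _.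
- by apply: (vpsiM); exact: vanishesMr XmY _.
Qed.

End Tails.

End Darboux.

(** * Resonances at a fixed frequency *)

Section FixedFrequency.
Context {R : realType}.
Local Notation mu := (@lebesgue_measure R).

Variables (g : R -> R) (w : R) (phi : R -> R) (e : R).
Hypothesis gH1 : hypH1 g.
Hypothesis w_gt0 : 0 < w.
Hypothesis g_small : forall s, 0 < s <= 3 * w -> `|g s| <= 8^-1 * s.
Hypothesis phiS : is_soliton g w phi.
Hypothesis g2_le : forall s, 0 < s <= 3 * w -> `|s * derive1n 2 g s| <= e.

Let sw := Num.sqrt w.
Let r := rho phi.
Let ps := psi phi.
Let ps' := psi' g phi.
Let gr x := g (r x).
Let g1r x := derive1 g (r x).
Let q x := primitive0 g (r x) / r x.
Let ps'' x := ps x * (- r x + 2 * r x * g1r x - 2 * gr x + 2 * q x).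
Let Um x := w - r x + gr x.
Let Up x := w - 3 * r x + gr x + 2 * r x * g1r x.
Let ap x := - gr x + 2 * q x.
Let am x := - 5 * gr x + 6 * q x + 2 * r x * g1r x.

Let r_gt0 x : 0 < r x.
Proof. exact: rho_gt0 gH1 w_gt0 phiS x. Qed.

Let r_itv x : 0 < r x <= 3 * w.
Proof. exact: rho_itv gH1 w_gt0 g_small phiS x. Qed.

Let dr x : der r x (2 * ps x * r x).
Proof. exact: der_rho gH1 w_gt0 phiS x. Qed.

Let dps x : der ps x (ps' x).
Proof. exact: der_psi gH1 w_gt0 phiS x. Qed.

Let ps_sqr x : ps x ^+ 2 = w - r x / 2 + q x.
Proof. exact: psi_sqr gH1 w_gt0 phiS x. Qed.

Let dgr x : der gr x (g1r x * (2 * ps x * r x)).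
Proof. exact: der_comp (dr x) (hypH1_der gH1 (r_gt0 x)).1. Qed.

Let dg1r x : der g1r x (derive1n 2 g (r x) * (2 * ps x * r x)).
Proof. exact: der_comp (dr x) (hypH1_der gH1 (r_gt0 x)).2. Qed.

Let dq x : der q x (2 * ps x * (gr x - q x)).
Proof.
have r0 : r x != 0 by rewrite gt_eqF.
apply: (der_eq (derM (der_comp (dr x) (der_primitive0 gH1 (r_gt0 x))) (derV (dr x) r0))).
by rewrite /q /gr; field.
Qed.

Let dps' x : der ps' x (ps'' x).
Proof.
have := derB (derD (derZ (- 2^-1) (dr x)) (dgr x)) (dq x).
rewrite (_ : (fun y => _) = ps'); last by apply/funext => y; rewrite /ps' /psi' -/(r y) -/(q y) -/(gr y); field.
by move=> /der_eq; apply; rewrite /ps''; field.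
Qed.

Let cr : continuous r. Proof. by move=> x; exact: der_cont (dr x). Qed.
Let cgr : continuous gr. Proof. by move=> x; exact: der_cont (dgr x). Qed.
Let cg1r : continuous g1r. Proof. by move=> x; exact: der_cont (dg1r x). Qed.
Let cq : continuous q. Proof. by move=> x; exact: der_cont (dq x). Qed.

Let r_even x : r (- x) = r x. Proof. exact: (rho_even phiS). Qed.

Let r_lim : r x @[x --> +oo] --> (0 : R). Proof. exact: (rho_lim phiS). Qed.

Let gr_lim : gr x @[x --> +oo] --> (0 : R).
Proof. exact: (rho_comp_lim gH1 w_gt0 phiS (hypH1_g_lim gH1)). Qed.

Let rg1r_lim : (r x * g1r x) @[x --> +oo] --> (0 : R).
Proof.
rewrite -[X in _ --> X](mulr0 0); apply: cvgM r_lim _.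
exact: (rho_comp_lim gH1 w_gt0 phiS (hypH1_g1_lim gH1)).
Qed.

Let q_le x : `|q x| <= r x / 16.
Proof. exact: (G_quot_le gH1 w_gt0 g_small phiS). Qed.

Let q_lim : q x @[x --> +oo] --> (0 : R).
Proof.
apply: near_cvgy => t /(cvgy_near r_lim) [M HM]; exists M => x /HM.
rewrite !subr0 gtr0_norm // => h; apply: le_trans (q_le x) _.
by have := r_gt0 x; lra.
Qed.

Let ps_le x : `|ps x| <= sw.
Proof.
rewrite -ler_sqr ?nnegrE ?sqrtr_ge0 // real_normK ?num_real // sqr_sqrtr ?ltW //.
by rewrite ps_sqr; have := q_le x; have := r_gt0 x; rewrite ler_norml; lra.
Qed.

Let r_le x : r x <= - 4 * ps' x.
Proof. exact: (rho_le_psi' gH1 w_gt0 g_small phiS). Qed.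

Let ps_odd x : ps (- x) = - ps x. Proof. exact: (psi_odd phiS). Qed.

Let e_ge0 : 0 <= e.
Proof. by apply: le_trans (g2_le (r_itv 0)). Qed.

Let ap_le x : `|ap x| <= e / 2 * r x.
Proof. exact: (aplus_le gH1 g2_le (r_itv x)). Qed.

Let am_le x : `|am x| <= 3 / 2 * e * r x.
Proof. exact: (aminus_le gH1 g2_le (r_itv x)). Qed.

Hypothesis e_small : e <= 64^-1.

Let Um_le x : `|Um x| <= 19 * w.
Proof.
have := g_small (r_itv x); have /andP[] := r_itv x; have := w_gt0.
by rewrite /Um /gr !ler_norml; lra.
Qed.

Let Up_le x : `|Up x| <= 19 * w.
Proof.
have -> : Up x = w - 3 * r x + 6 * gr x + am x - 6 * q x by rewrite /Up /am; ring.
have := g_small (r_itv x); have /andP[r0 r3] := r_itv x; have := w_gt0.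
have := am_le x; have := q_le x; have := ler_wpM2r (ltW r0) e_small.
by rewrite /gr !ler_norml; lra.
Qed.

Let cUm : continuous Um.
Proof.
move=> x; apply: cvgD; last exact: cgr.
by apply: cvgB; [exact: cvg_cst|exact: cr].
Qed.

Let cUp : continuous Up.
Proof.
move=> x; apply: cvgD.
  apply: cvgD; last exact: cgr.
  by apply: cvgB; [exact: cvg_cst|apply: cvgMr; exact: cr].
by apply: cvgM; [apply: cvgMr; exact: cr|exact: cg1r].
Qed.

Let lin := linearized w r gr g1r.

(** Together with the linearized system, this property of classical resonances is
    stable under x -> - x and under (X, Y, lambda) -> (X, - Y, - lambda). *)
Definition tame (X X1 Y Y1 : R -> R[i]) : Prop :=
  exists K, [/\ bounded_by K X, bounded_by K Y, bounded_by K X1, bounded_by K Y1 &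
    [/\ vanishes X1, vanishes (fun x => - X1 (- x)), vanishes Y1 &
        vanishes (fun x => - Y1 (- x))]].

(** The weak derivatives become classical, with limits 0 at both ends: the first
    derivative is square-integrable and Lipschitz. *)
Let component_regular (u u1 u2 : R -> R) : u \in Lfun mu +oo%E ->
  weak_derivative u u1 -> weak_derivative u1 u2 -> sobolevH1 u1 ->
  exists P P1 : R -> R, [/\ {ae mu, forall x, u x = P x}, continuous P,
    (forall x, der P x (P1 x)), (exists K, forall x, `|P x| <= K) &
    forall (h : R -> R) (L : R), continuous h -> (forall x, `|h x| <= L) ->
      {ae mu, forall x, u2 x = h x} ->
      [/\ (forall x, der P1 x (h x)), P1 x @[x --> +oo] --> (0 : R) &
          - P1 (- x) @[x --> +oo] --> (0 : R)]].
Proof.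
move=> uinf uu1 u1u2 [u1L2 _].
have [P [P1 [uP u1P1 cP cP1 [dP dP1]]]] := weak_derivative2_regular uu1 u1u2.
exists P, P1; split => //; first exact: Linfty_bounded uP.
move=> h L ch hL u2h; have {}dP1 := dP1 h ch u2h.
have [Q [C [dQ QC]]] := L2_sqr_primitive u1L2 cP1 u1P1.
split=> //; first exact: sqr_integrable_lipschitz_lim dP1 hL dQ QC.
apply: (@sqr_integrable_lipschitz_lim _ _ (fun x => h (- x)) (fun x => - Q (- x)) L C).
- by move=> x; rewrite -[h _]opprK; apply: derN; exact: der_flip.
- by move=> x.
- by move=> x; rewrite sqrrN -[_ ^+ 2]opprK; apply: derN; exact: der_flip.
- by move=> x; rewrite normrN.
Qed.

Lemma resonance_classical (X Y : R -> R[i]) (lam : R[i]) :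
  is_resonance g w phi X Y lam ->
  exists x0 x1 y0 y1 : R -> R[i], [/\ {ae mu, forall x, X x = x0 x},
    {ae mu, forall x, Y x = y0 x}, lin x0 x1 y0 y1 lam & tame x0 x1 y0 y1].
Proof.
move=> [[Xr Xi] [[Yr Yi] [X1 [X2 [Y1 [Y2 [[[wX wX'] [wX1 wX1']]
  [[wY wY'] [wY1 wY1']] [[sX sX'] [sY sY']] eqX eqY]]]]]]].
have [P [P1 [uP cP dP [KP bP] HP]]] := component_regular Xr wX wX1 sX.
have [P' [P1' [uP' cP' dP' [KP' bP'] HP']]] := component_regular Xi wX' wX1' sX'.
have [Q [Q1 [uQ cQ dQ [KQ bQ] HQ]]] := component_regular Yr wY wY1 sY.
have [Q' [Q1' [uQ' cQ' dQ' [KQ' bQ'] HQ']]] := component_regular Yi wY' wY1' sY'.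
pose x0 x := Complex (P x) (P' x); pose y0 x := Complex (Q x) (Q' x).
pose x1 x := Complex (P1 x) (P1' x); pose y1 x := Complex (Q1 x) (Q1' x).
have Xx0 : {ae mu, forall x, X x = x0 x}.
  by apply: ae_imp (ae_and uP uP') => x [h1 h2]; apply: complex_eq.
have Yy0 : {ae mu, forall x, Y x = y0 x}.
  by apply: ae_imp (ae_and uQ uQ') => x [h1 h2]; apply: complex_eq.
pose a := complex.Re lam; pose b := complex.Im lam.
pose K := KP + KP' + KQ + KQ'.
have [KP0 KP'0 KQ0 KQ'0] : [/\ 0 <= KP, 0 <= KP', 0 <= KQ & 0 <= KQ'].
  by split; [apply: le_trans (bP 0)|apply: le_trans (bP' 0)|apply: le_trans (bQ 0)|
    apply: le_trans (bQ' 0)].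
have source (U A B C : R -> R) (c d : R) : continuous U ->
    (forall x, `|U x| <= 19 * w) -> continuous A -> continuous B -> continuous C ->
    (forall x, `|A x| <= K) -> (forall x, `|B x| <= K) -> (forall x, `|C x| <= K) ->
    continuous (fun x => U x * A x - (c * B x + d * C x)) /\
    forall x, `|U x * A x - (c * B x + d * C x)| <= 19 * w * K + (`|c| * K + `|d| * K).
  move=> cU Uw cA cB cC AK BK CK; split=> x.
    apply: cvgB; first by apply: cvgM; [exact: cU|exact: cA].
    by apply: cvgD; apply: cvgMr; [exact: cB|exact: cC].
  apply: le_trans (ler_normB _ _) _; apply: lerD.
    by rewrite normrM; apply: ler_pM.
  by apply: le_trans (ler_normD _ _) _; rewrite !normrM lerD // ler_wpM2l.
have PK x : `|P x| <= K by have := bP x; rewrite /K; lra.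
have PK' x : `|P' x| <= K by have := bP' x; rewrite /K; lra.
have QK x : `|Q x| <= K by have := bQ x; rewrite /K; lra.
have QK' x : `|Q' x| <= K by have := bQ' x; rewrite /K; lra.
have [c1 b1] := source Um P Q Q' a (- b) cUm Um_le cP cQ cQ' PK QK QK'.
have [c2 b2] := source Um P' Q' Q a b cUm Um_le cP' cQ' cQ PK' QK' QK.
have [c3 b3] := source Up Q P P' a (- b) cUp Up_le cQ cP cP' QK PK PK'.
have [c4 b4] := source Up Q' P' P a b cUp Up_le cQ' cP' cP QK' PK' PK.
have eqX' x : X x = x0 x /\ Y x = y0 x -> Lminus g w phi X X2 x = lam * Y x ->
    X2 x = (Um x)%:C%C * x0 x - lam * y0 x.
  move=> [<- <-] <-; rewrite /Lminus /schrodinger -/(Um x).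
  by rewrite opprD opprK addrCA subrr addr0.
have eqY' x : X x = x0 x /\ Y x = y0 x -> Lplus g w phi Y Y2 x = lam * X x ->
    Y2 x = (Up x)%:C%C * y0 x - lam * x0 x.
  move=> [<- <-] <-; rewrite /Lplus /schrodinger -/(Up x).
  by rewrite opprD opprK addrCA subrr addr0.
have {}eqX : {ae mu, forall x, X2 x = (Um x)%:C%C * x0 x - lam * y0 x}.
  by apply: ae_imp (ae_and (ae_and Xx0 Yy0) eqX) => x [h1 h2]; exact: eqX'.
have {}eqY : {ae mu, forall x, Y2 x = (Up x)%:C%C * y0 x - lam * x0 x}.
  by apply: ae_imp (ae_and (ae_and Xx0 Yy0) eqY) => x [h1 h2]; exact: eqY'.
have [|dP1 lP lP'] := HP _ _ c1 b1.
  by apply: ae_imp eqX => x ->; rewrite !ReIm /= /a /b; ring.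
have [|dP1' lP1 lP1'] := HP' _ _ c2 b2.
  by apply: ae_imp eqX => x ->; rewrite !ReIm /= /a /b; ring.
have [|dQ1 lQ lQ'] := HQ _ _ c3 b3.
  by apply: ae_imp eqY => x ->; rewrite !ReIm /= /a /b; ring.
have [|dQ1' lQ1 lQ1'] := HQ' _ _ c4 b4.
  by apply: ae_imp eqY => x ->; rewrite !ReIm /= /a /b; ring.
exists x0, x1, y0, y1.
have dx0 x : cder x0 x (x1 x) by split => /=; [exact: dP|exact: dP'].
have dy0 x : cder y0 x (y1 x) by split => /=; [exact: dQ|exact: dQ'].
have dx1 x : cder x1 x ((Um x)%:C%C * x0 x - lam * y0 x).
  split; rewrite !ReIm /=.
    by apply: (der_eq (dP1 x)); rewrite /a /b; ring.
  by apply: (der_eq (dP1' x)); rewrite /a /b; ring.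
have dy1 x : cder y1 x ((Up x)%:C%C * y0 x - lam * x0 x).
  split; rewrite !ReIm /=.
    by apply: (der_eq (dQ1 x)); rewrite /a /b; ring.
  by apply: (der_eq (dQ1' x)); rewrite /a /b; ring.
split => //.
have vC (A B : R -> R) : A x @[x --> +oo] --> (0 : R) -> B x @[x --> +oo] --> (0 : R) ->
    vanishes (fun x => Complex (A x) (B x)).
  move=> A0 B0; apply: (@vanishes_eq _ (fun x => (A x)%:C%C + 'i%C * (B x)%:C%C)).
    by move=> x; apply: complex_eq; rewrite !ReIm /=; ring.
  by apply: vanishesD; [|apply: vanishesZ]; exact: vanishes_real.
have xK : bounded_by (K + K) x0.
  by move=> x; apply: le_trans (normc_le_ReIm _) _; rewrite /= lerD.
have yK : bounded_by (K + K) y0.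
  by move=> x; apply: le_trans (normc_le_ReIm _) _; rewrite /= lerD.
pose L := 19 * w * (K + K) + normc lam * (K + K).
have K0 : 0 <= K + K by rewrite /K; lra.
have L0 : 0 <= L by rewrite addr_ge0 // !mulr_ge0 ?normc_ge0 // ltW.
have srcL (U : R -> R) (f h : R -> R[i]) : (forall x, `|U x| <= 19 * w) ->
    bounded_by (K + K) f -> bounded_by (K + K) h ->
    bounded_by L (fun x => (U x)%:C%C * f x - lam * h x).
  move=> Uw fK hK x; apply: le_trans (normc_sub _ _) _; rewrite !normcM normc_real.
  by rewrite lerD // ?ler_wpM2l ?normc_ge0 // ler_pM // normc_ge0.
have x1K := landau_bound dx0 dx1 xK (srcL _ _ _ Um_le xK yK).
have y1K := landau_bound dy0 dy1 yK (srcL _ _ _ Up_le yK xK).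
exists ((K + K) + (K + K) + L).
have KL x : x <= K + K -> x <= (K + K) + (K + K) + L by lra.
split.
- by move=> x; apply: KL; exact: xK.
- by move=> x; apply: KL; exact: yK.
- exact: x1K.
- exact: y1K.
- split.
  + exact: vC.
  + by apply: vanishes_eq (vC _ _ lP' lP1') => x; apply: complex_eq; rewrite !ReIm.
  + exact: vC.
  + by apply: vanishes_eq (vC _ _ lQ' lQ1') => x; apply: complex_eq; rewrite !ReIm.
Qed.

Let flip1 (A : R -> R[i]) (x : R) := A (- x).
Let flipN (A : R -> R[i]) (x : R) := - A (- x).

Let ps'_even x : ps' (- x) = ps' x.
Proof. by rewrite /ps' /psi' -/(r (- x)) r_even. Qed.

Let linearized_flip X X1 Y Y1 lam : lin X X1 Y Y1 lam ->
  lin (flip1 X) (flipN X1) (flip1 Y) (flipN Y1) lam.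
Proof.
move=> [dX dY dX1 dY1]; split=> x.
- exact: cder_flip.
- exact: cder_flip.
- have := cderN (cder_flip (dX1 (- x))); rewrite opprK.
  by rewrite /gr r_even.
- have := cderN (cder_flip (dY1 (- x))); rewrite opprK.
  by rewrite /gr /g1r r_even.
Qed.

Let linearized_neg X X1 Y Y1 lam : lin X X1 Y Y1 lam ->
  lin X X1 (fun x => - Y x) (fun x => - Y1 x) (- lam).
Proof.
move=> [dX dY dX1 dY1]; split=> x //.
- exact: cderN.
- by rewrite mulrNN; exact: dX1.
- by apply: (cder_eq (cderN (dY1 x))); ring.
Qed.

Let tame_flip X X1 Y Y1 : tame X X1 Y Y1 ->
  tame (flip1 X) (flipN X1) (flip1 Y) (flipN Y1).
Proof.
move=> [K [h1 h2 h3 h4 [h5 h6 h7 h8]]]; exists K; split.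
- by move=> x; exact: h1.
- by move=> x; exact: h2.
- by move=> x; rewrite normc_opp; exact: h3.
- by move=> x; rewrite normc_opp; exact: h4.
- split=> //; [apply: vanishes_eq h5|apply: vanishes_eq h7] => x;
    by rewrite /flipN !opprK.
Qed.

Let tame_neg X X1 Y Y1 : tame X X1 Y Y1 ->
  tame X X1 (fun x => - Y x) (fun x => - Y1 x).
Proof.
move=> [K [h1 h2 h3 h4 [h5 h6 h7 h8]]]; exists K; split => //.
- by move=> x; rewrite normc_opp; exact: h2.
- by move=> x; rewrite normc_opp; exact: h4.
- by split => //; exact: vanishesN.
Qed.

Let DV := darbouxV ps. Let DV1 := darbouxV1 ps r gr q.
Let DW := darbouxW ps r gr q. Let DW1 := darbouxW1 ps r gr q.

(** V + W decouples at infinity with k^2 = omega - lambda. The change from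
    (Y, lambda) to (- Y, - lambda) exchanges it with V - W, and x -> - x
    exchanges the two ends. *)
Let tail_sum X X1 Y Y1 lam k : lin X X1 Y Y1 lam -> tame X X1 Y Y1 ->
  k ^+ 2 = w%:C%C - lam ->
  vanishes (fun x => DV1 X X1 Y Y1 lam x + DW1 X X1 Y Y1 lam x
    + k * (DV X X1 Y Y1 lam x + DW X X1 Y Y1 lam x)).
Proof.
move=> lXY [K [h1 h2 _ _ [h5 _ h7 _]]] k2.
exact: (outgoing_tail ps_sqr ps_le r_lim gr_lim rg1r_lim q_lim lXY k2 h1 h2 h5 h7).
Qed.

Let tail_sum_flip X X1 Y Y1 lam k : lin X X1 Y Y1 lam -> tame X X1 Y Y1 ->
  k ^+ 2 = w%:C%C - lam ->
  vanishes (fun x => - (DV1 X X1 Y Y1 lam (- x) + DW1 X X1 Y Y1 lam (- x))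
    + k * (DV X X1 Y Y1 lam (- x) + DW X X1 Y Y1 lam (- x))).
Proof.
move=> lXY tXY k2.
apply: vanishes_eq (tail_sum (linearized_flip lXY) (tame_flip tXY) k2) => x.
rewrite /DV1 /DW1 /DV /DW /darbouxV1 /darbouxW1 /darbouxV /darbouxW /flip1 /flipN ps_odd /gr /q r_even.
by move: (ps x) (g (r x)) (_ / r x) => pp gg qq; ring.
Qed.

Let tail_diff X X1 Y Y1 lam k : lin X X1 Y Y1 lam -> tame X X1 Y Y1 ->
  k ^+ 2 = w%:C%C + lam ->
  vanishes (fun x => DV1 X X1 Y Y1 lam x - DW1 X X1 Y Y1 lam x
    + k * (DV X X1 Y Y1 lam x - DW X X1 Y Y1 lam x)).
Proof.
move=> lXY tXY k2; rewrite -[lam]opprK in k2.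
apply: vanishes_eq (tail_sum (linearized_neg lXY) (tame_neg tXY) k2) => x.
by rewrite /DV1 /DW1 /DV /DW /darbouxV1 /darbouxW1 /darbouxV /darbouxW; ring.
Qed.

Let tail_diff_flip X X1 Y Y1 lam k : lin X X1 Y Y1 lam -> tame X X1 Y Y1 ->
  k ^+ 2 = w%:C%C + lam ->
  vanishes (fun x => - (DV1 X X1 Y Y1 lam (- x) - DW1 X X1 Y Y1 lam (- x))
    + k * (DV X X1 Y Y1 lam (- x) - DW X X1 Y Y1 lam (- x))).
Proof.
move=> lXY tXY k2; rewrite -[lam]opprK in k2.
apply: vanishes_eq (tail_sum_flip (linearized_neg lXY) (tame_neg tXY) k2) => x.
by rewrite /DV1 /DW1 /DV /DW /darbouxV1 /darbouxW1 /darbouxV /darbouxW; ring.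
Qed.

Let DV_bounded X X1 Y Y1 lam : tame X X1 Y Y1 ->
  exists K, forall x, normc (DV X X1 Y Y1 lam x) + normc (DW X X1 Y Y1 lam x) <= K.
Proof.
move=> [K [h1 h2 h3 h4 _]].
have K0 : 0 <= K := le_trans (normc_ge0 _) (h1 0).
have sw0 : 0 <= sw by exact: sqrtr_ge0.
have p2 x : `|ps x ^+ 2| <= sw ^+ 2.
  by rewrite normrX ler_sqr ?nnegrE ?ps_le.
have U x : `|ps x ^+ 2 + ps' x| <= 19 * w.
  have -> : ps x ^+ 2 + ps' x = Um x.
    by rewrite ps_sqr /ps' /psi' /Um -/(r x) -/(q x) -/(gr x); field.
  exact: Um_le.
have b (a c : R) (A B C : R[i]) (a0 c0 : R) : `|a| <= a0 -> `|c| <= c0 ->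
    normc A <= K -> normc B <= K -> normc C <= K ->
    normc ((- 2 * a)%:C%C * A + (2 * c)%:C%C * B - lam * C) <=
    2 * a0 * K + 2 * c0 * K + normc lam * K.
  move=> aa cc hA hB hC; apply: le_trans (normc_sub _ _) _; rewrite normcM.
  apply: lerD; last by rewrite ler_wpM2l ?normc_ge0.
  have a2 : `|- 2 * a| <= 2 * a0 by move: aa; rewrite !ler_norml; lra.
  have c2 : `|2 * c| <= 2 * c0 by move: cc; rewrite !ler_norml; lra.
  apply: le_trans (normc_add _ _) _; rewrite !normcM !normc_real.
  by apply: lerD; apply: ler_pM; rewrite ?normr_ge0 ?normc_ge0.
exists ((2 * sw * K + 2 * sw ^+ 2 * K + normc lam * K)
  + (2 * sw * K + 2 * (19 * w) * K + normc lam * K)) => x.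
by apply: lerD; apply: b.
Qed.

Hypothesis repulsive : 640 * e ^+ 2 * sw <
  \int[mu]_x (- 3 * g (phi x ^+ 2) + phi x ^+ 2 * derive1 g (phi x ^+ 2)
    + 4 * (primitive0 g (phi x ^+ 2) / phi x ^+ 2)).

Let sV x := (ap x + am x) / 2.
Let dV x := (am x - ap x) / 2.

Let sV_le x : `|sV x| <= e * r x.
Proof. by have := ap_le x; have := am_le x; rewrite /sV !ler_norml; lra. Qed.

Let dV_le x : `|dV x| <= e * r x.
Proof. by have := ap_le x; have := am_le x; rewrite /dV !ler_norml; lra. Qed.

Let even_r (f : R -> R) : even_fun (fun x => f (r x)).
Proof. by move=> x; rewrite r_even. Qed.

Let csV : continuous sV.
Proof.
move=> x; apply: cvgMl; apply: cvgD.
  by apply: cvgD; [apply: cvgN; exact: cgr|apply: cvgMr; exact: cq].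
apply: cvgD; last first.
  by apply: cvgM; [apply: cvgMr; exact: cr|exact: cg1r].
by apply: cvgD; apply: cvgMr; [exact: cgr|exact: cq].
Qed.

(** S is half of the integral over the line since the potential is even. *)
Let averaged_potential : exists (Sig : R -> R) (S : R),
  [/\ forall x, der Sig x (sV x), Sig 0 = 0, Sig x @[x --> +oo] --> S &
      320 * e ^+ 2 * sw < S].
Proof.
have ce : continuous (fun x => - 4 * e * ps' x).
  by move=> x; apply: cvgMr; exact: der_cont (dps' x).
have e_even x : - 4 * e * ps' (- x) = - 4 * e * ps' x by rewrite ps'_even.
have sV_dom x : `|sV x| <= - 4 * e * ps' x.
  by apply: le_trans (sV_le x) _; have := ler_wpM2l e_ge0 (r_le x); lra.
have dE x : der (fun x => - 4 * e * ps x) x (- 4 * e * ps' x) by exact: derZ.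
have E0 : - 4 * e * ps 0 = 0.
  have ps0 : ps 0 = 0 by have := ps_odd 0; rewrite oppr0; lra.
  by rewrite ps0 mulr0.
have El : (- 4 * e * ps x) @[x --> +oo] --> - 4 * e * - sw.
  by apply: cvgMr; exact: (psi_lim gH1 w_gt0 g_small phiS).
have [Sig [S [h1 h2 h3 h4]]] := even_dominated_integral csV ce
  (even_r (fun s => (aplus g s + aminus g s) / 2)) e_even sV_dom dE E0 El.
exists Sig, S; split => //.
suff : 640 * e ^+ 2 * sw < 2 * S by lra.
rewrite -h4; apply: lt_le_trans repulsive _.
rewrite le_eqVlt; apply/orP; left; apply/eqP; apply: eq_Rintegral => x _.
by rewrite -[phi x ^+ 2]/(r x) -/(gr x) -/(g1r x) -/(q x) /sV /ap /am; field.
Qed.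

Let complex_sqrt (z : R[i]) : exists2 k, k ^+ 2 = z & 0 <= complex.Re k.
Proof.
have [k0|k0] := leP 0 (complex.Re (sqrtc z)).
  by exists (sqrtc z) => //; rewrite sqr_sqrtc.
exists (- sqrtc z); first by rewrite sqrrN sqr_sqrtc.
by rewrite Re_opp oppr_ge0 ltW.
Qed.

Let resonance_trivial_halfplane X X1 Y Y1 lam : lin X X1 Y Y1 lam ->
  tame X X1 Y Y1 -> lam != 0 -> 0 <= complex.Re lam ->
  forall x, X x = 0 /\ Y x = 0.
Proof.
move=> lXY tXY lam0 relam.
have [k k2 k0] := complex_sqrt (w%:C%C - lam).
have [m m2 m0] := complex_sqrt (w%:C%C + lam).
have mw : sw <= normc m.
  rewrite -ler_sqr ?nnegrE ?normc_ge0 ?sqrtr_ge0 // sqr_sqrtr ?(ltW w_gt0) //.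
  have -> : normc m ^+ 2 = normc (m ^+ 2) by rewrite !expr2 normcM.
  rewrite m2; apply: le_trans (Re_le_normc _); rewrite Re_add /=.
  by apply: le_trans (ler_norm _); rewrite lerDl.
have [Sig [S [dSig Sig0 SigS S_large]]] := averaged_potential.
have [K bK] := DV_bounded lam tXY.
have dVV x : cder (DV X X1 Y Y1 lam) x (DV1 X X1 Y Y1 lam x).
  exact: (cderV ps_sqr dps lXY).
have dWW x : cder (DW X X1 Y Y1 lam) x (DW1 X X1 Y Y1 lam x).
  exact: (cderW ps_sqr dps dps' lXY).
have dV1 x : cder (DV1 X X1 Y Y1 lam) x
    ((w + am x)%:C%C * DV X X1 Y Y1 lam x - lam * DW X X1 Y Y1 lam x).
  exact: (cderV1 ps_sqr dps dps' lXY x).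
have dW1 x : cder (DW1 X X1 Y Y1 lam) x
    ((w + ap x)%:C%C * DW X X1 Y Y1 lam x - lam * DV X X1 Y Y1 lam x).
  exact: (cderW1 ps_sqr dps dps' lXY x).
pose p x := DV X X1 Y Y1 lam x + DW X X1 Y Y1 lam x.
pose p1 x := DV1 X X1 Y Y1 lam x + DW1 X X1 Y Y1 lam x.
pose q' x := DV X X1 Y Y1 lam x - DW X X1 Y Y1 lam x.
pose q1 x := DV1 X X1 Y Y1 lam x - DW1 X X1 Y Y1 lam x.
have pq0 : forall x, p x = 0 /\ q' x = 0.
  apply: (coupled_trivial (p1 := p1) (q1 := q1) (K := K + K) w_gt0 dps ps_odd
    (psi_lim gH1 w_gt0 g_small phiS) (fun x => ltW (r_gt0 x)) r_le
    (psi_tail gH1 w_gt0 g_small phiS) e_ge0 sV_le dV_le dSig Sig0 SigS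
    (even_r (fun s => (aplus g s + aminus g s) / 2))
    (even_r (fun s => (aminus g s - aplus g s) / 2)) e_small S_large k0 m0 mw).
  - by move=> x; apply: cderD.
  - by move=> x; apply: cderB.
  - move=> x; apply: (cder_eq (cderD (dV1 x) (dW1 x))).
    rewrite k2 /p /q' /sV /dV.
    by move: (ap x) (am x) (DV _ _ _ _ _ x) (DW _ _ _ _ _ x) => a b A B; field.
  - move=> x; apply: (cder_eq (cderB (dV1 x) (dW1 x))).
    rewrite m2 /p /q' /sV /dV.
    by move: (ap x) (am x) (DV _ _ _ _ _ x) (DW _ _ _ _ _ x) => a b A B; field.
  - exact: tail_sum.
  - exact: tail_sum_flip.
  - exact: tail_diff.
  - exact: tail_diff_flip.
  - move=> x; apply: lerD; apply: le_trans (bK x); first exact: normc_add.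
    exact: normc_sub.
apply: (darboux_injective ps_sqr dps lXY lam0) => x; have [h1 h2] := pq0 x.
  have : (2 : R[i]) * DV X X1 Y Y1 lam x = p x + q' x by rewrite /p /q'; ring.
  by rewrite h1 h2 addr0 => /eqP; rewrite mulf_eq0 pnatr_eq0 => /eqP.
have : (2 : R[i]) * DW X X1 Y Y1 lam x = p x - q' x by rewrite /p /q'; ring.
by rewrite h1 h2 subr0 => /eqP; rewrite mulf_eq0 pnatr_eq0 => /eqP.
Qed.

Lemma resonance_trivial X X1 Y Y1 lam : lin X X1 Y Y1 lam ->
  tame X X1 Y Y1 -> lam != 0 -> forall x, X x = 0 /\ Y x = 0.
Proof.
move=> lXY tXY lam0 x; have [h|/ltW h] := leP 0 (complex.Re lam).
  exact: (resonance_trivial_halfplane lXY tXY lam0 h).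
have [||h1 h2] := resonance_trivial_halfplane (linearized_neg lXY) (tame_neg tXY) _ _ x.
- by rewrite oppr_eq0.
- by rewrite Re_opp oppr_ge0.
- by split => //; apply/eqP; rewrite -oppr_eq0 h2.
Qed.

Let phi1 x := ps x * phi x.

Let dphi x : der phi x (phi1 x).
Proof. exact: der_phi gH1 w_gt0 phiS x. Qed.

Let dphi1 x : der phi1 x (Um x * phi x).
Proof.
apply: (der_eq (derM (dps x) (dphi x))); rewrite /phi1.
have -> : Um x = ps x ^+ 2 + ps' x.
  by rewrite ps_sqr /ps' /psi' /Um -/(r x) -/(q x) -/(gr x); field.
by ring.
Qed.

Let dphi2 x : der (fun x => Um x * phi x) x (Up x * phi1 x).
Proof.
have dUm : der Um x (0 - 2 * ps x * r x + g1r x * (2 * ps x * r x)).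
  exact: derD (derB (derC w x) (dr x)) (dgr x).
by apply: (der_eq (derM dUm (dphi x))); rewrite /Um /Up /phi1; ring.
Qed.

Let bounded_mul_lim (f h : R -> R) (K : R) : (forall x, `|f x| <= K) ->
  h x @[x --> +oo] --> (0 : R) -> (f x * h x) @[x --> +oo] --> (0 : R).
Proof.
move=> fK h0; have K0 : 0 <= K := le_trans (normr_ge0 _) (fK 0).
apply: near_cvgy => t t0; have K1 : 0 < K + 1 by rewrite ltr_wpDl.
have tK : 0 < t / (K + 1) by rewrite divr_gt0.
have [M HM] := cvgy_near h0 tK; exists M => x /HM; rewrite !subr0 normrM => hx.
apply: (@le_trans _ _ ((K + 1) * (t / (K + 1)))).
  by apply: ler_pM; rewrite ?normr_ge0 // (le_trans (fK x)) // lerDl.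
by rewrite mulrCA divff ?mulr1 // gt_eqF.
Qed.

Let phi0 : phi x @[x --> +oo] --> (0 : R).
Proof. exact: (phi_lim phiS). Qed.

Let phi10 : phi1 x @[x --> +oo] --> (0 : R).
Proof. exact: bounded_mul_lim ps_le phi0. Qed.

(** The vanishing Wronskian makes X / phi constant. *)
Lemma kernel_Lminus X X1 Y Y1 : lin X X1 Y Y1 0 -> tame X X1 Y Y1 ->
  exists c, forall x, X x = c * (phi x)%:C%C.
Proof.
move=> [dX _ dX1 _] [K [XK _ _ _ [X10 _ _ _]]].
have {}dX1 x : cder X1 x ((Um x)%:C%C * X x).
  by apply: (cder_eq (dX1 x)); rewrite mul0r subr0.
have wr := wronskian_zero dphi dphi1 dX dX1 phi0 phi10 XK X10.
have p0 x : phi x != 0 by rewrite gt_eqF // (soliton_gt0 gH1 w_gt0 phiS).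
have pC0 x : (phi x)%:C%C != 0 :> R[i] by rewrite fmorph_eq0.
have dquot x : cder (fun x => X x * ((phi x)^-1)%:C%C) x 0.
  apply: (cder_eq (cderM (dX x) (cder_real (derV (dphi x) (p0 x))))).
  have := wr x; rewrite fmorphV /= fmorph_div /= rmorphXn rmorphN /= => h.
  have -> : X1 x = X x * (phi1 x)%:C%C / (phi x)%:C%C by rewrite -h mulfK.
  by field; rewrite ?pC0 ?p0.
exists (X 0 * ((phi 0)^-1)%:C%C) => x.
by rewrite -(cder_0_cst dquot x 0) fmorphV /= divfK.
Qed.

(** As phi'(0) = 0 and phi''(0) is nonzero, the vanishing Wronskian gives Y(0) = 0;
    a suitable Y - c phi' then has zero Cauchy data at 0. *)
Lemma kernel_Lplus X X1 Y Y1 : lin X X1 Y Y1 0 -> tame X X1 Y Y1 ->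
  exists c, forall x, Y x = c * (derive1 phi x)%:C%C.
Proof.
move=> [_ dY _ dY1] [K [_ YK _ _ [_ _ Y10 _]]].
have {}dY1 x : cder Y1 x ((Up x)%:C%C * Y x).
  by apply: (cder_eq (dY1 x)); rewrite mul0r subr0.
have phi20 := bounded_mul_lim Um_le phi0.
have wr := wronskian_zero dphi1 dphi2 dY dY1 phi10 phi20 YK Y10.
have ps0 : ps 0 = 0 by have := ps_odd 0; rewrite oppr0; lra.
have phi2N0 : Um 0 * phi 0 != 0.
  have -> : Um 0 = ps' 0.
    have := ps_sqr 0; rewrite ps0 /ps' /psi' /Um -/(r 0) -/(q 0) -/(gr 0).
    by rewrite expr0n /=; lra.
  apply: mulf_neq0; last by rewrite gt_eqF // (soliton_gt0 gH1 w_gt0 phiS).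
  by rewrite lt_eqF //; have := r_le 0; have := r_gt0 0; lra.
have phi2C0 : (Um 0 * phi 0)%:C%C != 0 :> R[i] by rewrite fmorph_eq0.
have Y0 : Y 0 = 0.
  have /esym/eqP := wr 0; rewrite /phi1 ps0 mul0r rmorph0 mulr0.
  by rewrite mulf_eq0 (negbTE phi2C0) orbF => /eqP.
pose d := Y1 0 / (Um 0 * phi 0)%:C%C; exists d => x.
pose z x := Y x - d * (phi1 x)%:C%C.
pose z1 x := Y1 x - d * (Um x * phi x)%:C%C.
have dz y : cder z y (z1 y) by apply: cderB => //; apply: cderZ; exact: cder_real.
have dz1 y : cder z1 y ((Up y)%:C%C * z y).
  apply: (cder_eq (cderB (dY1 y) (cderZ d (cder_real (dphi2 y))))).
  by rewrite /z rmorphM /=; ring.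
have z00 : z 0 = 0 by rewrite /z Y0 /phi1 ps0 mul0r rmorph0 mulr0 subr0.
have z10 : z1 0 = 0 by rewrite /z1 /d divfK // subrr.
have comp (C : R[i] -> R) : C 0 = 0 -> (forall y, der (fun t => C (z t)) y (C (z1 y))) ->
    (forall y, der (fun t => C (z1 t)) y (Up y * C (z y))) -> C (z x) = 0.
  move=> C0 h1 h2; apply: (second_order_unique h1 h2 Up_le (x0 := 0)).
    by rewrite z00.
  by rewrite z10.
have z0 : z x = 0.
  apply: complex_eq; apply: comp => // y; first by have [] := dz y.
  - by have [h _] := dz1 y; apply: (der_eq h); rewrite Re_mul /=; ring.
  - by have [] := dz y.
  - by have [_ h] := dz1 y; apply: (der_eq h); rewrite Im_mul /=; ring.
have -> : derive1 phi x = phi1 x by exact: derive1_val (dphi x).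
by apply/eqP; rewrite -subr_eq0 -/(z x) z0.
Qed.

End FixedFrequency.

(** * Small frequencies *)

Theorem corollary2 (R : realType) (g : R -> R) (phi : R -> R -> R)
    (g_H1 : hypH1 g)
    (phi_soliton : \forall omega \near 0^'+, is_soliton g omega (phi omega))
    (g_H2 : hypH2 g phi) :
  \forall omega \near 0^'+,
    forall (X Y : R -> R[i]) (lambda : R[i]),
      is_resonance g omega (phi omega) X Y lambda ->
      ({ae @lebesgue_measure R, forall x, X x = 0} /\
       {ae @lebesgue_measure R, forall x, Y x = 0})
      \/
      [/\ lambda = 0,
          exists c : R[i],
            {ae @lebesgue_measure R, forall x,
               X x = c * (phi omega x)%:C%C} &
          exists d : R[i],
            {ae @lebesgue_measure R, forall x,
               Y x = d * (derive1 (phi omega) x)%:C%C}].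
Proof.
have e64 : 0 < 64^-1 :> R by rewrite invr_gt0.
have e8 : 0 < 8^-1 :> R by rewrite invr_gt0.
have [b b0 g_small] := hypH1_g_small g_H1 e8.
have eps := epsilon_small g_H1 e64.
(* Any constant above 640 serves; a vanishing epsilon is thereby excluded, the
   inverse of 0 being 0. *)
move/cvgryPge : g_H2 => /(_ 641) H2.
have w_small : \forall omega \near 0^'+, 0 < omega < b / 3.
  by apply/at_right0P; exists (b / 3) => //; rewrite divr_gt0.
near=> omega.
have [w0 wb] : 0 < omega /\ omega < b / 3.
  by apply/andP; near: omega.
have sol : is_soliton g omega (phi omega) by near: omega.
have [e_small g2_le] : epsilon g omega <= 64^-1 /\
  forall s, 0 < s <= 3 * omega -> `|s * derive1n 2 g s| <= epsilon g omega.
  by near: omega.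
have int_large : 641 <= (epsilon g omega ^+ 2 * Num.sqrt omega)^-1 *
    \int[@lebesgue_measure R]_x
      (- 3 * g (phi omega x ^+ 2)
       + phi omega x ^+ 2 * derive1 g (phi omega x ^+ 2)
       + 4 * (primitive0 g (phi omega x ^+ 2) / phi omega x ^+ 2)).
  by near: omega.
have gs s : 0 < s <= 3 * omega -> `|g s| <= 8^-1 * s.
  by move=> /andP[s0 sw]; apply: g_small; rewrite s0 /=; lra.
set e := epsilon g omega in e_small g2_le int_large.
set I := Rintegral _ _ _ in int_large.
have repulsive : 640 * e ^+ 2 * Num.sqrt omega < I.
  have E0 : 0 <= e ^+ 2 * Num.sqrt omega by rewrite mulr_ge0 ?sqr_ge0 ?sqrtr_ge0.
  move: E0; rewrite le_eqVlt => /predU1P[E0|E0].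
    by move: int_large; rewrite -E0 invr0 mul0r; lra.
  move: int_large; rewrite mulrC ler_pdivlMr // => /(lt_le_trans _); apply.
  by rewrite -mulrA ltr_pM2r //; lra.
move=> X Y lam res.
have [x0 [x1 [y0 [y1 [Xx0 Yy0 lXY tXY]]]]] :=
  resonance_classical g_H1 w0 gs sol g2_le e_small res.
have [lam0|lam0] := eqVneq lam 0; last first.
  left; have triv := resonance_trivial g_H1 w0 gs sol g2_le e_small repulsive lXY tXY lam0.
  split.
    by apply: ae_imp Xx0 => x ->; have [] := triv x.
  by apply: ae_imp Yy0 => x ->; have [] := triv x.
right; subst lam; split => //.
- have [c Xc] := kernel_Lminus g_H1 w0 gs sol lXY tXY.
  by exists c; apply: ae_imp Xx0 => x ->.
- have [c Yc] := kernel_Lplus g_H1 w0 gs sol g2_le e_small lXY tXY.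
  by exists c; apply: ae_imp Yy0 => x ->.
Unshelve. all: by end_near. Qed.
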